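(* Let $G$ be a group in the list $\Lambda$ which has no direct factor isomorphic to $Z_4\rtimes(Z_2\times Z_2)$. Then $G$ satisfies weak rigidity: there exist a field $k$ and $\alpha\in H^2(G,k^\times)$ such that $k^\alpha G$ is a central simple $k$-algebra, and whenever $k^\alpha G\cong k^\beta H$ (as $k$-algebras) for some finite group $H$ and some $\beta\in H^2(H,k^\times)$, one has $H\cong G$.
   Context: Cohomology groups $H^2(G,k^\times)$ are taken with trivial action of $G$ on $k^\times$; $k^\alpha G$ denotes the twisted group algebra ($k$-basis $\{u_g\}_{g\in G}$, $u_gu_h=f(g,h)u_{gh}$ for a cocycle $f$ representing $\alpha$). $Z_m$ is the cyclic group of order $m$; an abelian group is of symmetric type if it is isomorphic to $H\times H$ for some abelian $H$. $Z_4\rtimes(Z_2\times Z_2)$ denotes $\langle \pi,\sigma,\tau\mid \pi^4=\sigma^2=\tau^2=1,\ \sigma\tau=\tau\sigma,\ \sigma\pi\sigma^{-1}=\pi^3,\ \tau\pi\tau^{-1}=\pi^{-1}\rangle$. The list $\Lambda$ is the set of finite $p$-groups $G$ of one of the forms: (1) $G$ abelian of symmetric type; (2) $G\cong G_1\times G_2$ with $G_1=\langle \pi,\sigma\mid \sigma^{p^n}=\pi^{p^n}=1,\ \sigma\pi\sigma^{-1}=\pi^{p^s+1}\rangle$, $1\le s<n$, $s\ne1$ if $p=2$, and $G_2$ abelian of symmetric type of exponent $\le p^s$; (3) $p=2$, $G\cong G_1\times G_2$ with $G_1=\langle \pi,\sigma,\tau\mid \pi^{2^{n+1}}=\sigma^{2^n}=\tau^2=1,\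 \sigma\tau=\tau\sigma,\ \sigma\pi\sigma^{-1}=\pi^3,\ \tau\pi\tau^{-1}=\pi^{-1}\rangle$ ($n\ge1$), and $G_2$ abelian of symmetric type of exponent $\le 2$. *)

(* Defs.v *)
From HB Require Import structures.
From mathcomp Require Import all_boot all_order all_algebra all_fingroup all_solvable.
Set Implicit Arguments. Unset Strict Implicit. Unset Printing Implicit Defensive.
Import GRing.Theory.

Local Open Scope group_scope.

Definition symmetric_type (gT : finGroupType) (G : {group gT}) : Prop :=
  abelian G /\ exists A B : {group gT}, (A \x B)%g = G /\ A \isog B.

Definition is_G1_type2 (gT : finGroupType) (K : {group gT}) (p n s : nat) : Prop :=
  K \isog Grp (pi : sigma : sigma ^+ (p ^ n), pi ^+ (p ^ n),
                             sigma * pi * sigma^-1 = pi ^+ (p ^ s).+1).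

Definition is_G1_type3 (gT : finGroupType) (K : {group gT}) (n : nat) : Prop :=
  K \isog Grp (pi : sigma : tau : pi ^+ (2 ^ n.+1), sigma ^+ (2 ^ n), tau ^+ 2,
                                   sigma * tau = tau * sigma,
                                   sigma * pi * sigma^-1 = pi ^+ 3,
                                   tau * pi * tau^-1 = pi^-1).

Definition is_Z4_Z2Z2 (gT : finGroupType) (K : {group gT}) : Prop :=
  K \isog Grp (pi : sigma : tau : pi ^+ 4, sigma ^+ 2, tau ^+ 2,
                                   sigma * tau = tau * sigma,
                                   sigma * pi * sigma^-1 = pi ^+ 3,
                                   tau * pi * tau^-1 = pi^-1).

Definition in_Lambda (gT : finGroupType) (G : {group gT}) : Prop :=
  exists p : nat, prime p /\ p.-group G /\
  [\/ symmetric_type G,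
      (exists n s : nat, exists K1 K2 : {group gT},
         [/\ (1 <= s < n)%N, ~~ ((p == 2) && (s == 1))%N,
             (K1 \x K2)%g = G, is_G1_type2 K1 p n s &
             symmetric_type K2 /\ (exponent K2 <= p ^ s)%N])
    | (p = 2%N /\ exists n : nat, exists K1 K2 : {group gT},
         [/\ (1 <= n)%N, (K1 \x K2)%g = G, is_G1_type3 K1 n,
             symmetric_type K2 & (exponent K2 <= 2)%N])].

Definition has_Z4_Z2Z2_factor (gT : finGroupType) (G : {group gT}) : Prop :=
  exists K L : {group gT}, (K \x L)%g = G /\ is_Z4_Z2Z2 K.

Local Close Scope group_scope.
Local Open Scope ring_scope.

Definition cocycle (k : fieldType) (gT : finGroupType) (f : gT -> gT -> k) : Prop :=
  (forall x y, f x y != 0) /\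
  (forall x y z, f x y * f (x * y)%g z = f y z * f x (y * z)%g).

(* elements of k^f G are functions G -> k: a = \sum_g a(g) u_g *)
Definition tga (k : fieldType) (gT : finGroupType) := {ffun gT -> k}.

Definition tadd (k : fieldType) (gT : finGroupType) (a b : tga k gT) : tga k gT :=
  [ffun x => a x + b x].
Definition tscale (k : fieldType) (gT : finGroupType) (c : k) (a : tga k gT) : tga k gT :=
  [ffun x => c * a x].
Definition tzero (k : fieldType) (gT : finGroupType) : tga k gT := [ffun _ => 0].

(* product induced by u_x u_y = f(x,y) u_{xy} *)
Definition tmul (k : fieldType) (gT : finGroupType) (f : gT -> gT -> k)
    (a b : tga k gT) : tga k gT :=
  [ffun z => \sum_(x : gT) a x * b (x^-1 * z)%g * f x (x^-1 * z)%g].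

Definition tone (k : fieldType) (gT : finGroupType) (f : gT -> gT -> k) : tga k gT :=
  [ffun x => if x == 1%g then (f 1%g 1%g)^-1 else 0].

Definition central_simple (k : fieldType) (gT : finGroupType) (f : gT -> gT -> k) : Prop :=
  (forall z : tga k gT, (forall a, tmul f z a = tmul f a z) ->
      exists c : k, z = tscale c (tone f)) /\
  tone f <> tzero k gT /\
  (forall I : tga k gT -> Prop,
     I (tzero k gT) ->
     (forall a b, I a -> I b -> I (tadd a b)) ->
     (forall a b, I a -> I (tmul f b a)) ->
     (forall a b, I a -> I (tmul f a b)) ->
     (forall a, I a -> a = tzero k gT) \/ (forall a, I a)).

Definition tga_iso (k : fieldType) (gT hT : finGroupType)
    (f : gT -> gT -> k) (g : hT -> hT -> k) : Prop :=
  exists phi : tga k gT -> tga k hT,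
    bijective phi /\
    (forall c a b, phi (tadd (tscale c a) b) = tadd (tscale c (phi a)) (phi b)) /\
    (forall a b, phi (tmul f a b) = tmul g (phi a) (phi b)) /\
    phi (tone f) = tone g.

(* Main.v *)
Require Import Defs.
From HB Require Import structures.
From mathcomp Require Import all_boot all_order all_algebra all_fingroup all_solvable.
From mathcomp Require Import all_field zify ring.
From mathcomp.multinomials Require Import mpoly.
From Stdlib Require Import Classical.

(** The field [k] is a rational function field over a field [k0], and [k^f G] is a division
    algebra whose cocycle is [f = f0 * X^carry] with [f0] taking values in [k0]: the residue
    field of the algebra is a cyclotomic extension [L = k0(z)], spanned by the powers of [pi],
    and [sigma], [tau] and the symmetric factor contribute roots of the variables.  Leading
    terms show that [k^f G] is a domain with centre [k].  If [k^g H] is isomorphic to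
    [k^f G], the basis of [H] has trace zero away from [1], hence so do its leading terms;
    these form a projective basis of the crossed product [k0^f0 G], homogeneous for the
    quotient of [G] by [<pi>].  So [H] embeds in the group of homogeneous units modulo [k0^*].
    There the torsion of [L^*/k0^*] is computed from the cocycles [s(y)/y], which are roots
    of unity: it is generated by [z] for the modular groups, and by [z] and [sqrt -2] for the
    third family.  This determines [H] up to isomorphism, except that [sqrt -2] could enter
    when [G] has a factor [Z4 : (Z2 x Z2)]; for larger cyclic parts [sqrt -2] already lies in
    the span of [z^2], which contradicts the trace condition. *)

Set Implicit Arguments. Unset Strict Implicit. Unset Printing Implicit Defensive.
Import Order.TTheory GRing.Theory.

(** * Arithmetic and pairings *)

(** The trace condition is the only link between the unknown cocycle on [H] and the algebra of [G];
    reading it off needs characteristic zero. After passage to leading terms, the homogeneous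
    elements of a given degree form a line over [L], so a basis element is a degree together with a
    class of [L] modulo the scalars. Here [k0] is not a number field but the full fixed field of [s]
    and [t] in [algC], where these morphisms are known only on some roots of unity. Their exponents
    are therefore prescribed on one layer of roots of unity more than [z] requires; this bounds the
    roots of unity of p-power order in [L]. The extra torsion class is [sqrt -2 = e + e^3] with [e]
    of order 8: [s] takes [e] to its cube and fixes the sum, while [t] negates it. No isomorphism is
    written down by hand: orders are squeezed between two counts, and a model semidirect product,
    which has an evident projective basis, is identified with [G] by the very classification that is
    applied to [H]. *)

Lemma expn_one_add x m :
  exists y, (1 + x) ^ m = 1 + m * x + 'C(m, 2) * x ^ 2 + x ^ 3 * y.
Proof.
elim: m => [|m [y IH]]; first by exists 0; rewrite expn0 mul0n bin0n muln0.
exists (y + 'C(m, 2) + x * y); rewrite expnSr IH binS bin1; nia.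
Qed.

(** The linear term of the binomial expansion has the smallest valuation: for odd [p] because [p]
    divides ['C(p, 2)], and for [p = 2] because [2 * t >= t + 2], which fails exactly in the
    excluded case [t = 1]. *)
Lemma expn_one_add_pfactor p t u : prime p -> 0 < t ->
    ~~ ((p == 2) && (t == 1)) -> ~~ (p %| u) ->
  exists2 v, ~~ (p %| v) & (1 + p ^ t * u) ^ p = 1 + p ^ t.+1 * v.
Proof.
move=> pP t0 pt pu.
have [w def_w] : exists w, (1 + p ^ t * u) ^ p = 1 + p ^ t.+1 * (u + p * w).
  case: (eqVneq p 2) pt => [p2 /= t1|p2 _].
    subst p; case: t t0 t1 => [|[|t]] // _ _.
    exists (2 ^ t * u ^ 2); rewrite !expnS expn0; nia.
  have p3 : 2 < p by have := prime_gt1 pP; lia.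
  have [c def_c] : exists c, 'C(p, 2) = c * p.
    by apply/dvdnP; apply: prime_dvd_bin pP _; rewrite p3.
  have [y ->] := expn_one_add (p ^ t * u) p.
  case: t t0 => // t _.
  exists (p ^ t * c * u ^ 2 + p ^ t * p ^ t * u ^ 3 * y).
  rewrite def_c !expnS expn0; nia.
exists (u + p * w) => //.
by rewrite dvdn_addl // dvdn_mulr.
Qed.

Lemma expn_one_add_pfactorX p t m : prime p -> 0 < t ->
    ~~ ((p == 2) && (t == 1)) ->
  exists2 v, ~~ (p %| v) & (1 + p ^ t) ^ (p ^ m) = 1 + p ^ (t + m) * v.
Proof.
move=> pP t0 pt; elim: m => [|m [v pv IH]].
  by exists 1; [rewrite Euclid_dvd1 | rewrite expn0 expn1 addn0 muln1].
have [||w pw def_w] := @expn_one_add_pfactor p (t + m) v pP _ _ pv.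
- by rewrite addn_gt0 t0.
- by apply: contra pt => /andP[-> /eqP tm]; apply/eqP; lia.
by exists w; rewrite // expnSr expnM IH def_w addnS.
Qed.

(** Splitting off the [p]-part of [m] and reducing modulo the next power of [p] leaves a single term
    prime to [p]. This makes the powers of [s] distinct on [z]. *)
Lemma expn_one_add_neq1 p t m k : prime p -> 0 < t ->
    ~~ ((p == 2) && (t == 1)) -> 0 < m < p ^ k ->
  (1 + p ^ t) ^ m != 1 %[mod p ^ (t + k)].
Proof.
move=> pP t0 pt /andP[m0 mk].
have p0 := prime_gt0 pP.
have [m' pm' def_m] := pfactor_coprime pP m0.
have ltk : logn p m < k.
  rewrite -(ltn_exp2l _ _ (prime_gt1 pP)); apply: leq_ltn_trans mk.
  by rewrite dvdn_leq // pfactor_dvdnn.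
have [v pv def_v] := expn_one_add_pfactorX (logn p m) pP t0 pt.
rewrite def_m mulnC expnM def_v.
set e := t + logn p m in def_v *.
have [y ->] := expn_one_add (p ^ e * v) m'.
have e0 : 0 < e by rewrite addn_gt0 t0.
have dv : p ^ e.+1 %| p ^ (t + k) by apply: dvdn_exp2l; rewrite /e; lia.
apply/negP => /eqP /(congr1 (modn^~ (p ^ e.+1))).
rewrite !modn_dvdm // => /eqP.
case: e e0 dv def_v => // e _ _ _.
have -> : 1 + m' * (p ^ e.+1 * v) + 'C(m', 2) * (p ^ e.+1 * v) ^ 2 +
    (p ^ e.+1 * v) ^ 3 * y = m' * v * p ^ e.+1 + ('C(m', 2) * p ^ e * v ^ 2 +
    p ^ e * p ^ e.+1 * v ^ 3 * y) * p ^ e.+2 + 1.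
  by rewrite !expnS expn0; nia.
rewrite -[X in _ == X %[mod _]]add0n eqn_modDr addnC modnMDl mod0n -/(dvdn _ _) expnSr.
rewrite -mulnA [v * _]mulnC mulnCA dvdn_pmul2l ?expn_gt0 ?p0 //.
rewrite Euclid_dvdM // (negPf pv) orbF => pm; move: pm'.
by rewrite prime_coprime // pm.
Qed.

(** The sum is [(1 + p ^ t) ^ (p ^ k) - 1] divided by [p ^ t]. Its valuation later turns a norm
    condition on roots of unity into a divisibility of exponents. *)
Lemma sum_expn_one_add p t k : prime p -> 0 < t ->
    ~~ ((p == 2) && (t == 1)) ->
  exists2 v, ~~ (p %| v) & \sum_(i < p ^ k) (1 + p ^ t) ^ i = p ^ k * v.
Proof.
move=> pP t0 pt; have [v pv def_v] := expn_one_add_pfactorX k pP t0 pt.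
exists v => //; have p0 := prime_gt0 pP.
apply/eqP; rewrite -(eqn_pmul2l (_ : 0 < p ^ t)) ?expn_gt0 ?p0 //.
have := predn_exp (1 + p ^ t) (p ^ k); rewrite def_v add1n add1n /= => <-.
by rewrite expnD mulnA.
Qed.

(** * Nondegenerate pairings on finite abelian groups *)

Section Pairing.

Variable gT : finGroupType.

(** A nondegenerate symmetric form with values in [Z/d], kept in natural numbers so that its values
    can be exponents: of a root of unity in the cocycle of the symmetric factor, and of the
    monomials that separate degrees. *)
Definition pairing_on (d : nat) (A : {group gT}) (B : gT -> gT -> nat) :=
  [/\ {in A & &, forall x y z, B (x * y)%g z = B x z + B y z %[mod d]},
      {in A &, forall x y, B x y = B y x} &
      {in A, forall x, {in A, forall y, d %| B x y} -> x = 1%g}].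

Lemma pairing_cycle d (x : gT) : 0 < d -> #[x]%g %| d ->
  exists B, pairing_on d <[x]> B.
Proof.
move=> d0 /dvdnP[c def_d].
have c0 : 0 < c by move: d0; rewrite def_d muln_gt0 => /andP[].
(* The discrete logarithm to the base [x]; the form will be [lg y * lg z * (d / #[x])]. *)
pose lg y := index y [seq x ^+ i | i <- iota 0 #[x]]%g.
have lgP y : y \in <[x]>%g -> (x ^+ lg y)%g = y.
  move=> /cyclePmin[m ltm ->].
  have xm : (x ^+ m)%g \in [seq x ^+ i | i <- iota 0 #[x]]%g.
    by apply/map_f; rewrite mem_iota.
  have := nth_index 1%g xm; rewrite (nth_map 0) ?nth_iota ?add0n //.
    by have := xm; rewrite -index_mem size_map size_iota.
  by have := xm; rewrite -index_mem size_map.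
have lgM y z : y \in <[x]>%g -> z \in <[x]>%g ->
    lg (y * z)%g = lg y + lg z %[mod #[x]%g].
  move=> yx zx; apply/eqP; rewrite -eq_expg_mod_order expgD !lgP //.
  by rewrite groupM.
exists (fun y z => lg y * lg z * c); split.
- move=> y z w yx zx wx; apply/eqP; rewrite def_d -mulnDl -mulnDl.
  rewrite [c * _]mulnC -!muln_modl eqn_pmul2r //.
  by rewrite -modnMml lgM // modnMml.
- by move=> y z _ _; rewrite [lg y * _]mulnC.
move=> y yx /(_ x (cycle_id x)); rewrite def_d [c * _]mulnC dvdn_pmul2r //.
rewrite Gauss_dvdl => [|].
  by rewrite order_dvdn => /eqP; rewrite lgP.
have : (x ^+ lg x == x ^+ 1)%g by rewrite lgP ?cycle_id.
rewrite eq_expg_mod_order => /eqP /(congr1 (gcdn^~ #[x]%g)).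
by rewrite !gcdn_modl gcd1n /coprime gcdnC => ->.
Qed.

Lemma pairing_dprod d (A A1 A2 : {group gT}) B1 B2 : (A1 \x A2)%g = A ->
    pairing_on d A1 B1 -> pairing_on d A2 B2 ->
  exists B, pairing_on d A B.
Proof.
move=> defA [add1 sym1 nd1] [add2 sym2 nd2].
have [_ defM cA12 tiA12] := dprodP defA.
have cplA : A2 \in [complements to A1 in A]%g.
  by apply/complP; split.
pose f := divgr A1 A2; pose g := remgr A1 A2.
have fA x : x \in A -> f x \in A1 by rewrite -defM; apply: mem_divgr.
have gA x : x \in A -> g x \in A2 by rewrite -defM; apply: mem_remgr.
have fM : {in A &, {morph f : x y / (x * y)%g}}.
  by apply: divgrM => //.
have gM : {in A &, {morph g : x y / (x * y)%g}}.
  by apply: remgrM => //; have [] := dprod_normal2 defA.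
exists (fun x y => B1 (f x) (f y) + B2 (g x) (g y)); split.
- move=> x y z Ax Ay Az; rewrite fM // gM // -modnDm add1 ?add2 ?fA ?gA //.
  by rewrite modnDm addnACA.
- by move=> x y Ax Ay; rewrite (sym1 _ _ (fA x Ax) (fA y Ay)) (sym2 _ _ (gA x Ax) (gA y Ay)).
have B10 x : x \in A1 -> B1 x 1%g = 0 %[mod d].
  move=> A1x; apply/eqP; rewrite sym1 ?group1 //.
  have /eqP := add1 1%g 1%g x (group1 _) (group1 _) A1x.
  by rewrite mulg1 -[X in X == _ %[mod _]]addn0 eqn_modDl eq_sym.
have B20 x : x \in A2 -> B2 x 1%g = 0 %[mod d].
  move=> A2x; apply/eqP; rewrite sym2 ?group1 //.
  have /eqP := add2 1%g 1%g x (group1 _) (group1 _) A2x.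
  by rewrite mulg1 -[X in X == _ %[mod _]]addn0 eqn_modDl eq_sym.
move=> x Ax dx; have fx1 : f x = 1%g.
  apply: nd1 => [|y Ay]; first exact: fA.
  have Ay' : y \in A by rewrite -defM -[y]mulg1 mem_mulg.
  move: (dx _ Ay'); rewrite /f /g -{1 2}[y]mulg1.
  rewrite divgrMid // remgrMid // /dvdn -modnDmr B20 ?gA //.
  by rewrite mod0n addn0.
have gx1 : g x = 1%g.
  apply: nd2 => [|y Ay]; first exact: gA.
  have Ay' : y \in A by rewrite -defM -[y]mul1g mem_mulg.
  move: (dx _ Ay'); rewrite /f /g -{1 2}[y]mul1g.
  rewrite divgrMid // remgrMid // /dvdn -modnDml B10 ?fA //.
  by rewrite mod0n.
by rewrite [x](divgr_eq A1 A2) -/(f x) -/(g x) fx1 gx1 mulg1.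
Qed.

Lemma pairing_exists d (A : {group gT}) : 0 < d -> abelian A ->
  exponent A %| d -> exists B, pairing_on d A B.
Proof.
move=> d0 /abelian_structure[b defA _].
elim: b A defA => [A|x b IH A].
  rewrite big_nil => A1 _; exists (fun _ _ => 0); split=> // x.
  by rewrite -A1 => /set1gP.
rewrite big_cons => defA dA.
have [[_ A2 _ defA2] _ _ _] := dprodP defA.
rewrite defA2 in defA; have [sx sA2] := mulG_sub (dprodW defA).
have [B2 pB2] := IH _ defA2 (dvdn_trans (exponentS sA2) dA).
have [|B1 pB1] := @pairing_cycle d x d0.
  by apply: dvdn_trans (dvdn_exponent _) dA; rewrite (subsetP sx) ?cycle_id.
by apply: pairing_dprod defA pB1 pB2.
Qed.

End Pairing.

(** * Presentations of the nonabelian factors *)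

Section Presentations.
Local Open Scope group_scope.

Lemma leq_order_exp (gT : finGroupType) (x : gT) m : (0 < m)%N -> x ^+ m = 1 -> (#[x] <= m)%N.
Proof. by move=> m0 /eqP; rewrite -order_dvdn; apply: dvdn_leq. Qed.

Lemma leq_card_join (gT : finGroupType) (H K : {group gT}) :
  K \subset 'N(H) -> (#|H <*> K| <= #|H| * #|K|)%N.
Proof. by move=> nHK; rewrite norm_joinEr // dvdn_leq ?dvdn_cardMg ?muln_gt0 ?cardG_gt0. Qed.

Lemma norm_cycle_conj (gT : finGroupType) (x y : gT) m :
  y * x * y^-1 = x ^+ m -> <[y]> \subset 'N(<[x]>).
Proof.
move=> yx; rewrite -cycleV norms_cycle conjgE invgK mulgA yx.
exact: mem_cycle.
Qed.

(** The generator [1] gives the subgroup the same three-generator shape as in the third family, so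
    that one assembly argument serves both. *)
Lemma type2_homg (gT hT : finGroupType) (K1 : {group gT}) p n s (x y : hT) :
    is_G1_type2 K1 p n s -> x ^+ (p ^ n) = 1 -> y ^+ (p ^ n) = 1 ->
    y * x * y^-1 = x ^+ (p ^ s).+1 -> <<[set x; y; 1]>> \homg K1.
Proof.
move=> isoK1 xn yn yx; rewrite isoK1; apply/existsP; exists (x, y) => /=.
rewrite xn yn yx !xpair_eqE !eqxx !andbT; apply/eqP.
rewrite /cycle joing_idl joing_idr; apply/eqP; rewrite eqEsubset !gen_subG.
rewrite !subUset !sub1set group1 !andbT.
by rewrite !mem_gen // !inE eqxx ?orbT.
Qed.

Lemma type2_card (gT : finGroupType) (K1 : {group gT}) p n s : (0 < p)%N ->
  is_G1_type2 K1 p n s -> (#|K1| <= p ^ n * p ^ n)%N.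
Proof.
move=> p0 /isoGrp_hom/existsP[[x y] /=]; rewrite !xpair_eqE.
case/and4P=> /eqP <- /eqP yn /eqP xn /eqP yx.
have pn0 : (0 < p ^ n)%N by rewrite expn_gt0 p0.
apply: leq_trans (leq_card_join (norm_cycle_conj yx)) _.
by apply: leq_mul; apply: leq_order_exp.
Qed.

Lemma type3_homg (gT hT : finGroupType) (K1 : {group gT}) n (x y w : hT) :
    is_G1_type3 K1 n -> x ^+ (2 ^ n.+1) = 1 -> y ^+ (2 ^ n) = 1 -> w ^+ 2 = 1 ->
    y * w = w * y -> y * x * y^-1 = x ^+ 3 -> w * x * w^-1 = x^-1 ->
  <<[set x; y; w]>> \homg K1.
Proof.
move=> isoK1 xn yn w2 yw yx wx; rewrite isoK1; apply/existsP; exists (x, y, w) => /=.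
rewrite xn yn w2 yw yx wx !xpair_eqE !eqxx !andbT.
rewrite eqEsubset; apply/andP; split.
  by rewrite !join_subG !cycle_subG !mem_gen // !inE eqxx ?orbT.
rewrite gen_subG !subUset !sub1set -!cycle_subG joing_subr andbT -join_subG.
exact: joing_subl.
Qed.

Lemma type3_card (gT : finGroupType) (K1 : {group gT}) n :
  is_G1_type3 K1 n -> (#|K1| <= 2 ^ n.+1 * (2 ^ n * 2))%N.
Proof.
move=> /isoGrp_hom/existsP[[[x y] w] /=]; rewrite !xpair_eqE.
case/and5P=> /eqP <- /eqP xn /eqP yn /eqP wn /and3P[/eqP yw /eqP yx /eqP wx].
apply: leq_trans (leq_card_join _) _.
  apply: normsY.
    by apply: (norm_cycle_conj (m := #[x].-1)); rewrite wx invg_expg.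
  by apply: cents_norm; rewrite cent_cycle cycle_subG; apply/cent1P.
rewrite mulnA; apply: leq_mul; last exact: leq_order_exp.
apply: leq_trans (leq_card_join (norm_cycle_conj yx)) _.
by apply: leq_mul; apply: leq_order_exp; rewrite ?expn_gt0.
Qed.

End Presentations.

Local Open Scope ring_scope.

(** * Twisted group algebras *)

Lemma ffun_inj_surj (k : fieldType) (T : finType)
    (F : {ffun T -> k} -> {ffun T -> k}) :
    (forall c (a b : {ffun T -> k}),
       F ([ffun x => c * a x + b x]) = [ffun x => c * F a x + F b x]) ->
    (forall a, F a = [ffun=> 0] -> a = [ffun=> 0]) ->
  forall b, exists a, F a = b.
Proof.
move=> Flin Finj b.
pose V : vectType k := {ffun T -> k^o}.
have Fl : linear (F : V -> V).
  move=> c u v; rewrite (_ : c *: u + v = [ffun x => c * u x + v x]) ?Flin.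
    by apply/ffunP => x; rewrite !ffunE.
  by apply/ffunP => x; rewrite !ffunE.
pose L : {linear V -> V} := HB.pack (F : V -> V) (GRing.isLinear.Build k V V *:%R F Fl).
have ker0 : lker (linfun L) == 0%VS.
  apply/lker0P => u v; rewrite !lfunE /= => Fuv.
  apply/eqP; rewrite -subr_eq0; apply/eqP.
  have -> : 0 = [ffun=> 0] :> V by apply/ffunP => x; rewrite !ffunE.
  apply: Finj; rewrite -[F _]/(L _) raddfB /= Fuv subrr.
  by apply/ffunP => x; rewrite !ffunE.
exists ((linfun L)^-1%VF (b : V)).
by have := lker0_lfunVK ker0 (b : V); rewrite lfunE.
Qed.

Section TwistedGroupAlgebra.

Variables (k : fieldType) (gT : finGroupType) (f : gT -> gT -> k).
Hypothesis f_cocycle : cocycle f.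

Implicit Types a b v : tga k gT.

Definition tbase (g : gT) : tga k gT := [ffun x => (x == g)%:R].

Lemma cocycle_neq0 x y : f x y != 0. Proof. by case: f_cocycle. Qed.

Lemma cocycle1g x : f 1%g x = f 1%g 1%g.
Proof.
have [f0 fC] := f_cocycle; have := fC 1%g 1%g x.
by rewrite !mulg1 !mul1g => /(mulIf (f0 _ _)).
Qed.

Lemma cocycleg1 x : f x 1%g = f 1%g 1%g.
Proof.
have [f0 fC] := f_cocycle; have := fC x 1%g 1%g.
by rewrite !mulg1 => /(mulIf (f0 _ _)).
Qed.

Lemma tbase_neq0 g : tbase g != tzero k gT.
Proof. by apply/eqP => /ffunP/(_ g)/eqP; rewrite !ffunE eqxx oner_eq0. Qed.

Lemma tmulE a b z :
  tmul f a b z = \sum_(y : gT) a (z * y^-1)%g * b y * f (z * y^-1)%g y.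
Proof.
rewrite ffunE (reindex_inj (inj_comp (mulgI z) invg_inj)) /=.
by apply: eq_bigr => y _; rewrite invMg invgK mulgKV.
Qed.

Lemma tmul_basel g b z : tmul f (tbase g) b z = b (g^-1 * z)%g * f g (g^-1 * z)%g.
Proof.
rewrite ffunE (bigD1 g) //= ffunE eqxx mul1r big1 ?addr0 //.
by move=> x /negPf xg; rewrite ffunE xg !mul0r.
Qed.

Lemma tmul_baser g a z : tmul f a (tbase g) z = a (z * g^-1)%g * f (z * g^-1)%g g.
Proof.
rewrite tmulE (bigD1 g) //= ffunE eqxx mulr1 big1 ?addr0 //.
by move=> x /negPf xg; rewrite ffunE xg mulr0 mul0r.
Qed.

Lemma tmul_base x y : tmul f (tbase x) (tbase y) = tscale (f x y) (tbase (x * y)%g).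
Proof.
apply/ffunP => z; rewrite tmul_basel !ffunE mulrC.
rewrite (canF_eq (mulKVg x)); case: eqP => [->|_]; first by rewrite mulKg.
by rewrite !mulr0.
Qed.

Lemma tmul1 a : tmul f (tone f) a = a.
Proof.
apply/ffunP => z; rewrite ffunE (bigD1 1%g) //= ffunE eqxx.
rewrite invg1 mul1g cocycle1g mulrAC mulVf ?cocycle_neq0 // mul1r.
by rewrite big1 ?addr0 // => x /negPf x1; rewrite ffunE x1 !mul0r.
Qed.

Lemma tmult1 a : tmul f a (tone f) = a.
Proof.
apply/ffunP => z; rewrite tmulE (bigD1 1%g) //= ffunE eqxx.
rewrite invg1 mulg1 cocycleg1 mulfVK ?cocycle_neq0 //.
by rewrite big1 ?addr0 // => x /negPf x1; rewrite ffunE x1 mulr0 mul0r.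
Qed.

Lemma tmulZl c a b : tmul f (tscale c a) b = tscale c (tmul f a b).
Proof.
apply/ffunP => z; rewrite !ffunE mulr_sumr.
by apply: eq_bigr => x _; rewrite ffunE !mulrA.
Qed.

Lemma tmulZr c a b : tmul f a (tscale c b) = tscale c (tmul f a b).
Proof.
apply/ffunP => z; rewrite !ffunE mulr_sumr.
by apply: eq_bigr => x _; rewrite ffunE !mulrA [a x * c]mulrC.
Qed.

Lemma tmulDl a a' b : tmul f (tadd a a') b = tadd (tmul f a b) (tmul f a' b).
Proof.
apply/ffunP => z; rewrite !ffunE -big_split.
by apply: eq_bigr => x _; rewrite ffunE !mulrDl.
Qed.

Lemma tmulDr a b b' : tmul f a (tadd b b') = tadd (tmul f a b) (tmul f a b').
Proof.
apply/ffunP => z; rewrite !ffunE -big_split.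
by apply: eq_bigr => x _; rewrite ffunE mulrDr !mulrDl.
Qed.

(** In the basis [u_x] the diagonal entry of left multiplication by [a] at [x] is [a 1 * f 1 x], and
    [f 1 x] does not depend on [x]. *)
Lemma tmul_trace a :
  \sum_x tmul f a (tbase x) x = #|gT|%:R * (a 1%g * f 1%g 1%g).
Proof.
rewrite (eq_bigr (fun=> a 1%g * f 1%g 1%g)).
  by rewrite sumr_const mulr_natl; congr (_ *+ _); apply: eq_card.
by move=> x _; rewrite tmul_baser mulgV cocycle1g.
Qed.

Definition tdomain := forall a b,
  a != tzero k gT -> b != tzero k gT -> tmul f a b != tzero k gT.

Lemma tdomain_inv : tdomain -> forall a, a != tzero k gT ->
  exists b, tmul f a b = tone f.
Proof.
move=> dom a a0; apply: ffun_inj_surj => [c u v|u].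
  apply/ffunP => z; rewrite !ffunE mulr_sumr -big_split.
  by apply: eq_bigr => x _; rewrite !ffunE mulrDr !mulrDl !mulrA [a x * c]mulrC.
by move=> au0; apply/eqP/negPn/negP => /(dom _ _ a0)/eqP; apply.
Qed.

(** Subtracting the scalar [z 1 * f 1 1] reduces the centre to elements with coefficient [0] at [1];
    simplicity holds because nonzero elements have right inverses. *)
Lemma tdomain_central_simple : tdomain ->
    (forall z, (forall a, tmul f z a = tmul f a z) -> z 1%g = 0 ->
       z = tzero k gT) ->
  central_simple f.
Proof.
move=> dom cen; split=> [z zC|]; last split.
- pose c := z 1%g * f 1%g 1%g; exists c.
  have /ffunP z0 : tadd (tscale (- c) (tone f)) z = tzero k gT.
    apply: cen => [a|].
      by rewrite tmulDl tmulDr tmulZl tmulZr tmul1 tmult1 zC.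
    by rewrite !ffunE eqxx mulNr mulfK ?cocycle_neq0 // addNr.
  apply/ffunP => x; move: (z0 x); rewrite !ffunE mulNr => /eqP.
  by rewrite addrC subr_eq0 => /eqP.
- move=> /ffunP/(_ 1%g)/eqP; rewrite !ffunE eqxx invr_eq0.
  by rewrite (negPf (cocycle_neq0 _ _)).
move=> I I0 ID Il Ir.
have [[a [Ia /eqP a0]]|nI] := classic (exists a, I a /\ a <> tzero k gT); last first.
  by left=> a Ia; apply: NNPP => a0; case: nI; exists a.
by right=> b; have [c ac] := tdomain_inv dom a0; rewrite -(tmul1 b) -ac; auto.
Qed.

End TwistedGroupAlgebra.

(** * Traces and isomorphisms of twisted group algebras *)

Definition tlinear (k : fieldType) (gT hT : finGroupType)
    (F : tga k gT -> tga k hT) :=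
  forall c a b, F (tadd (tscale c a) b) = tadd (tscale c (F a)) (F b).

Lemma tlinearE (k : fieldType) (gT hT : finGroupType)
    (F : tga k gT -> tga k hT) : tlinear F ->
  forall a y, F a y = \sum_x a x * F (tbase k x) y.
Proof.
move=> Flin a y.
pose V : vectType k := {ffun gT -> k^o}; pose W : vectType k := {ffun hT -> k^o}.
have Fl : linear (F : V -> W).
  move=> c u v; rewrite (_ : c *: u + v = tadd (tscale c u) v) ?Flin.
    by apply/ffunP => x; rewrite !ffunE.
  by apply/ffunP => x; rewrite !ffunE.
pose L : {linear V -> W} :=
  HB.pack (F : V -> W) (GRing.isLinear.Build k V W *:%R F Fl).
have def_a : (a : V) = \sum_x a x *: (tbase k x : V).
  apply/ffunP => z; rewrite sum_ffunE (bigD1 z) //= !ffunE eqxx -[_ *: _]/(_ * _) mulr1.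
  by rewrite big1 ?addr0 // => x /negPf xz; rewrite !ffunE eq_sym xz scaler0.
rewrite -[F a]/(L a) [in LHS]def_a linear_sum sum_ffunE.
by apply: eq_bigr => x _; rewrite linearZ ffunE.
Qed.

(** Both sides are the trace of [F], computed in the basis of [hT] carried over by [psi] and in the
    basis of [gT]. *)
Lemma ttrace_conj (k : fieldType) (gT hT : finGroupType)
    (phi : tga k gT -> tga k hT) (psi : tga k hT -> tga k gT)
    (F : tga k gT -> tga k gT) :
    tlinear phi -> tlinear psi -> tlinear F -> cancel phi psi ->
  \sum_y phi (F (psi (tbase k y))) y = \sum_x F (tbase k x) x.
Proof.
move=> phil psil Fl phiK.
under eq_bigr => y _ do rewrite (tlinearE phil).
rewrite exchange_big /=; apply: eq_bigr => x _.
have Fpsil : tlinear (F \o psi) by move=> c a b /=; rewrite psil Fl.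
rewrite -{2}(phiK (tbase k x)) -[F (psi _)]/((F \o psi) _) (tlinearE Fpsil).
by apply: eq_bigr => y _; rewrite mulrC.
Qed.

Section Isomorphism.

Variables (k : fieldType) (gT hT : finGroupType).
Variables (f : gT -> gT -> k) (g : hT -> hT -> k).
Hypotheses (f_cocycle : cocycle f) (k0 : [pchar k] =i pred0).

Lemma tmul_linear (a : tga k gT) : tlinear (tmul f a).
Proof. by move=> c b d; rewrite tmulDr tmulZr. Qed.

(* The trace of left multiplication is an invariant of the algebra; it kills the
   nontrivial elements of any projective basis. *)
Lemma tga_iso_basis : tga_iso f g ->
  #|hT| = #|gT| /\
  exists v : hT -> tga k gT,
    [/\ forall h, v h != tzero k gT,
        forall h h', tmul f (v h) (v h') = tscale (g h h') (v (h * h')%g) &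
        forall h, h != 1%g -> v h 1%g = 0].
Proof.
case=> phi [[psi phiK psiK] [phil [phiM phi1]]].
have natk n : (n%:R == 0 :> k) = (n == 0)%N by move: n; apply/pcharf0P.
have psil : tlinear psi.
  by move=> c a b; apply: (can_inj phiK); rewrite phil !psiK.
have cardE : #|hT| = #|gT|.
  have idl : tlinear (@id (tga k gT)) by [].
  (* The trace of the identity is the dimension, and in characteristic zero it determines the order
     of the group. *)
  have := ttrace_conj phil psil idl phiK.
  under eq_bigr => y _ do rewrite psiK ffunE eqxx.
  under [RHS]eq_bigr => y _ do rewrite ffunE eqxx.
  rewrite !sumr_const => /eqP.
  have natI : injective (GRing.natmul (1 : k)).
    move=> m n; wlog lemn : m n / (m <= n)%N => [wlog mn|/eqP].
      by case/orP: (leq_total m n) => [/wlog|/wlog/(_ (esym mn))]; auto.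
    by rewrite eq_sym -subr_eq0 -natrB // natk subn_eq0 => nm; apply/eqP; rewrite eqn_leq lemn.
  by move=> /eqP/natI; rewrite !cardT !enumT.
split=> //; exists (fun h => psi (tbase k h)); split.
- move=> h; apply/eqP => /(congr1 phi); rewrite psiK => h0.
  have /eqP[] := tbase_neq0 k h; rewrite h0; apply/ffunP => x.
  by rewrite (tlinearE phil) big1 ?ffunE // => y _; rewrite ffunE mul0r.
- move=> h h'; apply: (can_inj phiK); rewrite phiM !psiK tmul_base.
  have := phil (g h h') (psi (tbase k (h * h')%g)) (tzero k gT).
  rewrite (_ : phi (tzero k gT) = tzero k hT).
    rewrite psiK => E; transitivity (tadd (tscale (g h h') (tbase k (h * h')%g)) (tzero k hT)).
      by apply/ffunP => x; rewrite !ffunE addr0.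
    by rewrite -E; congr phi; apply/ffunP => x; rewrite !ffunE addr0.
  apply/ffunP => x; rewrite (tlinearE phil) big1 ?ffunE // => y _.
  by rewrite ffunE mul0r.
move=> h h1; set v := psi _.
have := ttrace_conj phil psil (tmul_linear v) phiK.
rewrite tmul_trace // big1 => [/esym/eqP|y _].
  rewrite !mulf_eq0 natk (negPf (cocycle_neq0 f_cocycle _ _)) orbF.
  have /negPf-> : (#|gT| != 0)%N by rewrite -lt0n; apply/card_gt0P; exists 1%g.
  by move/eqP.
rewrite phiM !psiK tmul_base !ffunE; case: eqP => [/esym yh|]; rewrite ?mulr0 //.
by case/eqP: h1; apply: (mulIg y); rewrite mul1g.
Qed.
End Isomorphism.

(** * Leading terms *)

Local Notation "x %:F" := (@FracField.tofrac _ x).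

Lemma fraction_num_den (R : idomainType) (x : {fraction R}) :
  exists n d : R, d != 0 /\ d%:F * x = n%:F.
Proof.
elim/quotW: x => x; exists (frac x).1, (frac x).2; split; first exact: denom_ratioP.
rewrite -[_ * _]/(FracField.mul _ _) !piE; apply/eqmodP.
rewrite /= FracField.equivfE /FracField.mulf.
have dx := denom_ratioP x.
by rewrite !numden_Ratio ?mulr1 ?mul1r ?oner_neq0 // mulrC.
Qed.

Lemma numerator_neq0 (R : idomainType) (d p : R) (x : {fraction R}) :
  d != 0 -> x != 0 -> d%:F * x = p%:F -> p != 0.
Proof. by move=> d0 x0 dx; rewrite -tofrac_eq0 -dx mulf_neq0 // tofrac_eq0. Qed.

Lemma common_denominator (R : idomainType) (T : finType) (v : T -> {fraction R}) :
  exists2 d : R, d != 0 & exists p : T -> R, forall x, d%:F * v x = (p x)%:F.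
Proof.
pose P x (nd : R * R) := nd.2 != 0 /\ nd.2%:F * v x = nd.1%:F.
have [nd ndP] : exists nd : T -> R * R, forall x, P x (nd x).
  have H x : exists nd, P x nd.
    by have [n [d nd]] := fraction_num_den (v x); exists (n, d).
  apply: fin_all_exists => x; exact: H.
exists (\prod_y (nd y).2).
  by apply/prodf_neq0 => y _; case: (ndP y).
exists (fun x => (nd x).1 * \prod_(y | y != x) (nd y).2) => x.
rewrite (bigD1 x) //= !rmorphM /=; have [_ <-] := ndP x.
by rewrite mulrAC.
Qed.

Section Inflation.

Variables (R : fieldType) (m N : nat).
Hypothesis N0 : (0 < N)%N.

(** Replacing each variable by its [N]-th power makes exponents with denominator [N] integral, so
    that basis elements can be given the size of [N]-th roots of monomials. *)
Definition inflate (p : {mpoly R[m]}) : {mpoly R[m]} :=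
  p \mPo [tuple 'X_i ^+ N | i < m].

Lemma inflateM p q : inflate (p * q) = inflate p * inflate q.
Proof. exact: rmorphM. Qed.

Lemma inflateZ c p : inflate (c *: p) = c *: inflate p.
Proof. exact: linearZ. Qed.

Lemma inflate_sum (I : finType) (F : I -> {mpoly R[m]}) :
  inflate (\sum_i F i) = \sum_i inflate (F i).
Proof. exact: raddf_sum. Qed.

Lemma inflateX e : inflate 'X_[e] = 'X_[e *+ N].
Proof.
rewrite /inflate comp_mpolyX [RHS]mpolyXE_id; apply: eq_bigr => i _.
by rewrite tnth_mktuple -exprM mulmnE mulnC.
Qed.

Lemma inflateE p : inflate p = \sum_(e <- msupp p) p@_e *: 'X_[e *+ N].
Proof.
rewrite /inflate comp_mpolyEX; apply: eq_bigr => e _.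
by rewrite -inflateX.
Qed.

Lemma mnm_muln_inj (e e' : 'X_{1..m}) : (e *+ N = e' *+ N)%MM -> e = e'.
Proof.
move/mnmP => ee'; apply/mnmP => i; have := ee' i.
by rewrite !mulmnE => /eqP; rewrite eqn_pmul2r // => /eqP.
Qed.

Lemma inflate_coef p e : (inflate p)@_(e *+ N) = p@_e.
Proof.
rewrite inflateE raddf_sum /= [in RHS](mpolyE p) raddf_sum /=.
apply: eq_bigr => e' _; rewrite !mcoeffZ !mcoeffX; congr (_ * _%:R).
by congr nat_of_bool; apply/eqP/eqP => [/mnm_muln_inj|->].
Qed.

Lemma inflate_supp p e : (inflate p)@_e != 0 -> exists e', e = (e' *+ N)%MM.
Proof.
rewrite inflateE raddf_sum /= => pe; apply: NNPP => ne; case/eqP: pe.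
rewrite big1 // => e' _; rewrite mcoeffZ mcoeffX; case: eqP => [ee'|_].
  by case: ne; exists e'.
by rewrite mulr0.
Qed.

Lemma inflate_eq0 p : (inflate p == 0) = (p == 0).
Proof.
apply/eqP/eqP => [p0|->]; last exact: raddf0.
by apply/mpolyP => e; rewrite -inflate_coef p0 !mcoeff0.
Qed.

End Inflation.

Lemma mpolyX_eq0 (R : fieldType) m (e : 'X_{1..m}) : ('X_[e] == 0 :> {mpoly R[m]}) = false.
Proof.
by apply/eqP => /mpolyP/(_ e)/eqP; rewrite mcoeffX mcoeff0 eqxx oner_eq0.
Qed.

Fact carry_arith (a b c ab bc abc k1 k2 k3 k4 : nat) :
  (b + c = k1 + bc -> a + bc = k2 + abc -> a + b = k3 + ab ->
   ab + c = k4 + abc -> k3 + k4 = k1 + k2)%N.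
Proof. lia. Qed.

Section LeadingTerms.

Variables (k0 : fieldType) (gT qT : finGroupType) (r : gT -> qT).
Variables (f0 : gT -> gT -> k0) (m N : nat).
Variables (w : qT -> 'X_{1..m}) (carry : qT -> qT -> 'X_{1..m}).
Hypothesis rM : forall x y, r (x * y)%g = (r x * r y)%g.
Hypothesis f0_cocycle : cocycle f0.
Hypothesis N0 : (0 < N)%N.
Hypothesis w_carry : forall q q', (w q + w q' = carry q q' *+ N + w (q * q')%g)%MM.
Hypothesis w_inj : forall q q' e e',
  (e *+ N + w q = e' *+ N + w q')%MM -> q = q'.

Let R : idomainType := {mpoly k0[m]}.
Let k : fieldType := {fraction R}.

(** Formally [u_x] is the basis element over [k0] times the monomial of exponent [w (r x) / N]; a
    product of two such roots overflows by [X^carry]. *)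
Definition inflated_cocycle (x y : gT) : k :=
  (f0 x y *: 'X_[carry (r x) (r y)] : R)%:F.
Local Notation f := inflated_cocycle.

Lemma inflated_cocycleP : cocycle f.
Proof.
have [fn0 fC] := f0_cocycle; split=> [x y|x y z].
  by rewrite tofrac_eq0 scaler_eq0 negb_or fn0 mpolyX_eq0.
rewrite -!rmorphM /=; congr (_ %:F).
rewrite -!scalerAl -!scalerAr !scalerA fC -!mpolyXD; congr (_ *: 'X_[_]).
apply/(mnm_muln_inj N0)/mnmP => i.
move: (w_carry (r x) (r y)) (w_carry (r (x * y)%g) (r z)).
move: (w_carry (r y) (r z)) (w_carry (r x) (r (y * z)%g)).
rewrite !rM mulgA => /mnmP/(_ i) H1 /mnmP/(_ i) H2 /mnmP/(_ i) H3 /mnmP/(_ i) H4.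
move: H1 H2 H3 H4; rewrite !(mnmDE, mulmnE) !mulnDl.
exact: carry_arith.
Qed.

Definition homogeneous (a : tga k0 gT) := exists q, forall x, a x != 0 -> r x = q.

Definition weighted (p : gT -> R) (x : gT) : R := inflate N (p x) * 'X_[w (r x)].

(** One exponent [M] serves all coordinates: [a] vanishes at the coordinates whose own leading
    exponent is smaller. *)
Definition lead_bound (p : gT -> R) (M : 'X_{1..m}) (a : tga k0 gT) :=
  forall x, (mlead (weighted p x) <= M)%O /\ a x = (weighted p x)@_M.

(** The denominator [d] is part of the data: the leading form is unique once [d] is fixed, and
    otherwise only up to a nonzero scalar. *)
Definition lead (v : tga k gT) (d : R) (M : 'X_{1..m}) (a : tga k0 gT) :=
  [/\ d != 0, a != tzero k0 gT &
      exists2 p, forall x, d%:F * v x = (p x)%:F & lead_bound p M a].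

Lemma tga_neq0 (K : fieldType) (a : tga K gT) :
  a != tzero K gT -> exists x, a x != 0.
Proof.
move=> a0; apply: NNPP => na; case/eqP: a0; apply/ffunP => x; rewrite ffunE.
by apply/eqP/negPn/negP => ax; apply: na; exists x.
Qed.

Lemma weighted_eq0 p x : (weighted p x == 0) = (p x == 0).
Proof. by rewrite mulf_eq0 inflate_eq0 // mpolyX_eq0 orbF. Qed.

Lemma lead_exists v : v != tzero k gT -> exists d M a, lead v d M a.
Proof.
move=> /tga_neq0[x0 vx0]; have [d d0 [p dp]] := common_denominator v.
have px0 : p x0 != 0 := numerator_neq0 d0 vx0 (dp x0).
case: (@Order.TotalTheory.arg_maxP _ 'X_{1..m} gT x0 (fun x => p x != 0)
  (fun x => mlead (weighted p x)) px0) => x px maxx.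
pose M := mlead (weighted p x).
exists d, M, [ffun y => (weighted p y)@_M]; split=> //.
  apply/eqP => /ffunP/(_ x); rewrite !ffunE => /eqP.
  by rewrite mleadc_eq0 weighted_eq0 (negPf px).
exists p => // y; rewrite ffunE; split=> //.
have [py|/maxx//] := eqVneq (p y) 0.
have /eqP-> : weighted p y == 0 by rewrite weighted_eq0 py.
by rewrite mlead0 le0x.
Qed.

(** All exponents occurring in [weighted p x] are congruent to [w (r x)] modulo [N], so [M]
    determines [r x] by [w_inj]. *)
Lemma lead_homog v d M a : lead v d M a -> homogeneous a.
Proof.
case=> _ /tga_neq0[x0 ax0] [p _ pM]; exists (r x0).
have aP x : a x != 0 -> exists e, M = (e *+ N + w (r x))%MM.
  have [_ ->] := pM x; rewrite -mcoeff_msupp (perm_mem (msuppMX _ _)) => /mapP[e].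
  by rewrite mcoeff_msupp => /(@inflate_supp _ _ N)[e' ->] ->; exists e'; rewrite addmC.
move=> x /aP[e eM]; have [e' e'M] := aP _ ax0.
by apply: (@w_inj _ _ e e'); rewrite -eM.
Qed.

Lemma lead_eq0 v d M a x : lead v d M a -> v x = 0 -> a x = 0.
Proof.
case=> _ _ [p dp pM] vx; have [_ ->] := pM x.
have /eqP-> : weighted p x == 0.
  by rewrite weighted_eq0 -tofrac_eq0 -dp vx mulr0.
by rewrite mcoeff0.
Qed.

Lemma lead_neq0 v d M a : lead v d M a -> v != tzero k gT.
Proof.
move=> va; apply/eqP => v0; have [_ /tga_neq0[x]] := va.
by rewrite (lead_eq0 va) ?eqxx // v0 ffunE.
Qed.

Lemma lead_uniq v d M a M' a' : lead v d M a -> lead v d M' a' -> a = a'.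
Proof.
case=> d0 a0 [p dp pM] [_ a'0 [p' dp' p'M]].
have pp' x : weighted p x = weighted p' x.
  by rewrite /weighted; congr (inflate _ _ * _); apply/eqP; rewrite -tofrac_eq -dp -dp'.
have le_ (P Q : gT -> R) A B b b' : (forall x, weighted P x = weighted Q x) ->
    lead_bound P A b -> lead_bound Q B b' -> b != tzero k0 gT -> (A <= B)%O.
  move=> PQ PA QB /tga_neq0[x bx]; have [_ def_b] := PA x; have [le_B _] := QB x.
  rewrite leNgt; apply: contra bx => ltBA.
  by rewrite def_b PQ mcoeff_gt_mlead // (le_lt_trans le_B).
have MM' : M = M'.
  apply/eqP; rewrite eq_le (le_ _ _ _ _ _ _ pp' pM p'M a0).
  by rewrite (le_ _ _ _ _ _ _ (fun x => esym (pp' x)) p'M pM a'0).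
by apply/ffunP => x; have [_ ->] := pM x; have [_ ->] := p'M x; rewrite pp' MM'.
Qed.

(** The weights absorb the monomial [X^carry] of the cocycle, so the weighted coordinates multiply
    through [f0] alone. The last hypothesis says that the products of leading coefficients do not
    all cancel. *)
Lemma lead_mul v d M a v' d' M' a' : lead v d M a -> lead v' d' M' a' ->
  tmul f0 a a' != tzero k0 gT ->
  lead (tmul f v v') (d * d') (M + M')%MM (tmul f0 a a').
Proof.
case=> d0 a0 [p dp pM] [d'0 a'0 [p' dp' p'M]] aa'; split=> //.
  by rewrite mulf_neq0.
pose pp z := \sum_x p x * p' (x^-1 * z)%g *
  (f0 x (x^-1 * z)%g *: 'X_[carry (r x) (r (x^-1 * z)%g)]).
exists pp => z.
  rewrite ffunE mulr_sumr rmorph_sum; apply: eq_bigr => x _ /=.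
  rewrite !rmorphM /= -dp -dp' /inflated_cocycle; ring.
have wpp : weighted pp z = \sum_x f0 x (x^-1 * z)%g *:
    (weighted p x * weighted p' (x^-1 * z)%g).
  rewrite /weighted /pp inflate_sum mulr_suml; apply: eq_bigr => x _.
  rewrite !inflateM inflateZ inflateX // -!scalerAr -!scalerAl; congr (_ *: _).
  rewrite -!mulrA -mpolyXD; congr (_ * _).
  rewrite [RHS]mulrCA; congr (_ * _); rewrite -mpolyXD; congr 'X_[_].
  by rewrite w_carry -rM mulKVg.
rewrite wpp; split.
  elim/big_ind: _ => [|p1 p2 le1 le2|x _]; first by rewrite mlead0 le0x.
    by apply: le_trans (mleadD_le _ _) _; rewrite leUx le1.
  apply: le_trans (mleadZ_le _ _) _; apply: le_trans (mleadM_le _ _) _.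
  by apply: lem_add; [case: (pM x) | case: (p'M (x^-1 * z)%g)].
rewrite ffunE raddf_sum /=; apply: eq_bigr => x _.
have [le1 ->] := pM x; have [le2 ->] := p'M (x^-1 * z)%g.
by rewrite mcoeffZ mleadcMW // mulrC.
Qed.

Lemma lead_scale v d M a (v' : tga k gT) (d' alpha : R) : lead v d M a -> alpha != 0 -> d' != 0 ->
    (forall x, d'%:F * v' x = alpha%:F * (d%:F * v x)) ->
  exists M' c, c != 0 /\ lead v' d' M' (tscale c a).
Proof.
case=> d0 /tga_neq0[x0 ax0] [p dp pM] al0 d'0 vv'.
have il0 : inflate N alpha != 0 by rewrite inflate_eq0.
have c0 : mleadc (inflate N alpha) != 0 by rewrite mleadc_eq0.
exists (mlead (inflate N alpha) + M)%MM, (mleadc (inflate N alpha)); split=> //.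
split=> //.
  by apply/eqP => /ffunP/(_ x0)/eqP; rewrite !ffunE mulf_eq0 (negPf c0) (negPf ax0).
exists (fun x => alpha * p x) => x; first by rewrite vv' dp rmorphM.
have -> : weighted (fun x => alpha * p x) x = inflate N alpha * weighted p x.
  by rewrite /weighted inflateM mulrA.
have [le1 def_a] := pM x; split.
  by apply: le_trans (mleadM_le _ _) _; apply: lem_add.
by rewrite ffunE mleadcMW // def_a.
Qed.

Lemma lead_proportional (v : tga k gT) d M a (v' : tga k gT) d' M' a' (c : k) : c != 0 ->
    (forall x, v' x = c * v x) -> lead v d M a -> lead v' d' M' a' ->
  exists2 c0, c0 != 0 & a' = tscale c0 a.
Proof.
move=> c0 vv' va v'a'.
have [d0 _ _] := va; have [d'0 _ _] := v'a'.
have [n [e [e0 def_c]]] := fraction_num_den c.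
have n0 : n != 0 := numerator_neq0 e0 c0 def_c.
(* Both vectors are brought to the common denominator [e * d * d'], where the leading form is
   unique. *)
have [|||M1 [c1 [c1n0 va1]]] := @lead_scale v d M a v' (e * d * d') (n * d') va.
- by rewrite mulf_neq0.
- by rewrite !mulf_neq0.
- by move=> x; rewrite !rmorphM /= -def_c vv'; ring.
have [|||M2 [c2 [c2n0 va2]]] := @lead_scale v' d' M' a' v' (e * d * d') (e * d) v'a'.
- by rewrite mulf_neq0.
- by rewrite !mulf_neq0.
- by move=> x; rewrite !rmorphM mulrA.
have a12 := lead_uniq va1 va2.
exists (c2^-1 * c1); first by rewrite mulf_neq0 ?invr_eq0.
apply/ffunP => x; move/ffunP/(_ x): a12; rewrite !ffunE -mulrA => ->.
by rewrite mulKf.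
Qed.

Lemma lead_base g : lead (tbase k g) 1 (w (r g)) (tbase k0 g).
Proof.
split; [exact: oner_neq0 | exact: tbase_neq0 |].
exists (fun x => (x == g)%:R) => x; first by rewrite rmorph1 mul1r ffunE rmorph_nat.
rewrite /weighted ffunE; case: eqP => [->|_] /=.
  by rewrite /inflate rmorph1 mul1r mleadXm mcoeffX eqxx.
by rewrite /inflate raddf0 mul0r mlead0 mcoeff0 le0x.
Qed.

Hypothesis homog_domain : forall a b, homogeneous a -> homogeneous b ->
  a != tzero k0 gT -> b != tzero k0 gT -> tmul f0 a b != tzero k0 gT.
Hypothesis homog_center : forall a, homogeneous a ->
  (forall g, tmul f0 a (tbase k0 g) = tmul f0 (tbase k0 g) a) ->
  a 1%g = 0 -> a = tzero k0 gT.

Lemma homog_base g : homogeneous (tbase k0 g).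
Proof. by exists (r g) => x; rewrite ffunE; have [->|_] := eqVneq x g; rewrite ?eqxx. Qed.

Lemma inflated_domain : tdomain f.
Proof.
move=> v v' /lead_exists[d [M [a va]]] /lead_exists[d' [M' [a' va']]].
apply: lead_neq0 (lead_mul va va' _); have [_ a0 _] := va; have [_ a'0 _] := va'.
by apply: homog_domain => //; [apply: lead_homog va | apply: lead_homog va'].
Qed.

(** The leading form of a central element commutes with every [u_g]: the two products coincide, have
    the same denominator, and so have the same leading form. *)
Lemma inflated_central_simple : central_simple f.
Proof.
apply: tdomain_central_simple => [||z zC z1]; first exact: inflated_cocycleP.
  exact: inflated_domain.
apply/eqP/negPn/negP => z0; have [d [M [a za]]] := lead_exists z0.
have [_ a0 _] := za; have ha := lead_homog za.
case/eqP: (a0); apply: homog_center => // [g|]; last exact: lead_eq0 za z1.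
have ub := lead_base g; have hb := homog_base g; have b0 := tbase_neq0 k0 g.
have za1 := lead_mul za ub (homog_domain ha hb a0 b0).
have za2 := lead_mul ub za (homog_domain hb ha b0 a0).
by rewrite -zC mulrC in za2; apply: lead_uniq za1 za2.
Qed.

Definition homog_basis (hT : finGroupType) (a : hT -> tga k0 gT) :=
  [/\ forall h, homogeneous (a h) /\ a h != tzero k0 gT,
      forall h h', exists2 c, c != 0 &
        a (h * h')%g = tscale c (tmul f0 (a h) (a h')) &
      forall h, h != 1%g -> a h 1%g = 0].

Lemma inflated_basis (hT : finGroupType) (g : hT -> hT -> k) :
    [pchar k0] =i pred0 -> cocycle g -> tga_iso f g ->
  #|hT| = #|gT| /\ exists a : hT -> tga k0 gT, homog_basis a.
Proof.
move=> ch0 gC iso.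
have chk : [pchar k] =i pred0.
  move=> p; rewrite -(ch0 p) !inE; congr (_ && _).
  rewrite -(rmorph_nat (@FracField.tofrac R)) tofrac_eq0.
  by rewrite -(rmorph_nat (@mpolyC m k0)) mpolyC_eq0.
have [cardE [v [v0 vM v1]]] := tga_iso_basis inflated_cocycleP chk iso.
split=> //.
have [a va] : exists a : hT -> tga k0 gT, forall h, exists d M, lead (v h) d M (a h).
  have H h : exists a d M, lead (v h) d M a.
    by have [d [M [a va]]] := lead_exists (v0 h); exists a, d, M.
  exact: fin_all_exists H.
exists a; split=> [h|h h'|h h1]; first 1 last.
- have [d [M vah]] := va h; have [d' [M' vah']] := va h'.
  have [d2 [M2 vahh']] := va (h * h')%g.
  have [_ a0 _] := vah; have [_ a'0 _] := vah'.
  have hM := homog_domain (lead_homog vah) (lead_homog vah') a0 a'0.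
  apply: (@lead_proportional _ _ _ _ _ _ _ _ (g h h')^-1 _ _
    (lead_mul vah vah' hM) vahh'); first by rewrite invr_eq0; case: gC.
  by move=> x; rewrite vM ffunE mulKf //; case: gC.
- by have [d [M vah]] := va h; apply: lead_eq0 vah (v1 h h1).
by have [d [M vah]] := va h; split; [apply: lead_homog vah | case: vah].
Qed.

End LeadingTerms.

Lemma abelian_weights (qT : finGroupType) : abelian [set: qT]%g ->
  exists m N (w : qT -> 'X_{1..m}) (carry : qT -> qT -> 'X_{1..m}),
    [/\ (0 < N)%N,
        forall q q', (w q + w q' = carry q q' *+ N + w (q * q')%g)%MM &
        forall q q' e e', (e *+ N + w q = e' *+ N + w q')%MM -> q = q'].
Proof.
move=> cQ; pose d := exponent [set: qT]%g.
have d0 : (0 < d)%N by apply: exponent_gt0.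
have [B [addB symB ndB]] := pairing_exists d0 cQ (dvdnn _).
have inT (x : qT) : x \in [set: qT]%g by rewrite inE.
(* One variable per element of [qT]: the weight of [q] records its pairing with every element, and
   nondegeneracy makes this injective. The carries are those of adding remainders modulo [d]. *)
pose m := #|qT|.
pose w q : 'X_{1..m} := [multinom (B q (enum_val i) %% d)%N | i < m].
pose carry q q' : 'X_{1..m} := [multinom ((w q i + w q' i) %/ d)%N | i < m].
exists m, d, w, carry; split=> // [q q'|q q' e e'].
  apply/mnmP => i; rewrite !(mnmDE, mulmnE, mnmE).
  rewrite {1}(divn_eq (B q (enum_val i) %% d + B q' (enum_val i) %% d) d).
  by congr (_ + _)%N; rewrite modnDm addB.
move/mnmP => qq'; apply/eqP; rewrite eq_mulVg1; apply/eqP.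
apply: ndB => // y _; have := qq' (enum_rank y).
rewrite !(mnmDE, mulmnE, mnmE) enum_rankK => /(congr1 (modn^~ d)).
rewrite !modnMDl !modn_mod => Bqq'.
have /eqP := addB q (q^-1 * q')%g y (inT _) (inT _) (inT _).
rewrite mulKVg -Bqq' -[X in X == _ %[mod _]]addn0 eqn_modDl mod0n.
by rewrite eq_sym.
Qed.

(* The field is the fraction field of a polynomial ring over [k0], with one root of each
   variable adjoined by the grading group [qT]. *)
Lemma generic_form (k0 : fieldType) (gT qT : finGroupType) (r : gT -> qT)
    (f0 : gT -> gT -> k0) :
    (forall x y, r (x * y)%g = (r x * r y)%g) -> cocycle f0 ->
    abelian [set: qT]%g -> [pchar k0] =i pred0 ->
    (forall a b, homogeneous r a -> homogeneous r b ->
       a != tzero k0 gT -> b != tzero k0 gT -> tmul f0 a b != tzero k0 gT) ->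
    (forall a, homogeneous r a ->
       (forall g, tmul f0 a (tbase k0 g) = tmul f0 (tbase k0 g) a) ->
       a 1%g = 0 -> a = tzero k0 gT) ->
  exists (k : fieldType) (f : gT -> gT -> k), [/\ cocycle f, central_simple f &
    forall (hT : finGroupType) (g : hT -> hT -> k), cocycle g -> tga_iso f g ->
      #|hT| = #|gT| /\ exists a : hT -> tga k0 gT, homog_basis r f0 a].
Proof.
move=> rM f0C cQ ch0 dom cen.
have [m [N [w [carry [N0 wC wI]]]]] := abelian_weights cQ.
exists {fraction {mpoly k0[m]}}, (inflated_cocycle r f0 carry); split.
- exact: (inflated_cocycleP rM f0C N0 wC).
- exact: (inflated_central_simple rM f0C N0 wC wI dom cen).
by move=> hT g gC iso; apply: (inflated_basis rM f0C N0 wC wI dom) iso.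
Qed.

(** * Crossed products *)

Definition iterm (R : fieldType) (s : {rmorphism R -> R}) i : R -> R := iter i s.

Arguments iterm : simpl never.

Section IterMorphism.
Variables (R : fieldType) (s : {rmorphism R -> R}) (i : nat).

Fact iterm_is_zmod_morphism : zmod_morphism (iterm s i).
Proof. by rewrite /iterm; elim: i => //= j IH x y /=; rewrite IH rmorphB. Qed.

Fact iterm_is_monoid_morphism : monoid_morphism (iterm s i).
Proof.
rewrite /iterm; elim: i => //= j [IH1 IHM]; split=> [|x y] /=; first by rewrite IH1 rmorph1.
by rewrite IHM rmorphM.
Qed.

HB.instance Definition _ := GRing.isZmodMorphism.Build R R (iterm s i) iterm_is_zmod_morphism.
HB.instance Definition _ := GRing.isMonoidMorphism.Build R R (iterm s i) iterm_is_monoid_morphism.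
End IterMorphism.

Section CrossedData.

Variables (F : fieldType) (s t : {rmorphism F -> F}) (a b : nat) (aT : finGroupType).

(** The degrees in [sigma] and [tau], then the symmetric factor. Ordinals carry their additive
    cyclic structure, so [b = 0] removes [tau]. *)
Definition grading := ('I_a.+1 * 'I_b.+1 * (aT * aT))%type.
HB.instance Definition _ := FinGroup.on grading.

Definition theta (q : grading) (y : F) : F := iterm s q.1.1 (iterm t q.1.2 y).

HB.instance Definition _ q :=
  GRing.RMorphism.copy (theta q) (iterm s q.1.1 \o iterm t q.1.2).

(** Fixed points in all of [F], not only in the span of the powers of [z]. *)
Definition fixedK : {pred F} := fun y => (s y == y) && (t y == y).

(** [n.+1] is both the degree of the extension generated by [z] over the fixed field and the order
    of the class of [z] modulo that field. The root of unity [z ^+ n.+1] is the scalar through which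
    the two copies of [aT] fail to commute. *)
Record crossed_data (n : nat) (z : F) (u v d : nat) (B : aT -> aT -> nat) : Prop :=
  CrossedData {
    cd_s : s z = z ^+ u;
    cd_t : t z = z ^+ v;
    cd_sa : z ^+ (u ^ a.+1) = z;
    cd_tb : z ^+ (v ^ b.+1) = z;
    cd_card : n.+1 = (a.+1 * b.+1)%N;
    cd_faithful : forall i i' j j', (i < a.+1)%N -> (i' < a.+1)%N ->
      (j < b.+1)%N -> (j' < b.+1)%N ->
      z ^+ (u ^ i * v ^ j) = z ^+ (u ^ i' * v ^ j') -> i = i' /\ j = j';
    cd_fixed : z ^+ n.+1 \in fixedK;
    cd_prim : d.-primitive_root (z ^+ n.+1);
    cd_abelian : abelian [set: aT]%g;
    cd_pairing : pairing_on d [set: aT]%G B }.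

Definition spanL (n : nat) (z : F) (y : F) := exists2 c : 'I_n.+1 -> F,
  forall i, c i \in fixedK & y = \sum_i c i * z ^+ i.

(* [x] and [q] describe a projective basis of the crossed product of the field [spanL] with
   [grading], by elements that are homogeneous for the grading. *)
Record crossed_basis (n : nat) (z : F) (hT : finGroupType) (x : hT -> F)
    (q : hT -> grading) : Prop := CrossedBasis {
  cb_neq0 : forall h, x h != 0;
  cb_span : forall h, spanL n z (x h);
  cb_deg : forall h h', q (h * h')%g = (q h * q h')%g;
  cb_mul : forall h h', x (h * h')%g / (x h * theta (q h) (x h')) \in fixedK;
  cb_trace : forall h (c : 'I_n.+1 -> F), q h = 1%g -> h != 1%g ->
    (forall i, c i \in fixedK) -> x h = \sum_i c i * z ^+ i -> c ord0 = 0;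
  cb_card : #|hT| = (n.+1 * #|{: grading}|)%N }.

End CrossedData.
Arguments theta : simpl never.

Section CrossedFacts.

Variables (F : fieldType) (s t : {rmorphism F -> F}) (a b : nat) (aT : finGroupType).
Variables (n : nat) (z : F) (u v d : nat) (B : aT -> aT -> nat).
Hypothesis C : crossed_data s t a b n z u v d B.

Local Notation qT := (grading a b aT).
Local Notation K := (fixedK s t).
Local Notation L := (spanL s t n z).
Local Notation theta := (@theta F s t a b aT).

Definition kap (q : qT) := (u ^ q.1.1 * v ^ q.1.2)%N.

Lemma fixed_s y : y \in K -> s y = y. Proof. by case/andP => /eqP. Qed.
Lemma fixed_t y : y \in K -> t y = y. Proof. by case/andP => _ /eqP. Qed.
Lemma fixedP y : s y = y -> t y = y -> y \in K.
Proof. by move=> sy ty; rewrite unfold_in /fixedK sy ty !eqxx. Qed.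

Lemma iterm_fixed (f : {rmorphism F -> F}) i y : f y = y -> iterm f i y = y.
Proof. by move=> fy; rewrite /iterm; elim: i => //= i ->. Qed.

Lemma thetaE q y : theta q y = iterm s q.1.1 (iterm t q.1.2 y).
Proof. by []. Qed.

Lemma theta_fixed q y : y \in K -> theta q y = y.
Proof. by move=> yK; rewrite thetaE !iterm_fixed ?fixed_t ?fixed_s. Qed.

Lemma fixedM x y : x \in K -> y \in K -> x * y \in K.
Proof.
by move=> xK yK; apply: fixedP; rewrite rmorphM ?(fixed_s xK) ?(fixed_s yK) //
  (fixed_t xK) (fixed_t yK).
Qed.

Lemma fixedV x : x \in K -> x^-1 \in K.
Proof. by move=> xK; apply: fixedP; rewrite fmorphV ?(fixed_s xK) ?(fixed_t xK). Qed.

Lemma fixedX x i : x \in K -> x ^+ i \in K.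
Proof. by move=> xK; apply: fixedP; rewrite rmorphXn /= ?(fixed_s xK) ?(fixed_t xK). Qed.

Lemma fixed1 : 1 \in K. Proof. by apply: fixedP; rewrite rmorph1. Qed.

Lemma zn_neq0 : z ^+ n.+1 != 0.
Proof.
apply/eqP => z0; have := prim_expr_order (cd_prim C).
have := prim_order_gt0 (cd_prim C); case: (d) => // d' _.
by rewrite z0 expr0n /= => /eqP; rewrite eq_sym oner_eq0.
Qed.

Lemma z_neq0 : z != 0.
Proof. by apply: contraNneq zn_neq0 => ->; rewrite exprS mul0r. Qed.

Lemma iterm_sz i m : iterm s i (z ^+ m) = z ^+ (u ^ i * m).
Proof.
rewrite /iterm; elim: i => [|i IH] /=; first by rewrite expn0 mul1n.
by rewrite IH rmorphXn /= (cd_s C) -exprM expnS mulnA.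
Qed.

Lemma iterm_tz i m : iterm t i (z ^+ m) = z ^+ (v ^ i * m).
Proof.
rewrite /iterm; elim: i => [|i IH] /=; first by rewrite expn0 mul1n.
by rewrite IH rmorphXn /= (cd_t C) -exprM expnS mulnA.
Qed.

Lemma theta_z q m : theta q (z ^+ m) = z ^+ (kap q * m).
Proof. by rewrite thetaE iterm_tz iterm_sz mulnA. Qed.

Lemma expu_mod i m : z ^+ (u ^ (i %% a.+1) * m) = z ^+ (u ^ i * m).
Proof.
rewrite [in RHS](divn_eq i a.+1) [(_ %/ _ * _)%N]mulnC expnD expnM.
have E j : z ^+ ((u ^ a.+1) ^ j) = z.
  elim: j => [|j IH]; first by rewrite expn0 expr1.
  by rewrite expnS exprM (cd_sa C).
by rewrite -mulnA [in RHS]exprM E.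
Qed.

Lemma expv_mod i m : z ^+ (v ^ (i %% b.+1) * m) = z ^+ (v ^ i * m).
Proof.
rewrite [in RHS](divn_eq i b.+1) [(_ %/ _ * _)%N]mulnC expnD expnM.
have E j : z ^+ ((v ^ b.+1) ^ j) = z.
  elim: j => [|j IH]; first by rewrite expn0 expr1.
  by rewrite expnS exprM (cd_tb C).
by rewrite -mulnA [in RHS]exprM E.
Qed.

Lemma grading_val1 (q q' : qT) : (q * q')%g.1.1 = ((q.1.1 + q'.1.1) %% a.+1)%N :> nat.
Proof. by []. Qed.

Lemma grading_val2 (q q' : qT) : (q * q')%g.1.2 = ((q.1.2 + q'.1.2) %% b.+1)%N :> nat.
Proof. by []. Qed.

Lemma kapM q q' m : z ^+ (kap (q * q')%g * m) = z ^+ (kap q * kap q' * m).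
Proof.
rewrite /kap grading_val1 grading_val2 -mulnA expu_mod mulnC -mulnA expv_mod.
by congr (z ^+ _); rewrite !expnD; ring.
Qed.

Lemma zB_mod i j : i = j %[mod d] -> (z ^+ n.+1) ^+ i = (z ^+ n.+1) ^+ j.
Proof. by move/eqP => ij; apply/eqP; rewrite (eq_prim_root_expr (cd_prim C)). Qed.

Lemma span_sum (I : finType) (c : I -> F) (e : I -> 'I_n.+1) :
  (forall i, c i \in K) -> L (\sum_i c i * z ^+ e i).
Proof.
move=> cK; exists (fun j => \sum_(i | e i == j) c i).
  move=> j; elim/big_ind: _ => // [|x y xK yK].
    by apply: fixedP; rewrite rmorph0.
  by apply: fixedP; rewrite rmorphD /= ?(fixed_s xK) ?(fixed_s yK) ?(fixed_t xK) ?(fixed_t yK).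
rewrite (partition_big e xpredT) //=; apply: eq_bigr => j _.
by rewrite mulr_suml; apply: eq_bigr => i /eqP ->.
Qed.

(** Relations between [s] and [t], such as their orders and their commutation, are known on [z]
    only; this transports them to the span. *)
Lemma span_sum_eq (f g : {rmorphism F -> F}) y :
    (forall c, c \in K -> f c = c) -> (forall c, c \in K -> g c = c) ->
    (f z = g z) -> L y -> f y = g y.
Proof.
move=> fK gK fz [c cK ->]; rewrite !rmorph_sum; apply: eq_bigr => i _.
by rewrite !rmorphM !rmorphXn /= fz (fK _ (cK i)) (gK _ (cK i)).
Qed.

Lemma span_sa y : L y -> iterm s a.+1 y = y.
Proof.
apply: (@span_sum_eq (iterm s a.+1) idfun) => // [c cK|].
  by rewrite /= iterm_fixed ?fixed_s.
by rewrite /= -{1}[z]expr1 iterm_sz muln1 (cd_sa C).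
Qed.

Lemma span_tb y : L y -> iterm t b.+1 y = y.
Proof.
apply: (@span_sum_eq (iterm t b.+1) idfun) => // [c cK|].
  by rewrite /= iterm_fixed ?fixed_t.
by rewrite /= -{1}[z]expr1 iterm_tz muln1 (cd_tb C).
Qed.

Lemma span_st y : L y -> s (t y) = t (s y).
Proof.
apply: (@span_sum_eq (s \o t) (t \o s)) => [c cK|c cK|] /=.
- by rewrite fixed_t ?fixed_s.
- by rewrite fixed_s ?fixed_t.
by rewrite (cd_s C) (cd_t C) !rmorphXn /= (cd_s C) (cd_t C) -!exprM mulnC.
Qed.


(* Artin: the [n.+1] conjugates of [z] are distinct, so [1, z, .., z^n] is free over [K]. *)
Lemma span_free (I : finType) (c : I -> F) (e : I -> 'I_n.+1) :
    (forall i, c i \in K) -> injective e ->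
  \sum_i c i * z ^+ e i = 0 -> forall i, c i = 0.
Proof.
move=> cK eI S0 i0.
pose P : {poly F} := \sum_i c i *: 'X^(e i).
have coefP : P`_(e i0) = c i0.
  rewrite coef_sum (bigD1 i0) //= coefZ coefXn eqxx mulr1 big1 ?addr0 // => i ii0.
  rewrite coefZ coefXn; case: eqP => [/val_inj/eI ii|_]; last by rewrite mulr0.
  by rewrite ii eqxx in ii0.
pose rs := [seq z ^+ (u ^ (p.1 : 'I_a.+1) * v ^ (p.2 : 'I_b.+1)) | p <- enum {: 'I_a.+1 * 'I_b.+1}].
have size_rs : size rs = n.+1.
  by rewrite size_map -cardE card_prod !card_ord (cd_card C).
have uniq_rs : uniq rs.
  rewrite map_inj_uniq ?enum_uniq // => -[i j] [i' j'] /=.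
  by case/(cd_faithful C) => // /val_inj -> /val_inj ->.
have root_rs : all (root P) rs.
  apply/allP => _ /mapP[[i j] _ ->] /=; apply/rootP; rewrite /P horner_sum.
  have := congr1 (iterm s i \o iterm t j) S0; rewrite rmorph0 => {2}<-.
  rewrite rmorph_sum; apply: eq_bigr => k _; rewrite rmorphM /= hornerZ hornerXn.
  rewrite -exprM iterm_tz iterm_sz mulnA.
  by rewrite (iterm_fixed _ (fixed_t (cK k))) (iterm_fixed _ (fixed_s (cK k))).
have P0 : P = 0.
  apply/eqP/negPn/negP => /(fun P0 => max_poly_roots P0 root_rs uniq_rs).
  rewrite size_rs ltnNge => /negP; apply.
  apply: leq_trans (size_sum _ _ _) _; apply/bigmax_leqP => i _.
  by apply: leq_trans (size_scale_leq _ _) _; rewrite size_polyXn.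
by rewrite -coefP P0 coef0.
Qed.

End CrossedFacts.

Lemma abelian_grading a b (aT : finGroupType) :
  abelian [set: aT]%g -> abelian [set: grading a b aT]%g.
Proof.
move=> cA; apply/centsP => -[[i j] [x y]] _ [[i' j'] [x' y']] _.
have cm (w w' : aT) : (w * w' = w' * w)%g by exact: (centsP cA _ (in_setT _) _ (in_setT _)).
by congr (_, _, (_, _)); try apply: cm; apply: Zp_addC.
Qed.

(** * The crossed product as a twisted group algebra *)

Section CrossedForm.

Variables (F k0 : fieldType) (iota : {rmorphism k0 -> F}).
Variables (s t : {rmorphism F -> F}) (a b : nat) (aT : finGroupType).
Variables (n : nat) (z : F) (u v d : nat) (B : aT -> aT -> nat).
Hypothesis C : crossed_data s t a b n z u v d B.

Local Notation qT := (grading a b aT).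
Local Notation K := (fixedK s t).
Local Notation L := (spanL s t n z).
Local Notation theta := (@theta F s t a b aT).
Local Notation kp := (@kap a b aT u v).

Hypothesis iotaK : forall c, iota c \in K.
Hypothesis iota_surj : forall y, y \in K -> exists c, iota c = y.

Variables (gT : finGroupType) (eps : gT -> 'I_n.+1) (r : gT -> qT).
Hypothesis rM : forall x y, r (x * y)%g = (r x * r y)%g.
Hypothesis epsM : forall x y, eps (x * y)%g = ((eps x + kp (r x) * eps y) %% n.+1)%N :> nat.
Hypothesis coord_inj : forall x y, eps x = eps y -> r x = r y -> x = y.
Hypothesis coord_surj : forall i q, exists x, eps x = i /\ r x = q.

Variable z0 : k0.
Hypothesis iota_z0 : iota z0 = z ^+ n.+1.

(** Here [u_x] stands for [z ^+ eps x] times a symbol of degree [r x]. The first exponent counts the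
    overflow of the power of [z] past [z ^+ n.+1], the second is the bilinear cocycle of the
    symmetric factor. *)
Definition base_cocycle (x y : gT) : k0 :=
  z0 ^+ ((eps x + kp (r x) * eps y) %/ n.+1 + B (r x).2.2 (r y).2.1).
Local Notation f0 := base_cocycle.

Lemma base_cocycleE x y :
  iota (f0 x y) * z ^+ eps (x * y)%g =
  z ^+ eps x * theta (r x) (z ^+ eps y) * (z ^+ n.+1) ^+ B (r x).2.2 (r y).2.1.
Proof.
rewrite /base_cocycle rmorphXn /= iota_z0 (theta_z C) epsM exprD.
rewrite mulrAC -[_ ^+ (_ %/ _)]exprM -!exprD; congr (z ^+ _ * _).
by rewrite mulnC -divn_eq.
Qed.

Let inA (x : aT) : x \in [set: aT]%g. Proof. by rewrite inE. Qed.

Lemma BDl x y w : B (x * y)%g w = (B x w + B y w)%N %[mod d].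
Proof. by case: (cd_pairing C) => addB _ _; apply: addB. Qed.

Lemma B_sym x y : B x y = B y x.
Proof. by case: (cd_pairing C) => _ symB _; apply: symB. Qed.

Lemma BDr x y w : B w (x * y)%g = (B w x + B w y)%N %[mod d].
Proof. by rewrite B_sym BDl ![B _ w]B_sym. Qed.

Lemma B1l x : (d %| B 1%g x)%N.
Proof.
have /eqP := BDl 1%g 1%g x.
by rewrite mulg1 -[X in X == _ %[mod _]]addn0 eqn_modDl eq_sym mod0n.
Qed.

Lemma B_nd x : (forall y, d %| B x y)%N -> x = 1%g.
Proof. by case: (cd_pairing C) => _ _ nd dx; apply: nd. Qed.

(** The identity is checked in [F] after multiplication by a power of [z]: the powers of [z] agree
    because [theta] is multiplicative, the pairing exponents agree modulo [d] by bilinearity. *)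
Lemma base_cocycleP : cocycle f0.
Proof.
have zn0 := zn_neq0 C; have zn := z_neq0 C.
split=> [x y|x y w].
  by rewrite expf_neq0 // -(fmorph_eq0 iota) iota_z0.
apply: (fmorph_inj iota); apply: (mulIf (expf_neq0 (eps (x * y * w)%g) zn)).
have zK := cd_fixed C.
transitivity (z ^+ (eps x + kp (r x) * eps y + kp (r x) * kp (r y) * eps w) *
  (z ^+ n.+1) ^+ (B (r x).2.2 (r y).2.1 + B (r x * r y)%g.2.2 (r w).2.1)).
  rewrite rmorphM -mulrA base_cocycleE rM.
  have swap (e1 e2 e3 e4 : F) : e1 * (e2 * e3 * e4) = e1 * e2 * (e3 * e4) by ring.
  rewrite swap base_cocycleE !(theta_z C) (kapM C) !exprD; ring.
transitivity (z ^+ (eps x + kp (r x) * eps y + kp (r x) * kp (r y) * eps w) *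
  (z ^+ n.+1) ^+ (B (r y).2.2 (r w).2.1 + B (r x).2.2 (r y * r w)%g.2.1)).
  congr (_ * _); apply: (zB_mod C).
  have e1 : B (r x * r y)%g.2.2 (r w).2.1 =
    (B (r x).2.2 (r w).2.1 + B (r y).2.2 (r w).2.1)%N %[mod d] by apply: BDl.
  have e2 : B (r x).2.2 (r y * r w)%g.2.1 =
    (B (r x).2.2 (r y).2.1 + B (r x).2.2 (r w).2.1)%N %[mod d] by apply: BDr.
  rewrite -modnDmr e1 modnDmr -[RHS]modnDmr e2 modnDmr; congr (_ %% d)%N.
  by rewrite addnA addnC.
rewrite -mulgA rmorphM -[RHS]mulrA base_cocycleE rM.
have -> : iota (f0 y w) * (z ^+ eps x * theta (r x) (z ^+ eps (y * w)%g) *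
    (z ^+ n.+1) ^+ B (r x).2.2 (r y * r w)%g.2.1) =
  z ^+ eps x * theta (r x) (iota (f0 y w) * z ^+ eps (y * w)%g) *
    (z ^+ n.+1) ^+ B (r x).2.2 (r y * r w)%g.2.1.
  by rewrite [in RHS]rmorphM /= (theta_fixed _ (iotaK _)); ring.
rewrite base_cocycleE !rmorphM /= (theta_fixed _ (fixedX _ zK)) !(theta_z C) !exprD.
by rewrite mulnA; ring.
Qed.

(** The coordinate of a homogeneous element on the line over [L] formed by its degree; it turns the
    product into that of a crossed product. *)
Definition ev (A : tga k0 gT) : F := \sum_x iota (A x) * z ^+ eps x.

Definition graded q (A : tga k0 gT) := forall x, A x != 0 -> r x = q.

Lemma ev_base g : ev (tbase k0 g) = z ^+ eps g.
Proof.
rewrite /ev (bigD1 g) //= ffunE eqxx rmorph1 mul1r big1 ?addr0 // => x /negPf xg.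
by rewrite ffunE xg rmorph0 mul0r.
Qed.

Lemma graded_base g : graded (r g) (tbase k0 g).
Proof. by move=> x; rewrite ffunE; have [->|_] := eqVneq x g; rewrite ?eqxx. Qed.

Lemma ev_span A : L (ev A).
Proof. exact: span_sum. Qed.

Lemma ev_mul q q' A A' : graded q A -> graded q' A' ->
  ev (tmul f0 A A') = ev A * theta q (ev A') * (z ^+ n.+1) ^+ B q.2.2 q'.2.1.
Proof.
move=> gA gA'; rewrite /ev.
under eq_bigr => w _ do rewrite ffunE rmorph_sum mulr_suml.
rewrite exchange_big /= !mulr_suml; apply: eq_bigr => x _.
rewrite (reindex_inj (mulgI x)) /= rmorph_sum mulr_sumr mulr_suml.
apply: eq_bigr => y _; rewrite mulKg !rmorphM -mulrA base_cocycleE.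
have [->|Ax] := eqVneq (A x) 0; first by rewrite rmorph0 !mul0r.
have [->|A'y] := eqVneq (A' y) 0; first by rewrite !rmorph0 !(mulr0, mul0r).
by rewrite (gA _ Ax) (gA' _ A'y) /= (theta_fixed _ (iotaK _)); ring.
Qed.

Lemma degree_section q : exists g : 'I_n.+1 -> gT, forall i, eps (g i) = i /\ r (g i) = q.
Proof. by apply: (@fin_all_exists _ _ (fun i y => eps y = i /\ r y = q)) => i. Qed.

Lemma ev_graded q A (g : 'I_n.+1 -> gT) : (forall i, eps (g i) = i /\ r (g i) = q) ->
  graded q A -> ev A = \sum_i iota (A (g i)) * z ^+ i.
Proof.
move=> gP gA; have gK : cancel g eps by move=> i; case: (gP i).
rewrite /ev (bigID (fun y => r y == q)) /= [X in _ + X]big1 ?addr0.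
  rewrite [RHS](reindex_onto eps g) => [|i _]; last exact: gK.
  apply: eq_big => [y|y /eqP ryq].
    apply/eqP/eqP => [ryq|<-]; last by case: (gP (eps y)).
    by apply: coord_inj; [rewrite gK | have [_ ->] := gP (eps y)].
  congr (iota (A _) * _).
  by apply: coord_inj; [rewrite gK | have [_ ->] := gP (eps y)].
move=> y; apply: contraNeq; rewrite mulf_eq0 negb_or fmorph_eq0 => /andP[Ay _].
by apply/eqP; apply: gA.
Qed.

Lemma ev_inj q A : graded q A -> ev A = 0 -> A = tzero k0 gT.
Proof.
move=> gA eA; apply/ffunP => x; rewrite ffunE.
have [//|Ax] := eqVneq (A x) 0; case/eqP: (Ax); apply: (fmorph_inj iota).
rewrite rmorph0; have [g gP] := degree_section q.
have -> : x = g (eps x).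
  by have [e1 e2] := gP (eps x); apply: coord_inj; rewrite ?e1 ?e2 ?(gA _ Ax).
apply: (span_free C (c := fun i => iota (A (g i))) (e := id)) => [i|//|]; first exact: iotaK.
by rewrite -(ev_graded gP gA).
Qed.

Lemma crossed_domain A A' : homogeneous r A -> homogeneous r A' ->
  A != tzero k0 gT -> A' != tzero k0 gT -> tmul f0 A A' != tzero k0 gT.
Proof.
move=> [q gA] [q' gA'] A0 A'0; apply/eqP => AA'.
have := ev_mul gA gA'; rewrite AA' /ev big1 => [/esym/eqP|x _]; last first.
  by rewrite ffunE rmorph0 mul0r.
rewrite !mulf_eq0 fmorph_eq0 (negPf (expf_neq0 _ (zn_neq0 C))) orbF -!/(ev _).
case/orP => /eqP e0; [case/eqP: A0 | case/eqP: A'0].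
  exact: ev_inj gA e0.
exact: ev_inj gA' e0.
Qed.

Lemma coord1 : r 1%g = 1%g /\ eps 1%g = ord0.
Proof.
have r1 : r 1%g = 1%g by apply: (mulgI (r 1%g)); rewrite -rM !mulg1.
split=> //; apply: val_inj => /=.
have /eqP := epsM 1%g 1%g; rewrite mulg1 r1 /kap /= !expn0 !mul1n.
rewrite -{1}(modn_small (ltn_ord (eps 1%g))) -[X in X == _ %[mod _]]addn0.
by rewrite eqn_modDl mod0n modn_small // => /eqP.
Qed.

Lemma crossed_center A : homogeneous r A ->
    (forall g, tmul f0 A (tbase k0 g) = tmul f0 (tbase k0 g) A) ->
  A 1%g = 0 -> A = tzero k0 gT.
Proof.
move=> [q gA] cA A1; have [//|] := eqVneq (ev A) 0 => [/(ev_inj gA)//|eA0].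
have zn0 := zn_neq0 C; have zn := z_neq0 C; have LA := ev_span A.
have cAg g : ev A * theta q (z ^+ eps g) * (z ^+ n.+1) ^+ B q.2.2 (r g).2.1 =
    z ^+ eps g * theta (r g) (ev A) * (z ^+ n.+1) ^+ B (r g).2.2 q.2.1.
  have := congr1 ev (cA g).
  by rewrite (ev_mul gA (@graded_base g)) (ev_mul (@graded_base g) gA) ev_base.
(* Basis elements with exponent [0] and trivial degree in [sigma] and [tau] act trivially on [L], so
   commuting with them constrains only the pairing. *)
have cB x y : B q.2.2 x = B y q.2.1 %[mod d].
  have [g [eg rg]] := coord_surj ord0 (1, (x, y))%g; have := cAg g.
  rewrite eg rg expr0 rmorph1 mulr1 mul1r /theta /iterm /= => /(mulfI eA0)/eqP.
  by rewrite (eq_prim_root_expr (cd_prim C)) => /eqP.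
have B1r y : (d %| B y 1%g)%N by rewrite B_sym B1l.
have q22 : q.2.2 = 1%g.
  apply: B_nd => y; have := cB y 1%g.
  by rewrite (eqP (B1l _)) => /eqP.
have q21 : q.2.1 = 1%g.
  apply: B_nd => y; have := cB 1%g y.
  by rewrite (eqP (B1r _)) B_sym => /esym/eqP.
have cA1 g : (r g).2 = 1%g ->
    ev A * theta q (z ^+ eps g) = z ^+ eps g * theta (r g) (ev A).
  move=> rg2; have := cAg g; rewrite rg2 q22 q21.
  move=> /(mulIf (expf_neq0 _ zn0)); exact.
(* Commuting with [z] makes the degree act trivially on [z]. For [n = 0] the exponent [inord 1] is
   [0] and tests nothing, but then [a = b = 0]. *)
have q1 : q.1 = 1%g.
  have [g [eg rg]] := coord_surj (inord 1) 1%g; have := cA1 g.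
  rewrite rg => /(_ erefl); rewrite {2}/theta /iterm /= mulrC => /(mulIf eA0).
  rewrite (theta_z C) eg; case: (posnP n) => [n0 _|n_gt0].
    have := cd_card C; rewrite n0 => /esym/eqP; rewrite muln_eq1 => /andP[/eqP a0 /eqP b0].
    case: (q.1) => i j; congr (_, _); apply: val_inj.
      by have := ltn_ord i; rewrite {2}a0 ltnS leqn0 => /eqP.
    by have := ltn_ord j; rewrite {2}b0 ltnS leqn0 => /eqP.
  rewrite inordK // muln1 => E.
  have := cd_faithful C (ltn_ord q.1.1) (ltn0Sn a) (ltn_ord q.1.2) (ltn0Sn b).
  rewrite !expn0 muln1 => /(_ E)[i0 j0]; rewrite [q.1]surjective_pairing.
  by congr (_, _); apply: val_inj.
have th1 q' : q'.2 = 1%g -> theta q' (ev A) = ev A.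
  move=> q'2; have [g [eg rg]] := coord_surj ord0 q'; have := cA1 g.
  by rewrite rg eg expr0 rmorph1 mulr1 mul1r => /(_ q'2)/esym.
(* For [m = 0] the index [inord 1] is [0], and it is the order relation on [L] that gives the
   conclusion. *)
have iter_id (f : {rmorphism F -> F}) (m : nat) : iterm f m.+1 (ev A) = ev A ->
    (forall i : 'I_m.+1, iterm f i (ev A) = ev A) -> f (ev A) = ev A.
  case: m => [|m] // _ /(_ (inord 1)); by rewrite inordK.
have sA : s (ev A) = ev A.
  apply: (iter_id _ a (span_sa C LA)) => i.
  by have := th1 (i, 1, 1)%g erefl; rewrite /theta /iterm /=.
have tA : t (ev A) = ev A.
  apply: (iter_id _ b (span_tb C LA)) => i.
  by have := th1 (1, i, 1)%g erefl; rewrite /theta /iterm /=.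
have [c cA'] := iota_surj (fixedP sA tA).
have q_1 : q = 1%g by rewrite [q]surjective_pairing q1 [q.2]surjective_pairing q21 q22.
have [r1 e1] := coord1.
(* The value of [A] is now a scalar of degree [1]; injectivity of [ev] makes [A] itself that scalar,
   so its coefficient at [1] decides. *)
pose A' := tadd A (tscale (- c) (tbase k0 1%g)).
have gA' : graded 1%g A'.
  move=> x; rewrite !ffunE; have [->|_] := eqVneq x 1%g; first by rewrite r1.
  by rewrite mulr0 addr0 => /gA; rewrite q_1.
have /ffunP/(_ 1%g) : A' = tzero k0 gT.
  apply: ev_inj gA' _; rewrite /ev.
  under eq_bigr => x _ do rewrite ffunE rmorphD mulrDl.
  rewrite big_split /= -/(ev A) (bigD1 1%g) //= !ffunE eqxx mulr1 rmorphN cA' e1 expr0 mulr1.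
  rewrite big1 ?addr0 ?subrr // => x /negPf x1.
  by rewrite !ffunE x1 mulr0 rmorph0 mul0r.
rewrite !ffunE A1 eqxx mulr1 add0r => /eqP; rewrite oppr_eq0 => /eqP c0.
by case/eqP: eA0; rewrite -cA' c0 rmorph0.
Qed.

Lemma graded_uniq q q' A : A != tzero k0 gT -> graded q A -> graded q' A -> q = q'.
Proof. by move=> /tga_neq0[x Ax] gA gA'; rewrite -(gA _ Ax) -(gA' _ Ax). Qed.

Lemma graded_mul q q' A A' : graded q A -> graded q' A' ->
  graded (q * q')%g (tmul f0 A A').
Proof.
move=> gA gA' x; rewrite ffunE => S0.
have [y] : exists y, A y * A' (y^-1 * x)%g * f0 y (y^-1 * x)%g != 0.
  apply: NNPP => ny; case/eqP: S0; apply: big1 => y _.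
  by apply/eqP/negPn/negP => y0; apply: ny; exists y.
rewrite !mulf_eq0 !negb_or => /andP[/andP[/gA ry /gA' ryx] _].
by rewrite -ry -ryx -rM mulKVg.
Qed.

Lemma coord_card : #|gT| = (n.+1 * #|{: qT}|)%N.
Proof.
have [g gP] : exists g : 'I_n.+1 * qT -> gT, forall p, eps (g p) = p.1 /\ r (g p) = p.2.
  by apply: (@fin_all_exists _ _ (fun p y => eps y = p.1 /\ r y = p.2)) => p.
rewrite -[X in (X * _)%N](card_ord n.+1) -card_prod.
apply/esym/(@bij_eq_card _ _ g); exists (fun x => (eps x, r x)) => [p|x].
  by have [-> ->] := gP p; rewrite -surjective_pairing.
by have [e1 e2] := gP (eps x, r x); apply: coord_inj.
Qed.

Lemma crossed_form : [pchar F] =i pred0 ->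
  exists (k : fieldType) (f : gT -> gT -> k), [/\ cocycle f, central_simple f &
    forall (hT : finGroupType) (g : hT -> hT -> k), cocycle g -> tga_iso f g ->
      exists (x : hT -> F) (q : hT -> qT), crossed_basis s t n z x q].
Proof.
move=> ch0.
have ch0k : [pchar k0] =i pred0.
  move=> p; rewrite -(ch0 p) !inE; congr (_ && _).
  by rewrite -(fmorph_eq0 iota) rmorph_nat.
have [k [f [fC fS fB]]] := generic_form rM base_cocycleP
  (abelian_grading a b (cd_abelian C)) ch0k crossed_domain crossed_center.
exists k, f; split=> // hT g gC iso; have [cardE [A [hA mA A1]]] := fB hT g gC iso.
have [q gq] : exists q : hT -> qT, forall h, graded (q h) (A h).
  apply: (@fin_all_exists _ _ (fun h p => graded p (A h))) => h.
  by have [[p gp] _] := hA h; exists p.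
have A0 h : A h != tzero k0 gT by case: (hA h).
have x0 h : ev (A h) != 0.
  by apply/eqP => /(ev_inj (gq h)) /eqP; rewrite (negPf (A0 h)).
have qM h h' : q (h * h')%g = (q h * q h')%g.
  apply: graded_uniq (A0 _) (gq _) _; have [c c0 ->] := mA h h' => x.
  by rewrite ffunE mulf_eq0 negb_or => /andP[_]; apply: graded_mul.
exists (fun h => ev (A h)), q; split=> //.
- by move=> h; apply: ev_span.
- move=> h h'; have [c c0 ->] := mA h h'.
  have -> : ev (tscale c (tmul f0 (A h) (A h'))) =
      iota c * ev (tmul f0 (A h) (A h')).
    by rewrite mulr_sumr; apply: eq_bigr => x _; rewrite ffunE rmorphM mulrA.
  rewrite (ev_mul (gq h) (gq h')) mulrCA mulrAC mulfV ?mul1r; last first.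
    by rewrite mulf_neq0 // fmorph_eq0.
  by apply: fixedM; [exact: iotaK | apply: fixedX; apply: cd_fixed C].
- move=> h c qh h1 cK eh.
  have [gs gP] := degree_section (q h).
  have [r1 e1] := coord1.
  have gs0 : gs ord0 = 1%g.
    by have [e2 r2] := gP ord0; apply: coord_inj; rewrite ?e2 ?r2 ?r1 ?e1.
  have S0 : \sum_i (c i - iota (A h (gs i))) * z ^+ i = 0.
    under eq_bigr => i _ do rewrite mulrBl.
    by rewrite sumrB -eh -(ev_graded gP (gq h)) subrr.
  have cK' i : c i - iota (A h (gs i)) \in K.
    have iK := iotaK (A h (gs i)); have ciK := cK i.
    by apply: fixedP; rewrite rmorphB /= ?(fixed_s iK) ?(fixed_s ciK) ?(fixed_t iK) ?(fixed_t ciK).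
  have := span_free C (e := id) cK' (fun _ _ => id) S0 ord0.
  by rewrite gs0 A1 // rmorph0 subr0.
by rewrite cardE coord_card.
Qed.

End CrossedForm.

(** * Projective bases of the crossed product *)

Lemma grading_expg a b (aT : finGroupType) (w : grading a b aT) m :
  (w ^+ m)%g = (w.1.1 ^+ m, w.1.2 ^+ m, w.2 ^+ m)%g.
Proof. by elim: m => [|m IH]; rewrite ?expg0 // !expgS IH. Qed.

Lemma ord_expg_card m (i : 'I_m.+1) : (i ^+ m.+1 = 1)%g.
Proof. by rewrite -[X in (i ^+ X)%g](card_ord m.+1) -cardsT expg_cardG ?inE. Qed.

Lemma iterm_prod_fixed (F : fieldType) (s : {rmorphism F -> F}) m y :
  iterm s m.+1 y = y ->
  s (\prod_(j < m.+1) iterm s j y) = \prod_(j < m.+1) iterm s j y.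
Proof.
move=> sy; rewrite rmorph_prod big_ord_recr [RHS]big_ord_recl /= mulrC.
by rewrite -[s (iterm s m y)]/(iterm s m.+1 y) sy.
Qed.

Section BasisFacts.

Variables (F : fieldType) (s t : {rmorphism F -> F}) (a b : nat) (aT : finGroupType).
Variables (n : nat) (z : F) (u v d : nat) (B : aT -> aT -> nat).
Hypothesis C : crossed_data s t a b n z u v d B.

Local Notation qT := (grading a b aT).
Local Notation K := (fixedK s t).
Local Notation L := (spanL s t n z).
Local Notation theta := (@theta F s t a b aT).

Variables (hT : finGroupType) (x : hT -> F) (q : hT -> qT).
Hypothesis X : crossed_basis s t n z x q.

Lemma fixedMr y y' : y \in K -> y != 0 -> (y' * y \in K) = (y' \in K).
Proof.
move=> yK y0; apply/idP/idP => [yyK|y'K]; last exact: fixedM.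
by rewrite -(mulfK y0 y'); apply: fixedM => //; apply: fixedV.
Qed.

(** A quotient in [K] expresses congruence modulo the units of [K]; only such classes behave
    multiplicatively along a projective basis. *)
Lemma fixed_trans y2 y1 y3 : y2 != 0 -> y1 / y2 \in K -> y2 / y3 \in K -> y1 / y3 \in K.
Proof.
by move=> y20 K12 K23; rewrite -(mulfVK y20 y1) -mulrA; apply: fixedM.
Qed.

Lemma fixed_sym y1 y2 : y1 / y2 \in K -> y2 / y1 \in K.
Proof. by move/fixedV; rewrite invfM invrK mulrC. Qed.

Lemma fixed_mul2 y1 y2 y3 y4 : y1 / y2 \in K -> y3 / y4 \in K -> (y1 * y3) / (y2 * y4) \in K.
Proof. by move=> K12 K34; rewrite -mulf_div; apply: fixedM. Qed.

Lemma fixed_rmorph (f : {rmorphism F -> F}) y1 y2 : (forall c, c \in K -> f c = c) ->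
  y1 / y2 \in K -> f y1 / f y2 \in K.
Proof. by move=> fK K12; rewrite -fmorph_div fK. Qed.

Lemma theta1 p y : p.1 = 1%g -> theta p y = y.
Proof. by case: p => [[i j] w] /= [-> ->]. Qed.

Lemma deg1 : q 1%g = 1%g.
Proof. by apply: (mulgI (q 1%g)); rewrite -(cb_deg X) !mulg1. Qed.

Lemma degV h : q h^-1%g = (q h)^-1%g.
Proof. by apply: (mulgI (q h)); rewrite -(cb_deg X) !mulgV deg1. Qed.

Lemma degX h m : q (h ^+ m)%g = (q h ^+ m)%g.
Proof. by elim: m => [|m IH]; rewrite ?expg0 ?deg1 // !expgS (cb_deg X) IH. Qed.

Lemma basis1 : x 1%g \in K.
Proof.
have := cb_mul X 1%g 1%g; rewrite mulg1 deg1 theta1 //.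
rewrite invfM mulrA mulfV ?(cb_neq0 X) // mul1r => /fixedV.
by rewrite invrK.
Qed.

(** An element of [K] is its own constant coefficient in the powers of [z], so away from [1] the
    trace condition would make it zero. *)
Lemma basis_eq1 h : q h = 1%g -> x h \in K -> h = 1%g.
Proof.
move=> qh xK; apply/eqP/negPn/negP => h1.
have /= := cb_trace X (c := fun i => if i == ord0 then x h else 0) qh h1.
move=> H; case/eqP: (cb_neq0 X h); apply: H => [i|].
  by case: eqP => // _; apply: fixedP; rewrite rmorph0.
rewrite big_ord_recl /= mulr1 big1 ?addr0 // => i _.
by rewrite mul0r.
Qed.

(** From here on, relations in [hT] are proved by comparing degrees and classes modulo [K]. *)
Lemma basis_inj h h' : q h = q h' -> x h / x h' \in K -> h = h'.
Proof.
move=> qq xx; apply/eqP; rewrite eq_mulVg1; apply/eqP.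
apply: basis_eq1; first by rewrite (cb_deg X) degV qq mulVg.
rewrite -(divr1 (x _)).
have x0 := cb_neq0 X; have th0 p y : (theta p (x y) != 0) by rewrite fmorph_eq0.
apply: (@fixed_trans (x h^-1%g * theta (q h^-1%g) (x h'))).
- by rewrite mulf_neq0.
- exact: (cb_mul X).
apply: (@fixed_trans (x h^-1%g * theta (q h^-1%g) (x h))).
- by rewrite mulf_neq0.
- apply: fixed_mul2; first by rewrite mulfV ?fixed1.
  apply: fixed_sym; apply: fixed_rmorph xx => c; exact: theta_fixed.
apply: (@fixed_trans (x 1%g)) => //; last by rewrite divr1 basis1.
by apply: fixed_sym; have := cb_mul X h^-1%g h; rewrite mulVg.
Qed.

Lemma basis_expg h m : x (h ^+ m)%g / \prod_(j < m) iterm (theta (q h)) j (x h) \in K.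
Proof.
elim: m => [|m IH]; first by rewrite big_ord0 divr1 basis1.
rewrite expgS; apply: (@fixed_trans (x h * theta (q h) (x (h ^+ m)%g))).
- by rewrite mulf_neq0 ?fmorph_eq0 ?(cb_neq0 X).
- exact: (cb_mul X).
rewrite big_ord_recl /=; apply: fixed_mul2.
  by rewrite mulfV ?fixed1 ?(cb_neq0 X).
have := fixed_rmorph (fun c => theta_fixed (q h) (y:=c)) IH.
by rewrite rmorph_prod.
Qed.

Lemma basis_expg1 h m : (q h).1 = 1%g -> x (h ^+ m)%g / x h ^+ m \in K.
Proof.
move=> qh; have := basis_expg h m.
rewrite (eq_bigr (fun=> x h)) ?prodr_const ?card_ord // => j _.
by rewrite iterm_fixed //= theta1.
Qed.

Lemma basis_torsion h : (q h).1 = 1%g -> x h ^+ #|hT| \in K.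
Proof.
move=> qh; have := basis_expg1 #|hT| qh.
have -> : (h ^+ #|hT|)%g = 1%g by rewrite -cardsT expg_cardG ?inE.
move=> /fixed_sym; rewrite fixedMr ?fixedV ?basis1 //.
by rewrite invr_eq0 (cb_neq0 X).
Qed.

Lemma basis_mul1 h h' : (q h).1 = 1%g -> x (h * h')%g / (x h * x h') \in K.
Proof. by move=> qh; have := cb_mul X h h'; rewrite theta1. Qed.

Lemma basis_mulK h h' y y' : y != 0 -> y' != 0 -> x h / y \in K -> x h' / y' \in K ->
  x (h * h')%g / (y * theta (q h) y') \in K.
Proof.
move=> y0 y'0 hy h'y'; apply: (fixed_trans _ (cb_mul X h h')).
  by rewrite mulf_neq0 ?fmorph_eq0 ?(cb_neq0 X).
apply: fixed_mul2 => //; apply: fixed_rmorph h'y' => c; exact: theta_fixed.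
Qed.

Lemma basis_expK h m y : y != 0 -> x h / y \in K ->
  x (h ^+ m)%g / \prod_(j < m) iterm (theta (q h)) j y \in K.
Proof.
move=> y0 hy; apply: (fixed_trans _ (basis_expg h m)).
  by apply/prodf_neq0 => j _; rewrite fmorph_eq0 (cb_neq0 X).
rewrite -prodf_div; elim/big_ind: _ => [|c1 c2 K1 K2|j _]; first exact: fixed1.
  exact: fixedM.
by apply: fixed_rmorph hy => c cK; rewrite /= iterm_fixed //= theta_fixed.
Qed.

Lemma basis_expK1 h m y : y != 0 -> (q h).1 = 1%g -> x h / y \in K ->
  x (h ^+ m)%g / y ^+ m \in K.
Proof.
move=> y0 qh hy; have := basis_expK m y0 hy.
rewrite (eq_bigr (fun=> y)) ?prodr_const ?card_ord // => j _.
by rewrite iterm_fixed //= theta1.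
Qed.

Lemma basis_eq1K h y : y != 0 -> q h = 1%g -> x h / y \in K -> y \in K -> h = 1%g.
Proof.
by move=> y0 qh hy yK; apply: basis_eq1; rewrite // -(mulfVK y0 (x h)); apply: fixedM.
Qed.

Lemma basis_exp_norm (f : {rmorphism F -> F}) h m : theta (q h) =1 f ->
  x (h ^+ m)%g / \prod_(j < m) iterm f j (x h) \in K.
Proof.
move=> thf; have := basis_expg h m.
rewrite (eq_bigr (fun j : 'I_m => iterm f j (x h))) // => j _.
by rewrite /iterm; apply: eq_iter.
Qed.

Definition deg_morph : {morphism [set: hT] >-> qT} :=
  @Morphism hT qT [set: hT] q (fun h h' _ _ => cb_deg X h h').

Definition deg_ker : {group hT} := 'ker deg_morph.

Lemma in_deg_ker h : (h \in deg_ker) = (q h == 1%g).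
Proof. by rewrite !inE. Qed.

Lemma deg_card : (#|deg_ker| * #|(deg_morph @* [set: hT])%g| = n.+1 * #|{: qT}|)%N.
Proof.
rewrite -(cb_card X) -cardsT -(Lagrange (subsetT deg_ker)); congr (_ * _)%N.
by rewrite card_morphim setIid.
Qed.

(** The degree map has at most [#|qT|] values, on a group [n.+1] times as large. *)
Lemma deg_ker_ge : (n.+1 <= #|deg_ker|)%N.
Proof.
have qT0 : (0 < #|{: qT}|)%N by apply/card_gt0P; exists 1%g.
by rewrite -(leq_pmul2r qT0) -deg_card leq_mul2l max_card orbT.
Qed.

Lemma deg_surj : (#|deg_ker| <= n.+1)%N -> forall p, exists h, q h = p.
Proof.
move=> le_ker p; have : p \in (deg_morph @* [set: hT])%g.
  have -> : (deg_morph @* [set: hT])%g = [set: qT].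
    apply/eqP; rewrite eqEcard subsetT /= cardsT.
    by rewrite -(leq_pmul2l (ltn0Sn n)) -deg_card leq_mul2r le_ker orbT.
  by rewrite inE.
by case/morphimP => h _ _ ->; exists h.
Qed.

End BasisFacts.

(** All inequalities are squeezed: [H1] is a quotient of [K1], [H2] embeds in [wT], and their
    product has at least [#|K1| * #|wT|] elements. Equality makes the product direct and both
    comparisons isomorphisms. *)
Lemma dprod_isog_card (gT hT wT : finGroupType) (K1 K2 : {group gT})
    (H1 H2 : {group hT}) (psi : hT -> wT) :
    (K1 \x K2 = [set: gT])%g -> (K2 \isog [set: wT])%g -> (H1 \homg K1)%g ->
    H2 \subset ('C(H1))%g -> (H1 * H2 = [set: hT])%g ->
    {in H2 &, {morph psi : x y / (x * y)%g}} ->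
    (forall h, h \in H2 -> psi h = 1%g -> h = 1%g) ->
    (#|K1| * #|wT| <= #|hT|)%N ->
  ([set: hT] \isog [set: gT])%g.
Proof.
move=> defG isoK2 homH1 cH defH psiM psi1 leH.
pose f := Morphism psiM.
have injf : ('injm f)%g.
  by apply/subsetP => h; rewrite !inE /= => /andP[Hh /eqP/psi1->].
have card2 : (#|H2| <= #|wT|)%N by rewrite -(card_injm injf) ?max_card.
have card1 := leq_homg homH1.
have wT0 : (0 < #|wT|)%N by apply/card_gt0P; exists 1%g.
have leM : (#|K1| * #|wT| <= #|H1| * #|H2|)%N.
  by apply: leq_trans leH _; rewrite -cardsT -defH mul_cardG leq_pmulr ?cardG_gt0.
have eq1 : #|H1| = #|K1|.
  apply/eqP; rewrite eqn_leq card1 -(leq_pmul2r wT0) (leq_trans leM) //.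
  by rewrite leq_mul2l card2 orbT.
have eq2 : #|H2| = #|wT|.
  apply/eqP; rewrite eqn_leq card2 /=.
  by move: leM; rewrite eq1 leq_pmul2l ?cardG_gt0.
have tiH : (H1 :&: H2 = 1)%g.
  apply: cardMg_TI; rewrite defH cardsT; apply: leq_trans leH.
  by rewrite eq1 eq2.
have defHd : (H1 \x H2 = [set: hT])%g by rewrite dprodE.
apply: (isog_dprod defHd defG).
- by rewrite isogEcard homH1 eq1 leqnn.
have imf : (f @* H2 = [set: wT])%g.
  by apply/eqP; rewrite eqEcard subsetT /= card_injm // eq2 cardsT.
have := sub_isog (subxx _) injf; rewrite imf => /isog_trans; apply.
by rewrite isog_sym.
Qed.

(** * Splitting off the symmetric factor *)

Section Assembly.

Variables (F : fieldType) (s t : {rmorphism F -> F}) (a b : nat) (aT : finGroupType).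
Variables (n : nat) (z : F) (u v d : nat) (B : aT -> aT -> nat).
Hypothesis C : crossed_data s t a b n z u v d B.

Local Notation qT := (grading a b aT).
Local Notation K := (fixedK s t).
Local Notation theta := (@theta F s t a b aT).

Variables (hT : finGroupType) (x : hT -> F) (q : hT -> qT).
Hypothesis X : crossed_basis s t n z x q.

Variable rho : F.
Hypotheses (rho0 : rho != 0) (s_rho : s rho = rho) (t_rho : t rho / rho \in K).
Hypothesis rho2 : rho ^+ 2 \in K.
Hypothesis no_rho : forall h, q h = 1%g -> x h / rho \in K -> h = 1%g.

(** The classes generated by [rho] modulo [K]; [rho] will be [sqrt -2] in the third family and [1]
    in the others. *)
Definition rhoK : {pred F} := fun y => (y \in K) || (y / rho \in K).

Lemma rhoK_theta p y : y \in rhoK -> theta p y / y \in K.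
Proof.
have th_rho : theta p rho / rho \in K.
  rewrite /theta; have tK j : iterm t j rho / rho \in K.
    elim: j => [|j IH]; first by rewrite /iterm /= mulfV ?fixed1.
    rewrite -[iterm _ _ _]/(t (iterm t j rho)).
    apply: (@fixed_trans _ _ _ (t rho)) => //; first by rewrite fmorph_eq0.
    by apply: fixed_rmorph IH => c; apply: fixed_t.
  apply: (@fixed_trans _ _ _ (iterm s p.1.1 rho)); first by rewrite fmorph_eq0.
    by apply: fixed_rmorph (tK _) => c cK; rewrite /= iterm_fixed ?(fixed_s cK).
  by rewrite iterm_fixed // mulfV ?fixed1.
have [->|y0] := eqVneq y 0; first by rewrite invr0 mulr0 => _; apply: fixedP; rewrite rmorph0.
case/orP => yK; first by rewrite theta_fixed // mulfV ?fixed1.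
have -> : y = y / rho * rho by rewrite mulfVK.
rewrite rmorphM /= (theta_fixed _ yK) -mulf_div mulfV ?mul1r //.
by rewrite mulf_neq0 ?invr_eq0.
Qed.

Lemma rhoKM y1 y2 y3 : y1 \in rhoK -> y2 \in rhoK -> y1 * y2 != 0 ->
  y3 / (y1 * y2) \in K -> y3 \in rhoK.
Proof.
move=> y1K y2K y0 y3K.
suff : y1 * y2 \in rhoK.
  move=> y12K; apply/orP; case/orP: y12K => yK; [left|right].
    by rewrite -(mulfVK y0 y3); apply: fixedM.
  have -> : y3 / rho = y3 / (y1 * y2) * (y1 * y2 / rho) by rewrite mulrA mulfVK.
  exact: fixedM.
apply/orP; case/orP: y1K => y1K; case/orP: y2K => y2K; [left|right|right|left].
- exact: fixedM.
- by rewrite -mulrA; apply: fixedM.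
- by rewrite mulrAC; apply: fixedM.
have -> : y1 * y2 = (y1 / rho) * (y2 / rho) * rho ^+ 2 by field.
by apply: fixedM => //; apply: fixedM.
Qed.

(** The future symmetric factor: its elements are central because the action changes [rho] by a
    scalar only, and [no_rho] makes the degree in [aT * aT] faithful on it. *)
Definition rho_set := [set h | ((q h).1 == 1%g) && (x h \in rhoK)].

Lemma rho_group_set : group_set rho_set.
Proof.
have x0 := cb_neq0 X; apply/group_setP; split=> [|h h'].
  by rewrite inE (deg1 X) eqxx unfold_in (basis1 X).
rewrite !inE => /andP[/eqP qh hK] /andP[/eqP qh' h'K].
rewrite (cb_deg X) -[(_ * _)%g.1]/((q h).1 * (q h').1)%g qh qh' mulg1 eqxx /=.
by apply: rhoKM hK h'K _ _; rewrite ?mulf_neq0 //; apply: (basis_mul1 X).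
Qed.

Definition rho_group := Group rho_group_set.

Lemma rho_central h g : h \in rho_group -> (h * g = g * h)%g.
Proof.
rewrite inE => /andP[/eqP qh hK]; have x0 := cb_neq0 X.
have cq : (q h * q g = q g * q h)%g.
  by apply: (centsP (abelian_grading a b (cd_abelian C))); rewrite inE.
apply: (basis_inj X); first by rewrite !(cb_deg X).
apply: (@fixed_trans _ _ _ (x h * x g)); rewrite ?mulf_neq0 //.
  exact: (basis_mul1 X).
apply: (@fixed_trans _ _ _ (x g * theta (q g) (x h))).
- by rewrite mulf_neq0 ?fmorph_eq0.
- rewrite [x h * _]mulrC; apply: fixed_mul2; first by rewrite mulfV ?fixed1.
  by apply: fixed_sym; apply: rhoK_theta.
by apply: fixed_sym; apply: (cb_mul X).
Qed.

Lemma rho_deg_inj h : h \in rho_group -> (q h).2 = 1%g -> h = 1%g.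
Proof.
rewrite inE => /andP[/eqP qh1 hK] qh2.
have qh : q h = 1%g by rewrite [q h]surjective_pairing qh1 qh2.
by case/orP: hK => hK; [apply: (basis_eq1 X) | apply: no_rho].
Qed.

Variables hp hs ht : hT.
Hypotheses (q_hp : q hp = 1%g) (q_hs : q hs = (inord 1, 1, 1)%g).
Hypothesis q_ht : q ht = (1, inord 1, 1)%g.
Hypothesis cover : forall h, (q h).1 = 1%g -> exists m, x (hp ^+ m * h)%g \in rhoK.

Let H1 : {group hT} := <<[set hp; hs; ht]>>%G.

Lemma gen_mul : (H1 * rho_group = [set: hT])%g.
Proof.
have [Hp Hs Ht] : [/\ hp \in H1, hs \in H1 & ht \in H1].
  by split; apply: mem_gen; rewrite !inE eqxx ?orbT.
have expi (m : nat) (i : 'I_m.+1) : (inord 1 ^+ i)%g = i :> 'I_m.+1.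
  case: m i => [|m] i; first by rewrite !ord1.
  by rewrite Zp_expg; apply: val_inj; rewrite /= inordK // mul1n modn_small.
apply/eqP; rewrite eqEsubset subsetT /=; apply/subsetP => h _.
(* [g] cancels the degree in [sigma] and [tau]; a power of [hp] then cancels the power of [z]. *)
pose g := (hs ^+ (q h).1.1 * ht ^+ (q h).1.2)%g.
have qg : (q g).1 = (q h).1.
  rewrite (cb_deg X) !(degX X) q_hs q_ht.
  rewrite !grading_expg /= -[LHS]/(inord 1 ^+ _ * 1 ^+ _, 1 ^+ _ * inord 1 ^+ _)%g.
  by rewrite !expg1n !expi mulg1 mul1g -surjective_pairing.
have q1 : (q (g^-1 * h)%g).1 = 1%g.
  by rewrite (cb_deg X) (degV X) -[LHS]/((q g).1^-1 * (q h).1)%g qg mulVg.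
have [m hK] := cover q1.
have -> : h = (g * hp ^- m * (hp ^+ m * (g^-1 * h)))%g by rewrite mulgA mulgKV mulKVg.
apply: mem_mulg; first by rewrite !(groupM, groupV, groupX).
by rewrite inE hK (cb_deg X) (degX X) q_hp expg1n mul1g q1 eqxx.
Qed.

Lemma crossed_isog (gT : finGroupType) (K1 K2 : {group gT}) :
    (K1 \x K2 = [set: gT])%g -> (K2 \isog [set: aT * aT])%g -> (H1 \homg K1)%g ->
    (#|K1| <= n.+1 * (a.+1 * b.+1))%N ->
  ([set: hT] \isog [set: gT])%g.
Proof.
move=> defG isoK2 homH1 leK1.
apply: (dprod_isog_card (psi := fun h => (q h).2) defG isoK2 homH1 _ gen_mul).
- by apply/centsP => h Hh g _; apply: rho_central.
- by move=> h h' _ _ /=; rewrite (cb_deg X).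
- exact: rho_deg_inj.
have cardq : #|{: qT}| = (a.+1 * b.+1 * #|{: aT * aT}|)%N.
  by rewrite card_prod [X in (X * _)%N = _]card_prod !card_ord.
rewrite (cb_card X) cardq mulnA.
by rewrite leq_mul2r leK1 orbT.
Qed.

End Assembly.

(** * Torsion classes modulo the base field *)

Section Torsion.

Variables (F : fieldType) (s : {rmorphism F -> F}) (a : nat) (z : F) (u p M w : nat).
Hypothesis pP : prime p.
Hypothesis z_prim : (p ^ M).-primitive_root z.
Hypothesis u_pow : (u ^ a.+1 = 1 + p ^ M * w)%N.
Hypothesis pw : ~~ (p %| w)%N.
Hypothesis s_root : forall y, y ^+ (p ^ M.+1) = 1 -> s y = y ^+ u.

Lemma root_exp_gcd (y : F) m m' : y ^+ m = 1 -> y ^+ m' = 1 -> y ^+ gcdn m m' = 1.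
Proof.
case: (posnP m) => [->|m0]; first by rewrite gcd0n.
move=> ym ym'; have [c e def_g _] := egcdnP m' m0.
have : y ^+ (c * m) = y ^+ (e * m' + gcdn m m') by rewrite def_g.
by rewrite exprD mulnC exprM ym expr1n mulnC exprM ym' expr1n mul1r.
Qed.

Lemma iterm_root y i : y ^+ (p ^ M.+1) = 1 -> iterm s i y = y ^+ (u ^ i).
Proof.
move=> y1; elim: i => [|i IH]; first by rewrite expn0 expr1.
rewrite -[iterm s i.+1 y]/(s (iterm s i y)) IH rmorphXn /= (s_root y1).
by rewrite -exprM expnS.
Qed.

(* The conjugation [s] does not have order [a.+1] on the next layer of roots of unity. *)
Lemma root_of_unity_bound y e : y ^+ (p ^ e) = 1 -> iterm s a.+1 y = y ->
  y ^+ (p ^ M) = 1.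
Proof.
elim: e => [|e IH] y1 sy.
  by have := expn0 p; move: y1; rewrite expn0 expr1 => ->; rewrite expr1n.
have [leeM|ltMe] := leqP e.+1 M.
  by rewrite -(subnKC leeM) expnD exprM y1 expr1n.
apply: IH => //; rewrite ltnS in ltMe.
pose y' := y ^+ (p ^ (e - M)).
have y'M : y' ^+ (p ^ M.+1) = 1.
  by rewrite -exprM -expnD addnS subnK.
have : iterm s a.+1 y' = y' by rewrite rmorphXn /= sy.
rewrite iterm_root // u_pow exprD expr1 => sy'.
have y'0 : y' != 0.
  by apply: contra_eq_neq y'M => ->; rewrite expr0n expn_eq0 -leqn0 leqNgt prime_gt0 //=
    eq_sym oner_neq0.
have y'w : y' ^+ (p ^ M * w) = 1.
  by apply: (mulfI y'0); rewrite mulr1.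
have := root_exp_gcd y'M y'w.
rewrite expnSr -muln_gcdr (_ : gcdn p w = 1)%N ?muln1.
  by rewrite -exprM -expnD subnK.
by apply/eqP; rewrite -/(coprime _ _) prime_coprime.
Qed.

Lemma telescope_conj y m : y != 0 ->
  \prod_(j < m) iterm s j (s y / y) = iterm s m y / y.
Proof.
move=> y0; elim: m => [|m IH]; first by rewrite big_ord0 /iterm /= mulfV.
rewrite big_ord_recr /= IH rmorphM fmorphV /=.
rewrite /iterm -iterSr /= mulrC -mulrA mulKf //.
by rewrite -[iter m s y]/(iterm s m y) fmorph_eq0.
Qed.

(** The quotient [s y / y] is a root of unity of [p]-power order fixed by the iterate [a.+1] of [s],
    hence a power of [z]. Its norm telescopes to [1], which is the divisibility. *)
Lemma torsion_character y e : y != 0 -> s (y ^+ (p ^ e)) = y ^+ (p ^ e) ->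
    iterm s a.+1 y = y ->
  exists2 c, s y = z ^+ c * y & (p ^ M %| c * \sum_(j < a.+1) u ^ j)%N.
Proof.
move=> y0 ye sy; pose c := s y / y.
have sc : iterm s a.+1 c = c.
  have ss : iterm s a.+1 (s y) = s (iterm s a.+1 y) by rewrite /iterm -iterSr.
  by rewrite fmorph_div /= ss sy.
have ce : c ^+ (p ^ e) = 1.
  by rewrite expr_div_n -rmorphXn ye mulfV // expf_neq0.
have /(prim_rootP z_prim)[i def_c] := root_of_unity_bound ce sc.
exists i; first by rewrite -def_c mulfVK.
have zM : z ^+ (p ^ M.+1) = 1 by rewrite expnSr exprM (prim_expr_order z_prim) expr1n.
have := telescope_conj a.+1 y0; rewrite sy mulfV // -/c def_c.
rewrite (eq_bigr (fun j : 'I_a.+1 => z ^+ (i * u ^ j))) => [|j _]; last first.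
  by rewrite rmorphXn /= iterm_root // -exprM mulnC.
rewrite -expr_sum -big_distrr /= => /eqP.
by rewrite -(prim_order_dvd z_prim).
Qed.

End Torsion.

(** * Rigidity: modular groups *)

Section KernelCount.

Variables (F : fieldType) (s t : {rmorphism F -> F}) (a b : nat) (aT : finGroupType).
Variables (n : nat) (z : F) (u v d : nat) (B : aT -> aT -> nat).
Hypothesis C : crossed_data s t a b n z u v d B.
Variables (hT : finGroupType) (x : hT -> F) (q : hT -> grading a b aT).
Hypothesis X : crossed_basis s t n z x q.
Local Notation K := (fixedK s t).

Lemma fixed_zmod m : z ^+ m / z ^+ (m %% n.+1) \in K.
Proof.
have zn := z_neq0 C; rewrite {1}(divn_eq m n.+1) exprD mulfK ?expf_neq0 //.
by rewrite mulnC exprM; apply: fixedX; apply: cd_fixed C.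
Qed.

(** A pigeonhole in both directions: the kernel of the degree map has at least [n.+1] elements and
    injects into [n.+1] labels. *)
Lemma ker_label (T : finType) (P : hT -> T -> Prop) : #|T| = n.+1 ->
    (forall h, q h = 1%g -> exists i, P h i) ->
    (forall h h' i, q h = 1%g -> q h' = 1%g -> P h i -> P h' i -> h = h') ->
  (forall p, exists h, q h = p) /\ forall i, exists h, q h = 1%g /\ P h i.
Proof.
move=> cardT exP injP.
have [i0 _] := exP 1%g (deg1 X).
have [f fP] : exists f : hT -> T, forall h, q h = 1%g -> P h (f h).
  apply: (@fin_all_exists _ _ (fun h i => q h = 1%g -> P h i)) => h.
  by have [/exP[i Phi]|qh] := eqVneq (q h) 1%g; [exists i | exists i0 => /eqP; rewrite (negPf qh)].
have kerE h : h \in deg_ker X -> q h = 1%g by rewrite in_deg_ker => /eqP.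
have cardE : #|f @: deg_ker X| = #|deg_ker X|.
  apply: card_in_imset => h h' /kerE qh /kerE qh' fh.
  by apply: (injP _ _ (f h)) => //; [apply: fP | rewrite fh; apply: fP].
have imT : f @: deg_ker X = setT.
  by apply/eqP; rewrite eqEcard subsetT /= cardsT cardT cardE deg_ker_ge.
split=> [|i].
  by apply: (deg_surj (X := X)); rewrite -cardE imT cardsT cardT.
have : i \in f @: deg_ker X by rewrite imT inE.
by case/imsetP => h /kerE qh ->; exists h; split=> //; apply: fP.
Qed.

End KernelCount.

Lemma type2_isog (F : fieldType) (s : {rmorphism F -> F}) (a : nat) (aT : finGroupType)
    (n : nat) (z : F) (v d p N S : nat) (B : aT -> aT -> nat)
    (hT gT : finGroupType) (x : hT -> F) (q : hT -> grading a 0 aT) (K1 K2 : {group gT}) :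
    prime p -> (0 < S < N)%N -> ~~ ((p == 2) && (S == 1))%N ->
    a.+1 = (p ^ N)%N -> n.+1 = (p ^ N)%N -> (p ^ (N + S)).-primitive_root z ->
    (forall y, y ^+ (p ^ (N + S).+1) = 1 -> s y = y ^+ (p ^ S).+1) ->
    crossed_data s idfun a 0 n z (p ^ S).+1 v d B ->
    crossed_basis s idfun n z x q -> (p.-group [set: hT])%g ->
    (K1 \x K2 = [set: gT])%g -> (K2 \isog [set: aT * aT])%g ->
    is_G1_type2 K1 p N S ->
  ([set: hT] \isog [set: gT])%g.
Proof.
move=> pP /andP[S0 ltSN] pS aE nE zP sR C X pH defG isoK2 isoK1.
have x0 := cb_neq0 X; have z0 := z_neq0 C.
have [w pw def_u] := expn_one_add_pfactorX N pP S0 pS.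
have p0 := prime_gt0 pP.
have n0 : (0 < n)%N.
  by rewrite -ltnS nE -(exp1n N) ltn_exp2r ?prime_gt1 //; lia.
have a0 : (0 < a)%N by rewrite -ltnS aE -nE.
have [e cardH] := p_natP pH; rewrite cardsT in cardH.
rewrite [(S + N)%N]addnC -aE [(1 + p ^ S)%N]add1n in def_u.
have tors h : (q h).1 = 1%g -> exists i : 'I_n.+1, x h / z ^+ i \in fixedK s idfun.
  move=> qh; have hK := basis_torsion X qh; rewrite cardH in hK.
  have [c sx] := torsion_character pP zP def_u pw sR (x0 h) (fixed_s hK)
    (span_sa C (cb_span X h)).
  (* The sum of exponents has valuation [N] and [z] has order [p ^ (N + S)], so [p ^ S] divides [c].
     As [s] multiplies [z ^+ i] by [z ^+ (p ^ S * i)], some power of [z] has the same character as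
     [x h]. *)
  have [y py sumE] := sum_expn_one_add N pP S0 pS.
  have -> : (\sum_(j < a.+1) (p ^ S).+1 ^ j = p ^ N * y)%N.
    by rewrite aE -sumE; apply: eq_bigr => j _; rewrite add1n.
  rewrite mulnCA expnD dvdn_pmul2l ?expn_gt0 ?p0 // mulnC Gauss_dvdr; last first.
    by rewrite coprimeXl // prime_coprime.
  case/dvdnP => i def_c.
  have iK : x h / z ^+ i \in fixedK s idfun.
    apply: fixedP => //; rewrite fmorph_div rmorphXn /= sx (cd_s C) def_c.
    rewrite -exprM mulSn exprD [(i * p ^ S)%N]mulnC.
    have cancel (y1 y2 y3 : F) : y1 != 0 -> y1 * y2 / (y3 * y1) = y2 / y3.
      by move=> y10; rewrite [y3 * y1]mulrC -mulf_div mulfV ?mul1r.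
    by rewrite cancel ?expf_neq0.
  exists (inord (i %% n.+1)); rewrite inordK ?ltn_pmod //.
  apply: fixed_trans iK _; first by rewrite expf_neq0.
  exact: (fixed_zmod C).
have [surj lab] : (forall r, exists h, q h = r) /\
    forall i : 'I_n.+1, exists h, q h = 1%g /\ x h / z ^+ i \in fixedK s idfun.
  apply: (ker_label X) => [|h qh|h h' i qh qh' hi h'i]; first exact: card_ord.
    by apply: tors; rewrite qh.
  apply: (basis_inj X); first by rewrite qh qh'.
  apply: (fixed_trans _ hi (fixed_sym h'i)); exact: expf_neq0.
have [hp [q_hp x_hp]] := lab (inord 1); rewrite inordK // expr1 in x_hp.
have [hs q_hs] := surj (inord 1, 1, 1)%g.
have th_hs y : theta s idfun (q hs) y = s y.
  by rewrite q_hs /theta /= inordK // /iterm.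
have hp_pow m : x (hp ^+ m)%g / z ^+ m \in fixedK s idfun.
  by apply: (basis_expK1 X); rewrite ?q_hp.
have zK := cd_fixed C.
apply: (crossed_isog C X (rho := 1) (hp := hp) (hs := hs) (ht := 1%g) _ _ _ _ _ q_hp q_hs
  _ _ defG isoK2).
- exact: oner_neq0.
- exact: rmorph1.
- by rewrite /= divr1; apply: fixed1.
- by rewrite expr1n; apply: fixed1.
- by move=> h qh; rewrite divr1; apply: (basis_eq1 X).
- by rewrite (deg1 X) (ord1 (inord 1)).
- move=> h qh; have [i hi] := tors h qh; exists (n.+1 - i)%N.
  apply/orP; left.
  have := basis_mulK X (expf_neq0 _ z0) (expf_neq0 _ z0) (hp_pow (n.+1 - i)%N) hi.
  rewrite (degX X) q_hp expg1n theta1 // -exprD subnK; last by rewrite ltnW // ltn_ord.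
  by rewrite fixedMr ?fixedV // invr_eq0 (zn_neq0 C).
- have q1 m : (q hp ^+ m = 1)%g by rewrite q_hp expg1n.
  apply: (type2_homg isoK1); rewrite -?nE.
  + by apply: (basis_eq1K X) (hp_pow _) _; rewrite ?(degX X) ?q1 ?expf_neq0.
  (* The power of [hs] has trivial degree, and its class is that of a norm, which [s] fixes. *)
  + pose y := \prod_(j < a.+1) iterm s j (x hs).
    have sy : s y = y := iterm_prod_fixed (span_sa C (cb_span X hs)).
    have y0 : y != 0 by apply/prodf_neq0 => j _; rewrite fmorph_eq0.
    apply: (basis_eq1K X (y := y) y0).
    * by rewrite (degX X) q_hs nE -aE grading_expg /= ord_expg_card !expg1n.
    * by rewrite nE -aE; apply: (basis_exp_norm X).
    by apply: fixedP.
  apply: (canLR (mulgK _)); apply: (basis_inj X).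
    by rewrite !(cb_deg X) (degX X) q1 q_hp mul1g mulg1.
  have xx : x hs / x hs \in fixedK s idfun by rewrite mulfV // fixed1.
  have := basis_mulK X (x0 hs) z0 xx x_hp.
  have := basis_mulK X (expf_neq0 _ z0) (x0 hs) (hp_pow (p ^ S).+1) xx.
  rewrite (degX X) q1 theta1 // th_hs (cd_s C) [x hs * _ ^+ _]mulrC => H1 H2.
  by apply: (fixed_trans _ H2 (fixed_sym H1)); rewrite mulf_neq0 ?expf_neq0.
by rewrite aE nE muln1; apply: type2_card isoK1.
Qed.

(** * Rigidity: the 2-groups with three generators *)

(** The base [3 = 1 + 2] is the case excluded from the valuation lemmas; the power is rewritten with
    base [9 = 1 + 2 ^ 3], whence the exponent [m.+2]. *)
Lemma expn3_pow2 m : (1 < m)%N ->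
  exists2 w, ~~ (2 %| w)%N & (3 ^ (2 ^ m) = 1 + 2 ^ m.+2 * w)%N.
Proof.
case: m => [|[|m]] // _.
have [w ow def_w] := @expn_one_add_pfactorX 2 3 m.+1 isT isT isT.
by exists w; rewrite // (_ : m.+4 = 3 + m.+1)%N -?def_w ?[(2 ^ m.+2)%N]expnS ?expnM //; lia.
Qed.

Section Type3.

Variables (F : fieldType) (s t : {rmorphism F -> F}) (a : nat) (aT : finGroupType).
Variables (n m : nat) (z : F) (v d : nat) (B : aT -> aT -> nat).
Hypothesis m2 : (1 < m)%N.
Hypothesis aE : a.+1 = (2 ^ m)%N.
Hypothesis nE : n.+1 = (2 ^ m.+1)%N.
Hypothesis zP : (2 ^ m.+2).-primitive_root z.
Hypothesis vE : v.+1 = (2 ^ m.+2)%N.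
Hypothesis sR : forall y, y ^+ (2 ^ m.+3) = 1 -> s y = y ^+ 3.
Hypothesis C : crossed_data s t a 1 n z 3 v d B.
Local Notation K := (fixedK s t).
Local Notation theta := (@theta F s t a 1 aT).

Variables (hT : finGroupType) (x : hT -> F) (q : hT -> grading a 1 aT).
Hypothesis X : crossed_basis s t n z x q.
Hypothesis hT2 : (2.-group [set: hT])%g.

Let z0 : z != 0 := z_neq0 C.
Let x0 : forall h, x h != 0 := cb_neq0 X.

Lemma half_turn : z ^+ n.+1 = -1.
Proof.
have : (z ^+ n.+1) ^+ 2 == 1 by rewrite nE -exprM -expnSr (prim_expr_order zP).
rewrite sqrf_eq1 => /orP[|/eqP//]; rewrite -(prim_order_dvd zP) nE => /dvdn_leq.
by rewrite expn_gt0 => /(_ erefl); rewrite leq_exp2l // ltnn.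
Qed.

Lemma neg1_neq1 : -1 != 1 :> F.
Proof.
rewrite -half_turn -(prim_order_dvd zP) nE; apply/negP => /dvdn_leq.
by rewrite expn_gt0 => /(_ erefl); rewrite leq_exp2l // ltnn.
Qed.

Lemma two_neq0 : 2 != 0 :> F.
Proof. by apply: contraNneq neg1_neq1 => E; rewrite -subr_eq0 -opprD -[1 + 1]/(2%:R) E oppr0. Qed.

Lemma sz k : s (z ^+ k) = z ^+ (3 * k).
Proof. by rewrite rmorphXn /= (cd_s C) -exprM. Qed.

Lemma tz k : t (z ^+ k) = z ^- k.
Proof.
apply: (mulIf (expf_neq0 k z0)); rewrite mulVf ?expf_neq0 //.
rewrite rmorphXn /= (cd_t C) -exprM -exprD -{2}[k]mul1n -mulnDl addn1 vE.
by rewrite exprM (prim_expr_order zP) expr1n.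
Qed.

Definition eighth := z ^+ (2 ^ m.-1).
(** A square root of [-2]: [s] exchanges [eighth] and its cube, and [t] negates the sum. *)
Definition rho := eighth + eighth ^+ 3.

Lemma eighth4 : eighth ^+ 4 = -1.
Proof.
rewrite -half_turn nE -exprM; congr (z ^+ _).
by rewrite (_ : 4 = 2 ^ 2)%N // -expnD; congr (_ ^ _)%N; lia.
Qed.

Lemma s_rho : s rho = rho.
Proof.
have E : eighth ^+ 9 = eighth by rewrite (exprD _ 8 1) (exprM _ 4 2) eighth4 sqrrN expr1n mul1r.
rewrite rmorphD -exprM /eighth !sz.
by rewrite [(3 * 2 ^ _)%N]mulnC exprM -/eighth addrC; congr (_ + _);
  rewrite -[RHS]E -exprM; congr (z ^+ _); lia.
Qed.

Lemma t_rho : t rho = - rho.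
Proof.
have e0 : eighth != 0 by rewrite expf_neq0.
have E : eighth^-1 = - eighth ^+ 3.
  by apply: (mulfI e0); rewrite mulfV // mulrN -exprS eighth4 opprK.
have E3 : (- eighth ^+ 3) ^+ 3 = - ((eighth ^+ 4) ^+ 2 * eighth) by ring.
rewrite rmorphD rmorphXn /= {1 2}/eighth tz -/eighth E E3 eighth4 /rho; ring.
Qed.

Lemma rho_sqr : rho ^+ 2 = - 2.
Proof.
have -> : rho ^+ 2 = eighth ^+ 2 + 2 * eighth ^+ 4 + eighth ^+ 4 * eighth ^+ 2.
  by rewrite /rho; ring.
rewrite eighth4; ring.
Qed.

Lemma rho_neq0 : rho != 0.
Proof.
by apply/eqP => r0; have := rho_sqr; rewrite r0 expr0n /= => /eqP;
  rewrite eq_sym oppr_eq0 (negPf two_neq0).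
Qed.

Lemma rho2K : rho ^+ 2 \in K.
Proof. by apply: fixedP; rewrite rmorphXn /= ?s_rho ?t_rho ?sqrrN. Qed.

Lemma neg1K : -1 \in K. Proof. by apply: fixedP; rewrite rmorphN1. Qed.

(** Only [k] modulo [n.+1] and the parity of [e] matter, since [z ^+ n.+1] and [rho ^+ 2] lie in
    [K]. *)
Definition lab h k e := x h / (z ^+ k * rho ^+ e) \in K.

Lemma rho_mod e e' : odd e = odd e' -> rho ^+ e / rho ^+ e' \in K.
Proof.
have E f : rho ^+ f / rho ^+ (odd f) \in K.
  rewrite -{1}(odd_double_half f) addnC exprD mulfK ?expf_neq0 ?rho_neq0 //.
  by rewrite -mul2n exprM; apply: fixedX rho2K.
move=> ee'; apply: (fixed_trans _ (E e)); first by rewrite expf_neq0 ?rho_neq0.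
by rewrite ee'; apply: fixed_sym; apply: E.
Qed.

Lemma z_mod k k' : k = k' %[mod n.+1] -> z ^+ k / z ^+ k' \in K.
Proof.
move=> kk'; apply: (fixed_trans _ (fixed_zmod C k)); first by rewrite expf_neq0.
by rewrite kk'; apply: fixed_sym; apply: fixed_zmod C _.
Qed.

Lemma mon_neq0 k e : z ^+ k * rho ^+ e != 0.
Proof. by rewrite mulf_neq0 ?expf_neq0 ?rho_neq0. Qed.

Lemma lab_mod h k e k' e' : k = k' %[mod n.+1] -> odd e = odd e' ->
  lab h k e -> lab h k' e'.
Proof.
move=> kk' ee' hl; apply: (fixed_trans (mon_neq0 k e) hl).
by apply: fixed_mul2; [apply: z_mod | apply: rho_mod].
Qed.

Lemma lab_mul h h' k e k' e' : (q h).1 = 1%g -> lab h k e -> lab h' k' e' ->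
  lab (h * h')%g (k + k') (e + e').
Proof.
move=> qh hl h'l; have := basis_mulK X (mon_neq0 k e) (mon_neq0 k' e') hl h'l.
by rewrite theta1 // /lab !exprD mulrACA.
Qed.

Lemma lab_exp h k e i : (q h).1 = 1%g -> lab h k e -> lab (h ^+ i)%g (k * i) (e * i).
Proof.
move=> qh hl; have := basis_expK1 X i (mon_neq0 k e) qh hl.
by rewrite /lab exprMn -!exprM.
Qed.

Lemma lab_eq1 h k e : q h = 1%g -> lab h k e -> (n.+1 %| k)%N -> ~~ odd e -> h = 1%g.
Proof.
move=> qh hl dk oe; apply: (basis_eq1 X qh).
have : lab h 0 0 by apply: lab_mod hl; rewrite ?mod0n ?(eqP dk) ?(negPf oe).
by rewrite /lab !expr0 mulr1 divr1.
Qed.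

Lemma fixed_root y k : y = z ^+ k -> s y = y -> y = 1 \/ y = -1.
Proof.
move=> -> /eqP; rewrite sz (eq_prim_root_expr zP) -{2}[k]mul1n.
have -> : (3 * k = 2 * k + 1 * k)%N by lia.
rewrite -[X in _ == X %[mod _]]add0n eqn_modDr mod0n => dk.
have : (z ^+ k) ^+ 2 == 1 by rewrite -exprM mulnC -(prim_order_dvd zP).
by rewrite sqrf_eq1 => /orP[]/eqP ->; [left | right].
Qed.

Lemma pow3 : exists2 w, ~~ (2 %| w)%N & (3 ^ a.+1 = 1 + 2 ^ m.+2 * w)%N.
Proof. by rewrite aE; apply: expn3_pow2. Qed.

Lemma sum3 : exists2 w, ~~ (2 %| w)%N & (\sum_(j < a.+1) 3 ^ j = 2 ^ m.+1 * w)%N.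
Proof.
have [w ow def_w] := pow3; exists w => //.
have := predn_exp 3 a.+1; rewrite def_w /= expnS -mulnA => /eqP.
by rewrite eqn_pmul2l // => /eqP <-.
Qed.

Lemma torsion3 h : (q h).1 = 1%g -> exists k e, lab h k e.
Proof.
move=> qh; have hK := basis_torsion X qh.
have [e cardH] := p_natP hT2; rewrite cardsT in cardH; rewrite cardH in hK.
have [w ow def_w] := pow3; have Lx := cb_span X h.
have isP : prime 2 by [].
have [c sx] := torsion_character isP zP def_w ow sR (x0 h) (fixed_s hK) (span_sa C Lx).
have [w' ow' ->] := sum3.
rewrite mulnCA expnSr dvdn_pmul2l ?expn_gt0 // Euclid_dvdM // (negPf ow') orbF.
(* As [c] is even, [z ^+ i] has the same character under [s] as [x h], so [y] is fixed by [s]. *)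
case/dvdnP=> i def_c; pose y := x h / z ^+ i.
have y0 : y != 0 by rewrite mulf_neq0 ?invr_eq0 ?expf_neq0.
have sy : s y = y.
  rewrite fmorph_div /= sx sz def_c (_ : (3 * i = i + i * 2)%N); last by lia.
  by rewrite exprD [z ^+ i * _]mulrC -mulf_div mulfV ?expf_neq0 ?mul1r.
(* A root of unity fixed by [s], hence [1] or [-1]; the value [-1] is the character of [rho]. *)
pose b := t y / y.
have yK : y ^+ (2 ^ (e + m.+1)) \in K.
  rewrite expr_div_n; apply: fixedM.
    by rewrite expnD exprM; apply: fixedX.
  apply: fixedV; rewrite -exprM mulnC exprM expnD mulnC exprM -nE.
  by do 2?apply: fixedX; apply: cd_fixed C.
have be : b ^+ (2 ^ (e + m.+1)) = 1.
  by rewrite expr_div_n -rmorphXn /= (fixed_t yK) mulfV // expf_neq0.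
have sb : s b = b.
  rewrite fmorph_div /= sy; congr (_ / _); rewrite -[in RHS]sy.
  by rewrite /y !fmorph_div /= (span_st C Lx) tz fmorphV /= !sz tz.
have bM := root_of_unity_bound isP def_w ow sR be (iterm_fixed _ sb).
have [j def_b] := prim_rootP zP bM.
case: (fixed_root def_b sb) => b1.
  exists i, 0; rewrite /lab expr0 mulr1; apply: fixedP => //.
  by rewrite -[LHS](mulfVK y0) -/b b1 mul1r.
exists i, 1; rewrite /lab expr1 invfM mulrA -/y.
apply: fixedP; rewrite fmorph_div /= ?sy ?s_rho //.
by rewrite t_rho -[t y](mulfVK y0) -/b b1 mulN1r invrN mulrNN.
Qed.

Lemma quarter_sqr : z ^+ (2 ^ m) ^+ 2 = -1.
Proof. by rewrite -exprM -expnSr -nE half_turn. Qed.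

Lemma quarter_notK : z ^+ (2 ^ m) \notin K.
Proof.
apply/negP => /fixed_t; rewrite tz => /(congr1 (fun y => y * z ^+ (2 ^ m))).
rewrite mulVf ?expf_neq0 // -expr2 quarter_sqr => /esym/eqP.
by rewrite (negPf neg1_neq1).
Qed.

Lemma one_add_quarter_neq0 : 1 + z ^+ (2 ^ m) != 0.
Proof.
apply: contra quarter_notK; rewrite addrC addr_eq0 => /eqP ->.
exact: neg1K.
Qed.

(** The constant coefficient would be the nonzero [c], against the trace condition; and for [h = 1]
    the value would have to lie in [K]. *)
Lemma no_one_add_quarter h : q h = 1%g -> x h / (1 + z ^+ (2 ^ m)) \in K -> False.
Proof.
set c := _ / _ => qh cK.
have xE : x h = c * (1 + z ^+ (2 ^ m)) by rewrite mulfVK ?one_add_quarter_neq0.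
have c0 : c != 0 by rewrite mulf_neq0 ?invr_eq0 ?one_add_quarter_neq0.
have [h1|h1] := eqVneq h 1%g.
  case/negP: quarter_notK; have : 1 + z ^+ (2 ^ m) \in K.
    have := basis1 X; rewrite -h1 xE mulrC fixedMr //.
  move=> qK; apply: fixedP.
    by have := fixed_s qK; rewrite rmorphD rmorph1 => /addrI.
  by have := fixed_t qK; rewrite rmorphD rmorph1 => /addrI.
case/eqP: c0; have ltmn : (2 ^ m < n.+1)%N by rewrite nE ltn_exp2l.
pose k : 'I_n.+1 := Ordinal ltmn.
have k0 : k != ord0 by rewrite -val_eqE /= -lt0n expn_gt0.
have := cb_trace X (c := fun i => if (i == ord0) || (i == k) then c else 0) qh h1.
rewrite eqxx; apply=> [i|].
  by case: ifP => // _; apply: fixedP; rewrite rmorph0.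
rewrite (bigD1 ord0) //= (bigD1 k) //= !eqxx orbT big1 ?addr0 => [|i /andP[/negPf-> /negPf->]].
  by rewrite expr0 -mulrDr xE.
by rewrite mul0r.
Qed.

(** Dividing [eighth + eighth ^+ 3] by [eighth] gives [1 + eighth ^+ 2]; up to sign,
    [z ^+ (n.+1 - 2 ^ m.-1)] is the inverse of [eighth]. *)
Lemma no_lab_quarter h : q h = 1%g -> lab h (n.+1 - 2 ^ m.-1) 1 -> False.
Proof.
move=> qh hl; apply: (no_one_add_quarter qh).
have lek : (2 ^ m.-1 <= n.+1)%N by rewrite nE leq_exp2l //; lia.
have e1 : z ^+ (n.+1 - 2 ^ m.-1) * eighth = -1.
  by rewrite -exprD subnK // half_turn.
have e2 : eighth ^+ 2 = z ^+ (2 ^ m).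
  by rewrite -exprM -expnSr prednK //; lia.
have E : z ^+ (n.+1 - 2 ^ m.-1) * rho ^+ 1 = (-1) * (1 + z ^+ (2 ^ m)).
  by rewrite -e2 -e1 expr1 /rho; ring.
move: hl; rewrite /lab E invfM mulrCA => /(fixedM neg1K).
by rewrite invrN invr1 !mulN1r opprK.
Qed.

(** If only even [k] occurred, there would be just [n.+1] possible labels, so all would occur,
    including the forbidden one of [no_lab_quarter]. Its exponent is even because [m > 1]; for
    [m = 1] it would be odd. *)
Lemma odd_label : exists h k e, [/\ q h = 1%g, lab h k e & odd k].
Proof.
apply: NNPP => no_odd.
have m0 : (0 < 2 ^ m)%N by rewrite expn_gt0.
pose P h (i : 'I_(2 ^ m) * bool) := lab h (2 * i.1) i.2.
have cardT : #|{: 'I_(2 ^ m) * bool}| = n.+1.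
  by rewrite card_prod card_ord card_bool nE expnSr.
have [||_ lab_surj] := @ker_label _ _ _ _ _ _ _ _ _ _ _ X _ P cardT.
- move=> h qh; have [|k [e hl]] := @torsion3 h; first by rewrite qh.
  have ek : ~~ odd k by apply/negP => ok; apply: no_odd; exists h, k, e.
  exists (Ordinal (ltn_pmod k./2 m0), odd e); apply: lab_mod hl => /=.
    rewrite muln_modr -expnS -nE modn_mod mul2n.
    by rewrite -{1}(odd_double_half k) (negPf ek).
  by rewrite oddb.
- move=> h h' i qh qh' hi h'i; apply: (basis_inj X); first by rewrite qh qh'.
  by apply: (fixed_trans (mon_neq0 (2 * i.1) i.2) hi); apply: fixed_sym.
(* Twice this exponent is [n.+1 - 2 ^ m.-1]. *)
have lt1 : (2 ^ m - 2 ^ m.-2 < 2 ^ m)%N by rewrite ltn_subrL expn_gt0 m0.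
have [h [qh hl]] := lab_surj (Ordinal lt1, true).
apply: (no_lab_quarter qh); apply: lab_mod hl => //=.
congr (_ %% _)%N; rewrite nE mulnBr -!expnS; congr (_ - 2 ^ _)%N; lia.
Qed.

Lemma generator_label : exists hp e, q hp = 1%g /\ lab hp 1 e.
Proof.
have [h [k [e [qh hl ok]]]] := odd_label.
have k0 : (0 < k)%N by case: (k) ok.
have [i j def_g _] := egcdnP n.+1 k0.
have co : gcdn k n.+1 = 1%N by apply/eqP; rewrite nE -/(coprime _ _) coprimeXr // coprimen2.
exists (h ^+ i)%g, (e * i); split; first by rewrite (degX X) qh expg1n.
apply: lab_mod (lab_exp i _ hl) => //; last by rewrite qh.
by rewrite mulnC def_g co modnMDl.
Qed.

Lemma even_half_turn e : ~~ odd (e * (2 ^ m)).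
Proof. by rewrite oddM oddX orbF; case: (m) m2 => // m' _; rewrite andbF. Qed.

(** An even power of the generator moves the label [(0, 1)] to the forbidden one and keeps the
    parity of the exponent of [rho]. *)
Lemma no_lab_rho h : q h = 1%g -> lab h 0 1 -> False.
Proof.
move=> qh hl; have [hp [e [qp pl]]] := generator_label.
have hq1 : (q h).1 = 1%g by rewrite qh.
have hpq1 : (q hp).1 = 1%g by rewrite qp.
apply: (@no_lab_quarter (h * hp ^+ (n.+1 - 2 ^ m.-1))%g).
  by rewrite (cb_deg X) (degX X) qh qp expg1n mulg1.
apply: lab_mod (lab_mul hq1 hl (lab_exp (n.+1 - 2 ^ m.-1) hpq1 pl)).
  by rewrite mul1n.
have ok : ~~ odd (n.+1 - 2 ^ m.-1).
  rewrite nE oddB ?leq_exp2l //; last by lia.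
  by rewrite !oddX; case: (m) m2 => [|[|]].
by rewrite oddD oddM (negPf ok) andbF.
Qed.

(** With different parities, [h * h' ^+ n] would have the label [(0, 1)], because [n] is odd and is
    [-1] modulo [n.+1]. *)
Lemma lab_uniq h h' k e e' : q h = 1%g -> q h' = 1%g -> lab h k e -> lab h' k e' -> h = h'.
Proof.
move=> qh qh' hl hl'.
have hq1 : (q h).1 = 1%g by rewrite qh.
have hq1' : (q h').1 = 1%g by rewrite qh'.
have [ee'|ee'] := eqVneq (odd e) (odd e').
  apply: (basis_inj X); first by rewrite qh qh'.
  apply: (fixed_trans (mon_neq0 k e) hl); apply: fixed_sym.
  exact: lab_mod hl'.
case: (@no_lab_rho (h * h' ^+ n)%g).
  by rewrite (cb_deg X) (degX X) qh qh' expg1n mulg1.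
apply: lab_mod (lab_mul hq1 hl (lab_exp n hq1' hl')).
  by rewrite -mulnS modnMl mod0n.
have on : odd n by rewrite -[odd n]negbK -oddS nE oddX.
by rewrite oddD oddM on andbT; case: (odd e) (odd e') ee' => [] [].
Qed.

Lemma deg_surj3 p : exists h, q h = p.
Proof.
have [||] := @ker_label _ _ _ _ _ _ _ _ _ _ _ X _ (fun h (i : 'I_n.+1) => exists e, lab h i e)
  (card_ord _); last by move=> + _; apply.
- move=> h qh; have [|k [e hl]] := @torsion3 h; first by rewrite qh.
  exists (inord (k %% n.+1)), e; apply: lab_mod hl => //.
  by rewrite inordK ?ltn_pmod // modn_mod.
by move=> h h' i qh qh' [e hl] [e' hl']; apply: lab_uniq hl hl'.
Qed.

Lemma s_fixed_dvd k : s (z ^+ k) = z ^+ k -> (n.+1 %| k)%N.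
Proof.
move=> sk; have : (z ^+ k) ^+ 2 == 1.
  by case: (fixed_root erefl sk) => ->; rewrite ?sqrrN expr1n.
rewrite -exprM -(prim_order_dvd zP) [(2 ^ m.+2)%N]expnSr dvdn_pmul2r //.
by rewrite -nE.
Qed.

Lemma lab_norm h y k e : x h / y \in K -> y != 0 -> lab h k e ->
  exists2 c, c \in K & y = c * (z ^+ k * rho ^+ e).
Proof.
move=> hy y0 hl; exists (y / (z ^+ k * rho ^+ e)); last by rewrite mulfVK ?mon_neq0.
by apply: fixed_trans (fixed_sym hy) hl.
Qed.

Definition snorm y := \prod_(j < a.+1) iterm s j y.

(** A power of [z] fixed by [s] is a sign, so the norm has label [(0, 0)] or the excluded [(0, 1)].
    The membership in [K] is kept for the commutator computation. *)
Lemma norm_s h : q h = (inord 1, 1, 1)%g -> (h ^+ a.+1)%g = 1%g /\ snorm (x h) \in K.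
Proof.
move=> qh; set g := (h ^+ a.+1)%g; set y := snorm (x h).
have a0 : (0 < a)%N.
  by rewrite -ltnS aE -{1}(expn0 2) ltn_exp2l //; lia.
have qg : q g = 1%g.
  by rewrite (degX X) qh grading_expg /= ord_expg_card !expg1n.
have gy : x g / y \in K.
  apply: (basis_exp_norm X) => w.
  by rewrite qh /theta /= inordK // /iterm.
have y0 : y != 0 by apply/prodf_neq0 => j _; rewrite fmorph_eq0.
have sy : s y = y := iterm_prod_fixed (span_sa C (cb_span X h)).
have [|k [e gl]] := @torsion3 g; first by rewrite qg.
have [c cK def_y] := lab_norm gy y0 gl.
have c0 : c != 0 by apply: contraNneq y0 => c0; rewrite def_y c0 mul0r.
have dk : (n.+1 %| k)%N.
  apply: s_fixed_dvd; move: sy; rewrite def_y !rmorphM /= (fixed_s cK).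
  rewrite [s (rho ^+ e)]rmorphXn /= s_rho => /(mulfI c0).
  by move/(mulIf (expf_neq0 _ rho_neq0)).
have [oe|oe] := boolP (odd e).
  case: (@no_lab_rho g qg); apply: lab_mod gl; last by rewrite oe.
  by rewrite (eqP dk) mod0n.
have g1 := lab_eq1 qg gl dk oe; split=> //.
move: gy; rewrite g1 => /fixed_sym; rewrite fixedMr ?fixedV ?invr_eq0 //.
exact: basis1 X.
Qed.

Lemma norm_t h : q h = (1, inord 1, 1)%g -> (h ^+ 2)%g = 1%g.
Proof.
move=> qh; set g := (h ^+ 2)%g; pose y := \prod_(j < 2) iterm t j (x h).
have qg : q g = 1%g.
  by rewrite (degX X) qh grading_expg /= ord_expg_card !expg1n.
have gy : x g / y \in K.
  apply: (basis_exp_norm X) => w.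
  by rewrite qh /theta /= inordK // /iterm.
have y0 : y != 0 by apply/prodf_neq0 => j _; rewrite fmorph_eq0.
have ty : t y = y := iterm_prod_fixed (span_tb C (cb_span X h)).
have [|k [e gl]] := @torsion3 g; first by rewrite qg.
have [c cK def_y] := lab_norm gy y0 gl.
have c0 : c != 0 by apply: contraNneq y0 => c0; rewrite def_y c0 mul0r.
have tk : (-1) ^+ e = (z ^+ k) ^+ 2.
  have zk0 := expf_neq0 k z0.
  move: ty; rewrite def_y !rmorphM /= (fixed_t cK) tz.
  rewrite [t (rho ^+ e)]rmorphXn /= t_rho [(- rho) ^+ e]exprNn => /(mulfI c0).
  rewrite mulrA => /(mulIf (expf_neq0 _ rho_neq0)) /(congr1 (fun w => z ^+ k * w)).
  by rewrite mulVKf // -expr2.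
have [oe|oe] := boolP (odd e); last first.
  apply: (lab_eq1 qg gl _ oe); move: tk; rewrite -signr_odd (negPf oe) expr0 => /esym/eqP.
  by rewrite -exprM -(prim_order_dvd zP) [(2 ^ m.+2)%N]expnSr dvdn_pmul2r // -nE.
have [hp [e' [qp pl]]] := generator_label.
have gq1 : (q g).1 = 1%g by rewrite qg.
have pq1 : (q hp).1 = 1%g by rewrite qp.
(* For odd [e] the square of [z ^+ k] is [-1], so [k] is [2 ^ m] modulo [n.+1] and [hp ^+ (2 ^ m)]
   cancels it. *)
case: (@no_lab_rho (g * hp ^+ (2 ^ m))%g).
  by rewrite (cb_deg X) (degX X) qg qp expg1n mulg1.
apply: lab_mod (lab_mul gq1 gl (lab_exp (2 ^ m) pq1 pl)).
  have k2 : 2 ^ m = k %[mod 2 ^ m.+1].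
    move: tk; rewrite -signr_odd oe expr1 -half_turn -exprM => /eqP.
    rewrite (eq_prim_root_expr zP) nE [in X in X == _ %[mod _]]expnSr.
    by rewrite [(2 ^ m.+2)%N]expnSr -!muln_modl eqn_pmul2r // => /eqP.
  rewrite nE mul1n -modnDml -k2 modnDml.
  by rewrite addnn -mul2n -expnS modnn mod0n.
by rewrite oddD oe (negPf (even_half_turn _)).
Qed.

Lemma snormM y y' : snorm (y * y') = snorm y * snorm y'.
Proof. by rewrite /snorm -big_split; apply: eq_bigr => j _; rewrite rmorphM. Qed.

Lemma snorm_fixed y : s y = y -> snorm y = y ^+ a.+1.
Proof.
move=> sy; rewrite /snorm (eq_bigr (fun=> y)) ?prodr_const ?card_ord // => j _.
exact: iterm_fixed.
Qed.

Lemma snorm_z : snorm z = -1.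
Proof.
have [w ow sum_w] := sum3.
rewrite /snorm (eq_bigr (fun j : 'I_a.+1 => z ^+ (3 ^ j))) => [|j _].
  rewrite -expr_sum sum_w -nE exprM half_turn -signr_odd.
  by rewrite dvdn2 negbK in ow; rewrite ow.
by rewrite -{1}[z]expr1 (iterm_sz C) muln1.
Qed.

(* Taking norms down to the fixed field of [s] shows that the commutator is a square. *)
Lemma commutator_even hp e hs ht j : q hp = 1%g -> lab hp 1 e ->
    q hs = (inord 1, 1, 1)%g -> q ht = (1, inord 1, 1)%g ->
    (hp ^+ j * (hs * ht) = ht * hs)%g -> ~~ odd j.
Proof.
move=> qp pl qs qt comm.
have [_ NsK] := norm_s qs; have Lt := cb_span X ht; have Ls := cb_span X hs.
have xx h : x h / x h \in K by rewrite mulfV // fixed1.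
have a0 : (0 < a)%N by rewrite -ltnS aE -{1}(expn0 2) ltn_exp2l //; lia.
have th_s y : theta (q hs) y = s y by rewrite qs /theta /= inordK // /iterm.
have th_t y : theta (q ht) y = t y by rewrite qt /theta /= inordK // /iterm.
have pq1 : (q hp).1 = 1%g by rewrite qp.
have pj := lab_exp j pq1 pl.
have st := basis_mulK X (x0 hs) (x0 ht) (xx hs) (xx ht); rewrite th_s in st.
have ts := basis_mulK X (x0 ht) (x0 hs) (xx ht) (xx hs); rewrite th_t in ts.
have xst : x hs * s (x ht) != 0 by rewrite mulf_neq0 ?fmorph_eq0.
have := basis_mulK X (mon_neq0 (1 * j) (e * j)) xst pj st.
rewrite theta1 ?(degX X) ?qp ?expg1n // comm mul1n => pst.
have tsx0 : x ht * t (x hs) != 0 by rewrite mulf_neq0 ?fmorph_eq0.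
have [c cK def_c] : exists2 c, c \in K &
    z ^+ j * rho ^+ (e * j) * (x hs * s (x ht)) = c * (x ht * t (x hs)).
  by eexists; [exact: fixed_trans (x0 _) (fixed_sym pst) ts | rewrite mulfVK].
have Nst : snorm (s (x ht)) = snorm (x ht).
  transitivity (s (snorm (x ht))); last exact: iterm_prod_fixed (span_sa C Lt).
  by rewrite /snorm rmorph_prod; apply: eq_bigr => i _; rewrite /iterm -iterSr.
have Nts : snorm (t (x hs)) = snorm (x hs).
  rewrite -[RHS](fixed_t NsK) /snorm rmorph_prod; apply: eq_bigr => i _.
  have := @span_sum_eq _ s t n z (iterm s i \o t) (t \o iterm s i) (x hs).
  apply=> // [y yK|y yK|] /=.
  - by rewrite (fixed_t yK) iterm_fixed ?(fixed_s yK).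
  - by rewrite iterm_fixed ?(fixed_s yK) ?(fixed_t yK).
  by rewrite -{2}[z]expr1 (iterm_sz C) (cd_t C) (iterm_sz C)
    rmorphXn /= (cd_t C) -!exprM muln1 mulnC.
have nz (y : F) : y != 0 -> snorm y != 0.
  by move=> y0; apply/prodf_neq0 => i _; rewrite fmorph_eq0.
have := congr1 snorm def_c; rewrite !snormM Nst Nts [snorm (x ht) * _]mulrC.
move=> /(mulIf (mulf_neq0 (nz _ (x0 hs)) (nz _ (x0 ht)))).
have -> : snorm (z ^+ j) = (-1) ^+ j.
  by rewrite -snorm_z /snorm -prodrXl; apply: eq_bigr => i _; rewrite rmorphXn.
have srj : s (rho ^+ (e * j)) = rho ^+ (e * j) by rewrite rmorphXn /= s_rho.
rewrite (snorm_fixed srj) (snorm_fixed (fixed_s cK)) => eq_c.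
apply/negP => oj; rewrite -signr_odd oj expr1 in eq_c.
(* [U] is a root of unity fixed by [s], hence a sign, and yet its power [2 ^ m] is [-1]. *)
pose U := c / rho ^+ (e * j).
have r0 : rho ^+ (e * j) != 0 by rewrite expf_neq0 ?rho_neq0.
have Um : U ^+ (2 ^ m) = -1.
  by rewrite -aE expr_div_n -eq_c mulfK // expf_neq0.
have sU : s U = U by rewrite fmorph_div /= srj (fixed_s cK).
have Um2 : U ^+ (2 ^ m.+2) = 1.
  by rewrite expnSr exprM expnSr exprM Um sqrrN !expr1n.
have [k def_U] := prim_rootP zP Um2.
have e2m : U ^+ (2 ^ m) = 1.
  have := even_half_turn 1; rewrite mul1n => em.
  by case: (fixed_root def_U sU) => ->; rewrite ?expr1n // -signr_odd (negPf em).
by case/eqP: neg1_neq1; rewrite -Um e2m.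
Qed.

Lemma conj_lab hp hp' h e k' e' : q hp = 1%g -> q hp' = 1%g -> lab hp 1 e -> lab hp' k' e' ->
    theta (q h) (z ^+ 1 * rho ^+ e) / (z ^+ k' * rho ^+ e') \in K ->
  (h * hp * h^-1)%g = hp'.
Proof.
move=> qp qp' pl pl' thK; apply: (canLR (mulgK _)); apply: (basis_inj X).
  by rewrite !(cb_deg X) qp qp' mulg1 mul1g.
have xx : x h / x h \in K by rewrite mulfV // fixed1.
have H1 := basis_mulK X (x0 h) (mon_neq0 1 e) xx pl.
have H2 := basis_mulK X (mon_neq0 k' e') (x0 h) pl' xx.
rewrite qp' theta1 // mulrC [_ * x h]mulrC in H2.
have {}H2 : x (hp' * h)%g / (x h * (z ^+ k' * rho ^+ e')) \in K by rewrite mulrC.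
apply: (fixed_trans _ H1); first by rewrite mulf_neq0 ?fmorph_eq0 ?mon_neq0.
apply: (fixed_trans _ _ (fixed_sym H2)); first by rewrite mulf_neq0 ?mon_neq0.
exact: fixed_mul2.
Qed.

Lemma lab_rhoK h e : lab h 0 e -> x h \in rhoK s t rho.
Proof.
move=> hl; apply/orP; have [oe|oe] := boolP (odd e); [right|left].
  have : lab h 0 1 by apply: lab_mod hl; rewrite ?oe.
  by rewrite /lab expr0 mul1r expr1.
have : lab h 0 0 by apply: lab_mod hl; rewrite ?(negPf oe).
by rewrite /lab !expr0 mulr1 divr1.
Qed.

Lemma type3_isog (gT : finGroupType) (K1 K2 : {group gT}) :
    (K1 \x K2 = [set: gT])%g -> (K2 \isog [set: aT * aT])%g ->
    is_G1_type3 K1 m ->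
  ([set: hT] \isog [set: gT])%g.
Proof.
move=> defG isoK2 isoK1.
have [hp [e [qp pl]]] := generator_label.
have [hs0 qs0] := deg_surj3 (inord 1, 1, 1)%g.
have [ht qt] := deg_surj3 (1, inord 1, 1)%g.
have pq1 : (q hp).1 = 1%g by rewrite qp.
have qpj j : q (hp ^+ j)%g = 1%g by rewrite (degX X) qp expg1n.
have on : odd n by rewrite -[odd n]negbK -oddS nE oddX.
have pn : (hp ^+ n.+1)%g = 1%g.
  apply: (lab_eq1 (qpj _) (lab_exp n.+1 pq1 pl)); first by rewrite mul1n.
  by rewrite oddM /= on andbF.
have cqt : (q ht * q hs0 = q hs0 * q ht)%g.
  by apply: (centsP (abelian_grading a 1 (cd_abelian C))); rewrite inE.
have [k even_k comm] : exists2 k, ~~ odd k & (hp ^+ k * (hs0 * ht) = ht * hs0)%g.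
  pose g := (ht * hs0 * (hs0 * ht)^-1)%g.
  have qg : q g = 1%g by rewrite (cb_deg X) (degV X) !(cb_deg X) cqt mulgV.
  have [|k [f gl]] := @torsion3 g; first by rewrite qg.
  have pk := lab_exp k pq1 pl; rewrite mul1n in pk.
  have comm : (hp ^+ k * (hs0 * ht) = ht * hs0)%g.
    by rewrite (lab_uniq (qpj k) qg pk gl) mulgKV.
  by exists k => //; apply: commutator_even qp pl qs0 qt comm.
(* Since [ht] inverts [hp], half of the commutator exponent corrects [hs0] to an element commuting
   with [ht]; its order again comes from [norm_s]. *)
pose hs := (hp ^+ k./2 * hs0)%g.
have qs : q hs = (inord 1, 1, 1)%g by rewrite (cb_deg X) qpj mul1g.
have [hsn _] := norm_s qs.
have a0 : (0 < a)%N by rewrite -ltnS aE -{1}(expn0 2) ltn_exp2l //; lia.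
have conj_s : (hs * hp * hs^-1 = hp ^+ 3)%g.
  apply: (conj_lab qp (qpj 3) pl (lab_exp 3 pq1 pl)).
  rewrite rmorphM qs /= {1}/theta /= inordK // -[iterm t _ _]/(z ^+ 1) -[iterm s _ _]/(s (z ^+ 1)).
  rewrite sz mulnC [theta _ (rho ^+ e)]rmorphXn /= /theta /= inordK //.
  rewrite -[iterm t _ _]/rho -[iterm s _ _]/(s rho) s_rho.
  apply: fixed_mul2; first by rewrite mulfV ?fixed1 ?expf_neq0.
  by apply: rho_mod; rewrite oddM andbT.
have conj_t : (ht * hp * ht^-1 = hp^-1)%g.
  have -> : (hp^-1 = hp ^+ n)%g by apply: (mulgI hp); rewrite mulgV -expgS pn.
  apply: (conj_lab qp (qpj n) pl (lab_exp n pq1 pl)).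
  rewrite rmorphM qt /= {1}/theta /= inordK //.
  rewrite -[iterm s _ _]/(iterm t 1 (z ^+ 1)) -[iterm t _ _]/(t (z ^+ 1)).
  rewrite tz [theta _ (rho ^+ e)]rmorphXn /= /theta /= inordK // -[iterm s _ _]/(t rho) t_rho.
  apply: fixed_mul2.
    by rewrite -invfM -exprD mul1n add1n half_turn; apply: fixedV neg1K.
  rewrite exprNn -mulrA; apply: fixedM; first by apply: fixedX neg1K.
  by apply: rho_mod; rewrite oddM on andbT.
have R4 : (hs * ht = ht * hs)%g.
  have ct i : (ht * hp ^+ i = hp ^- i * ht)%g.
    apply: (canRL (mulgKV _)); have := conjXg hp ht^-1%g i.
    by rewrite !conjgE invgK !mulgA conj_t expgVn.
  rewrite /hs [RHS]mulgA ct -[RHS]mulgA -comm !mulgA; congr (_ * _ * _)%g.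
  by rewrite -{3}(odd_double_half k) (negPf even_k) add0n -addnn expgD mulKg.
have := @crossed_isog _ _ _ _ _ _ _ _ _ _ _ _ C _ _ _ X rho rho_neq0 s_rho _ rho2K _
  hp hs ht qp qs qt _ _ _ _ defG isoK2.
apply.
- by rewrite t_rho mulNr mulfV ?rho_neq0 // neg1K.
- move=> h qh hr; case: (@no_lab_rho h qh).
  by rewrite /lab expr0 mul1r expr1.
- move=> h qh; have [k' [f hl]] := torsion3 qh; exists (k' * n)%N.
  have := lab_mul _ (lab_exp (k' * n) pq1 pl) hl; rewrite qpj => /(_ erefl) hl'.
  apply: lab_rhoK; apply: lab_mod hl' => //.
  by rewrite mul1n addnC -mulnS modnMl mod0n.
- by apply: (type3_homg isoK1 _ _ (norm_t qt) R4 conj_s conj_t); rewrite -?nE -?aE.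
by rewrite aE nE; apply: type3_card.
Qed.

End Type3.

(** * Model groups and the base field *)

Section FixedField.

Variables (F : fieldType) (s t : {rmorphism F -> F}).

Fact fixed_divring_closed : divring_closed (fixedK s t).
Proof.
split=> [|x y xK yK|x y xK yK]; first exact: fixed1.
  by apply: fixedP; rewrite rmorphB /= ?(fixed_s xK) ?(fixed_s yK) ?(fixed_t xK) ?(fixed_t yK).
by apply: fixedM => //; apply: fixedV.
Qed.
HB.instance Definition _ := GRing.isDivringClosed.Build F (fixedK s t) fixed_divring_closed.

Record fixed_field := FixedField { fixed_val : F; fixed_valP : fixed_val \in fixedK s t }.
HB.instance Definition _ := [isSub for fixed_val].
HB.instance Definition _ := [Choice of fixed_field by <:].
HB.instance Definition _ := [SubChoice_isSubIntegralDomain of fixed_field by <:].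
HB.instance Definition _ := [SubIntegralDomain_isSubField of fixed_field by <:].

Definition fixed_iota : {rmorphism fixed_field -> F} := \val.

End FixedField.

Section ModelGroup.

Variables (n a b : nat) (aT : finGroupType) (u v : nat).
Local Notation qT := (grading a b aT).
Local Notation kp := (@kap a b aT u v).

Definition kap_mod := forall q q' : qT, kp (q * q')%g = (kp q * kp q')%N %[mod n.+1].

(** The semidirect product of a cyclic group of order [n.+1] by the grading group. The proof [H] is
    a parameter of the type so that the group structure can be attached as an instance. *)
Definition model (H : kap_mod) : Type := ('I_n.+1 * qT)%type.

Hypothesis H : kap_mod.

HB.instance Definition _ := Finite.on (model H).

Definition model_mul (x y : model H) : model H :=
  (inZp (x.1 + kp x.2 * y.1), (x.2 * y.2)%g).
Definition model_one : model H := (ord0, 1%g).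
Definition model_inv (x : model H) : model H :=
  (inZp (n.+1 - (kp (x.2)^-1%g * x.1) %% n.+1), (x.2)^-1%g).

Lemma model_mulA : associative model_mul.
Proof.
move=> x y w; congr (_, _); last by rewrite /= mulgA.
apply: val_inj => /=; rewrite modnDml -[LHS]modnDmr modnMmr modnDmr.
rewrite -[RHS]modnDmr -[in RHS]modnMml H modnMml modnDmr.
by congr (_ %% _)%N; rewrite mulnDr mulnA addnA.
Qed.

Lemma model_mul1 : left_id model_one model_mul.
Proof.
move=> [i q]; congr (_, _); last by rewrite /= mul1g.
by apply: val_inj; rewrite /= /kap /= !expn0 !mul1n add0n modn_small.
Qed.

Lemma model_mulV : left_inverse model_one model_inv model_mul.
Proof.
move=> [i q]; congr (_, _); last by rewrite /= mulVg.
apply: val_inj; rewrite /= modnDml -modnDmr subnK ?modnn //.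
by rewrite ltnW // ltn_pmod.
Qed.

HB.instance Definition _ :=
  Finite_isGroup.Build (model H) model_mulA model_mul1 model_mulV.

End ModelGroup.

Section ModelBasis.

Variables (F : fieldType) (s t : {rmorphism F -> F}) (a b : nat) (aT : finGroupType).
Variables (n N : nat) (z : F) (u v d : nat) (B : aT -> aT -> nat).
Hypothesis C : crossed_data s t a b n z u v d B.
Hypothesis zP : N.-primitive_root z.
Hypothesis nN : (n.+1 %| N)%N.

Local Notation qT := (grading a b aT).

Lemma crossed_kap_mod : @kap_mod n a b aT u v.
Proof.
move=> q q'; have := kapM C q q' 1; rewrite !muln1 => /eqP.
rewrite (eq_prim_root_expr zP) => /eqP /(congr1 (modn^~ n.+1)).
by rewrite !modn_dvdm.
Qed.

Local Notation M := (model crossed_kap_mod).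

Lemma model_basis :
  crossed_basis s t n z (fun h : M => z ^+ h.1) (fun h : M => h.2).
Proof.
have z0 := z_neq0 C; split=> //.
- by move=> h; rewrite expf_neq0.
- move=> h; have := @span_sum _ s t n z unit (fun=> 1) (fun=> h.1) (fun=> fixed1 s t).
  by rewrite (big_pred1 tt) ?mul1r // => -[].
- move=> h h'; rewrite (theta_z C) -exprD.
  by apply: fixed_sym; apply: fixed_zmod C _.
- move=> h c qh h1 cK hc.
  have S0 : \sum_i (c i - (i == h.1)%:R) * z ^+ i = 0.
    under eq_bigr => i _ do rewrite mulrBl.
    rewrite sumrB -hc (bigD1 h.1) //= eqxx mul1r big1 ?addr0 ?subrr // => i /negPf->.
    by rewrite mul0r.
  have cK' i : c i - (i == h.1)%:R \in fixedK s t.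
    by rewrite rpredB // rpred_nat.
  have := span_free C (e := id) cK' (fun _ _ => id) S0 ord0.
  case: eqP => [h0|_]; last by rewrite subr0.
  by case/eqP: h1; rewrite [h]surjective_pairing qh -h0.
by rewrite card_prod card_ord.
Qed.

End ModelBasis.

(** The monomials form a crossed basis indexed by the model group, so the last hypothesis already
    identifies that group with [gT]. Thus [gT] receives coordinates without a normal form for its
    presentation. *)
Lemma crossed_rigid (F : fieldType) (s t : {rmorphism F -> F}) (a b : nat)
    (aT : finGroupType) (n N : nat) (z : F) (u v d : nat) (B : aT -> aT -> nat)
    (gT : finGroupType) :
    [pchar F] =i pred0 -> crossed_data s t a b n z u v d B ->
    N.-primitive_root z -> (n.+1 %| N)%N ->
    (forall (hT : finGroupType) (x : hT -> F) (q : hT -> grading a b aT),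
       crossed_basis s t n z x q -> ([set: hT] \isog [set: gT])%g) ->
  exists (k : fieldType) (f : gT -> gT -> k),
    cocycle f /\ central_simple f /\
    (forall (hT : finGroupType) (g : hT -> hT -> k),
       cocycle g -> tga_iso f g -> ([set: hT] \isog [set: gT])%g).
Proof.
move=> ch0 C zP nN iso.
have isoM := iso _ _ _ (model_basis C zP nN).
rewrite isog_sym in isoM; have [phi injphi imphi] := isogP isoM.
have phiM x y : phi (x * y)%g = (phi x * phi y)%g by rewrite morphM ?inE.
have phiI : injective phi by move=> x y; apply: (injmP injphi); rewrite inE.
have surj p : exists x, phi x = p.
  have : p \in (phi @* [set: gT])%g by rewrite imphi inE.
  by case/morphimP => x _ _ ->; exists x.
have [z1 z1E] : exists c : fixed_field s t, fixed_iota s t c = z ^+ n.+1.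
  by exists (FixedField (cd_fixed C)).
have [||||||k [f [fC fS fB]]] := @crossed_form F (fixed_field s t) (fixed_iota s t)
  s t a b aT n z u v d B C _ _ gT (fun x => (phi x).1) (fun x => (phi x).2) _ _ _ _ z1 z1E ch0.
- by move=> c; apply: fixed_valP.
- by move=> y yK; exists (FixedField yK).
- by move=> x y; rewrite phiM.
- by move=> x y; rewrite phiM.
- move=> x y e1 e2; apply: phiI.
  by rewrite [phi x]surjective_pairing e1 e2 -surjective_pairing.
- by move=> i q; have [x xE] := surj (i, q); exists x; rewrite xE.
exists k, f; split=> //; split=> // hT g gC giso.
by have [x [q X]] := fB hT g gC giso; apply: iso X.
Qed.

(** * Choice of roots of unity *)

Definition rigid (gT : finGroupType) :=
  exists (k : fieldType) (f : gT -> gT -> k),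
    cocycle f /\ central_simple f /\
    (forall (hT : finGroupType) (g : hT -> hT -> k),
       cocycle g -> tga_iso f g -> ([set: hT] \isog [set: gT])%g).

Lemma algC_pchar0 : [pchar algC] =i pred0.
Proof. exact: Num.Theory.pchar_num. Qed.

Lemma rigid_type1 (gT aT : finGroupType) : abelian [set: aT]%g ->
  ([set: gT] \isog [set: aT * aT])%g -> rigid gT.
Proof.
move=> cA isoG; pose d := exponent [set: aT]%g.
have d0 : (0 < d)%N by apply: exponent_gt0.
have [z zP] := C_prim_root_exists d0.
have [B pB] := pairing_exists d0 cA (dvdnn _).
(* With identity morphisms and [n = 0], both [K] and [L] are [algC], and only the pairing
   remains. *)
pose id_ : {rmorphism algC -> algC} := idfun.
have C : crossed_data id_ id_ 0 0 0 z 1 1 d B.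
  by split=> //; rewrite ?expr1 ?unfold_in ?eqxx // => -[|i] [|i'] [|j] [|j'].
apply: (crossed_rigid algC_pchar0 C zP (dvd1n _)) => hT x q X.
have K_all y : y \in fixedK id_ id_ by apply: fixedP.
have h1 h : q h = 1%g -> h = 1%g by move=> qh; apply: (basis_eq1 X).
have q11 h : (q h).1 = 1%g.
  by case: (q h) => -[i j] w /=; rewrite [i]ord1 [j]ord1.
have defG : (1%G \x [set: gT]%G = [set: gT])%g by rewrite dprod1g.
apply: (crossed_isog C X (rho := 1) (hp := 1%g) (hs := 1%g) (ht := 1%g)
  _ _ _ _ _ _ _ _ _ defG isoG) => //.
- exact: oner_neq0.
- by move=> h qh _; apply: h1.
- exact: deg1 X.
- by rewrite (deg1 X) (ord1 (inord 1)).
- by rewrite (deg1 X) (ord1 (inord 1)).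
- by move=> h _; exists 0; apply/orP; left.
- apply: isog_hom; apply: trivial_isog => //.
  by apply/trivgP; rewrite gen_subG !subUset !sub1set !group1.
by rewrite cards1.
Qed.

Lemma expn_mod_inj U N M : coprime U N ->
    (forall k, 0 < k < M -> U ^ k != 1 %[mod N])%N ->
  forall i i', (i < M)%N -> (i' < M)%N -> U ^ i = U ^ i' %[mod N] -> i = i'.
Proof.
move=> coU U1 i i'; wlog le_ii' : i i' / (i <= i')%N => [wl li li' E|li li' /eqP].
  by case/orP: (leq_total i i') => le; [apply: wl | apply/esym/wl].
case: (posnP U) => [U0|U0].
  move: coU; rewrite U0 /coprime gcd0n => /eqP N1; case: (leqP M 1) => [M1|M1].
    by rewrite N1 !modn1; lia.
  by have := U1 1 M1; rewrite N1 !modn1.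
rewrite eq_sym eqn_mod_dvd; last by rewrite leq_pexp2l.
rewrite -{1}(subnKC le_ii') expnD -{2}[(U ^ i)%N]muln1 -mulnBr Gauss_dvdr; last first.
  by rewrite coprimeXr // coprime_sym.
rewrite -eqn_mod_dvd ?expn_gt0 ?U0 // => E; apply/eqP; rewrite eqn_leq le_ii' /=.
rewrite leqNgt; apply: contraL E => lt_ii'; apply: U1.
by rewrite subn_gt0 lt_ii' (leq_ltn_trans (leq_subr _ _)).
Qed.

Lemma rigid_type2 (gT aT : finGroupType) (K1 K2 : {group gT}) p N S :
    prime p -> (0 < S < N)%N -> ~~ ((p == 2) && (S == 1))%N ->
    abelian [set: aT]%g -> (p.-group [set: aT])%g -> (exponent [set: aT]%g %| p ^ S)%N ->
    (K1 \x K2 = [set: gT])%g -> (K2 \isog [set: aT * aT])%g ->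
    is_G1_type2 K1 p N S -> rigid gT.
Proof.
move=> pP /andP[S0 ltSN] pS cA pA eA defG isoK2 isoK1.
have p0 := prime_gt0 pP; have p1 := prime_gt1 pP.
have pe0 e : (0 < p ^ e)%N by rewrite expn_gt0 p0.
have [z zP] := C_prim_root_exists (pe0 (N + S)%N).
have [B pB] := pairing_exists (pe0 S) cA eA.
have cou e : coprime (p ^ S).+1 (p ^ e).
  by rewrite coprimeXr // -(coprime_pexpr _ _ S0) coprimeSn.
(* The action is prescribed one layer beyond the order of [z], as the bound on roots of unity
   requires. The order of [z] is chosen so that [z ^+ (p ^ N)] is fixed and has order [p ^ S], the
   modulus of the pairing. *)
have [s sP] := Qn_aut_exists (cou (N + S).+1).
pose id_ : {rmorphism algC -> algC} := idfun.
pose a := (p ^ N).-1.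
have aE : a.+1 = (p ^ N)%N by rewrite prednK.
have z1 : z ^+ (p ^ (N + S).+1) = 1 by rewrite expnSr exprM (prim_expr_order zP) expr1n.
have [w pw def_u] := expn_one_add_pfactorX N pP S0 pS.
rewrite [(S + N)%N]addnC -aE [(1 + p ^ S)%N]add1n in def_u.
have zu : z ^+ ((p ^ S).+1 ^ a.+1) = z.
  by rewrite def_u exprD expr1 exprM (prim_expr_order zP) expr1n mulr1.
have C : crossed_data s id_ a 0 a z (p ^ S).+1 1 (p ^ S) B.
  split=> //.
  - exact: sP.
  - by rewrite muln1.
  - move=> i i' [|j] [|j'] // li li' _ _; rewrite !exp1n !muln1 => /eqP.
    rewrite (eq_prim_root_expr zP) => /eqP ii'; split=> //.
    apply: (expn_mod_inj (cou _) _ li li' ii') => k; rewrite aE.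
    by rewrite [(N + S)%N]addnC -[(p ^ S).+1]add1n; apply: expn_one_add_neq1.
  - rewrite unfold_in /fixedK eqxx andbT rmorphXn /= (sP _ z1) aE -!exprM.
    by rewrite mulSn exprD -expnD addnC (prim_expr_order zP) mulr1.
  - rewrite aE; have := dvdn_prim_root zP (dvdn_exp2l p (leq_addl N S)).
    by rewrite expnD mulnK.
have dN : (a.+1 %| p ^ (N + S))%N by rewrite aE dvdn_exp2l // leq_addr.
apply: (crossed_rigid algC_pchar0 C zP dN) => hT x q X.
apply: (type2_isog pP _ pS aE aE zP sP C X _ defG isoK2 isoK1); first by rewrite S0.
rewrite /pgroup cardsT (cb_card X) card_prod [#|{: _ * _}|]card_prod card_prod !card_ord aE.
rewrite muln1 !pnatM !pnatX pnat_id //=.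
by move: pA; rewrite /pgroup cardsT => ->.
Qed.

Lemma expn3_mod8 (i : nat) : (3 ^ i %% 8 = if odd i then 3 else 1)%N.
Proof.
elim: i => [|i IH] //; rewrite expnS -modnMmr IH /=.
by case: (odd i).
Qed.

Lemma expn3_neq1 m k : (1 < m)%N -> (0 < k < 2 ^ m)%N -> (3 ^ k != 1 %[mod 2 ^ m.+2])%N.
Proof.
case: m => [|[|m]] // _ /andP[k0 km]; have [ok|ek] := boolP (odd k).
  apply/eqP => /(congr1 (modn^~ 8)); rewrite !modn_dvdm ?(@dvdn_exp2l 2 3) //.
  by rewrite expn3_mod8 ok.
have kE : k = (2 * k./2)%N by rewrite mul2n -[LHS]odd_double_half (negPf ek).
rewrite kE expnM (_ : m.+4 = 3 + m.+1)%N; last by lia.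
apply: (@expn_one_add_neq1 2 3) => //.
by move: k0 km; rewrite kE [(2 ^ m.+2)%N]expnS; lia.
Qed.

Lemma rigid_type3 (gT aT : finGroupType) (K1 K2 : {group gT}) m :
    (1 < m)%N ->
    abelian [set: aT]%g -> (2.-group [set: aT])%g -> (exponent [set: aT]%g %| 2)%N ->
    (K1 \x K2 = [set: gT])%g -> (K2 \isog [set: aT * aT])%g ->
    is_G1_type3 K1 m -> rigid gT.
Proof.
move=> m2 cA pA eA defG isoK2 isoK1.
have pe0 e : (0 < 2 ^ e)%N by rewrite expn_gt0.
have [z zP] := C_prim_root_exists (pe0 m.+2).
have [B pB] := pairing_exists (isT : 0 < 2)%N cA eA.
have [s sP] := @Qn_aut_exists 3 (2 ^ m.+3) (coprimeXr _ (isT : coprime 3 2)).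
pose v := (2 ^ m.+2).-1.
have vE : v.+1 = (2 ^ m.+2)%N by rewrite prednK.
have [t tP] : {t : {rmorphism algC -> algC} | forall y, y ^+ (2 ^ m.+2) = 1 -> t y = y ^+ v}.
  by apply: Qn_aut_exists; rewrite -vE coprimenS.
pose a := (2 ^ m).-1.
have aE : a.+1 = (2 ^ m)%N by rewrite prednK.
pose n := (2 ^ m.+1).-1.
have nE : n.+1 = (2 ^ m.+1)%N by rewrite prednK.
have z1 := prim_expr_order zP.
have z2 : z ^+ (2 ^ m.+3) = 1 by rewrite expnSr exprM z1 expr1n.
have [w ow def_w] := expn3_pow2 m2; rewrite -aE in def_w.
have v8 : (v %% 8 = 7)%N.
  have v4 : (2 ^ m.+2 = 8 * 2 ^ m.-1)%N by rewrite (_ : m.+2 = 3 + m.-1)%N ?expnD //; lia.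
  by have := pe0 m.-1; rewrite /v v4; lia.
have v2 : (v * v = 1 + 2 ^ m.+2 * v.-1)%N.
  have : (0 < v)%N by case: (v) v8.
  by rewrite -vE; nia.
have vv : (v * v = 1 %[mod 2 ^ m.+2])%N by rewrite v2 addnC mulnC modnMDl.
have C : crossed_data s t a 1 n z 3 v 2 B.
  split=> //.
  - exact: sP.
  - exact: tP.
  - by rewrite def_w exprD expr1 exprM z1 expr1n mulr1.
  - by rewrite expnS expn1 v2 exprD expr1 exprM z1 expr1n mulr1.
  - by rewrite nE aE expnSr.
  - move=> i i' j j' li li' lj lj' /eqP; rewrite (eq_prim_root_expr zP) => /eqP E.
    (* Powers of [3] are [1] or [3] modulo [8], whereas [v], which is [-1], is [7]; reduction modulo
       [8] therefore detects the exponent of [v]. *)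
    have jj' : j = j'.
      have d8 : (8 %| 2 ^ m.+2)%N by apply: (@dvdn_exp2l 2 3); lia.
      move: E => /(congr1 (modn^~ 8)); rewrite !(modn_dvdm _ d8).
      rewrite -modnMml -[in RHS]modnMml !expn3_mod8 -modnMmr -[in RHS]modnMmr.
      case: j j' lj lj' => [|[|j]] [|[|j']] // _ _; rewrite ?expn1 ?v8;
        by case: (odd i) (odd i') => [] [].
    split=> //; apply: (@expn_mod_inj 3 (2 ^ m.+2) a.+1) => //.
    + by rewrite coprimeXr.
    + by move=> k; rewrite aE; apply: expn3_neq1.
    have VV : (v ^ j' * v ^ j' = 1 %[mod 2 ^ m.+2])%N.
      by rewrite -expnMn -modnXm vv modnXm exp1n.
    have e k : (3 ^ k = 3 ^ k * v ^ j' * v ^ j' %[mod 2 ^ m.+2])%N.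
      by rewrite -mulnA -modnMmr VV modnMmr muln1.
    by rewrite e -modnMml -{1}jj' E modnMml -e.
  - rewrite (half_turn nE zP); apply: fixedP; exact: rmorphN1.
  - have := dvdn_prim_root zP (dvdn_exp2l 2 (ltn0Sn m.+1)).
    by rewrite expn1 expnSr mulnK // nE.
have dN : (n.+1 %| 2 ^ m.+2)%N by rewrite nE dvdn_exp2l.
apply: (crossed_rigid algC_pchar0 C zP dN) => hT x q X.
apply: (type3_isog m2 aE nE zP vE sP C X _ defG isoK2 isoK1).
rewrite /pgroup cardsT (cb_card X) card_prod [#|{: _ * _}|]card_prod card_prod !card_ord aE nE.
rewrite !pnatM !pnatX /=.
by move: pA; rewrite /pgroup cardsT => ->.
Qed.

Local Close Scope ring_scope.

(** * From the list of groups to the three rigidity results *)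

Lemma symmetric_type_square (gT : finGroupType) (K : {group gT}) : symmetric_type K ->
  exists aT : finGroupType, [/\ abelian [set: aT]%g, K \isog [set: aT * aT]%g,
    (exponent [set: aT]%g %| exponent K) &
    forall p, (p.-group K)%g -> (p.-group [set: aT])%g].
Proof.
move=> [cK [A1 [A2 [defK isoA]]]]; exists (subg_of A1).
have [sA1 _] := mulG_sub (dprodW defK).
have iso1 : (A1 \isog [set: subg_of A1])%g := isog_subg A1.
have isoS : ([set: subg_of A1] \isog A1)%g by rewrite isog_sym.
split.
- by rewrite (isog_abelian isoS); apply: abelianS cK.
- have := setX_dprod [set: subg_of A1]%G [set: subg_of A1]%G.
  have -> : setX [set: subg_of A1] [set: subg_of A1] = [set: subg_of A1 * subg_of A1].
    by apply/setP => y; rewrite !inE.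
  have i1 := isog_trans iso1 (isog_setX1 (subg_of A1) [set: subg_of A1]%G).
  have isoA2 : (A2 \isog A1)%g by rewrite isog_sym.
  have i2 := isog_trans isoA2 (isog_trans iso1 (isog_set1X (subg_of A1) [set: subg_of A1]%G)).
  by move=> defX; apply: (isog_dprod defK defX i1 i2).
- by rewrite (exponent_isog isoS) exponentS.
by move=> p pK; rewrite /pgroup (card_isog isoS); apply: pgroupS pK.
Qed.

Lemma pgroup_exponent_dvd (gT : finGroupType) (K : {group gT}) p e : prime p ->
  (p.-group K)%g -> exponent K <= p ^ e -> exponent K %| p ^ e.
Proof.
move=> pP pK; have [k ->] : exists k, exponent K = p ^ k.
  have pe : p.-nat (exponent K) by rewrite pnat_exponent.
  by have [k ->] := p_natP pe; exists k.
by rewrite leq_exp2l ?prime_gt1 //; apply: dvdn_exp2l.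
Qed.

Theorem theorem5 (gT : finGroupType) :
  in_Lambda [set: gT]%G -> ~ has_Z4_Z2Z2_factor [set: gT]%G ->
  exists (k : fieldType) (f : gT -> gT -> k),
    cocycle f /\ central_simple f /\
    (forall (hT : finGroupType) (g : hT -> hT -> k),
       cocycle g -> tga_iso f g -> ([set: hT] \isog [set: gT])%g).
Proof.
move=> [p [pP [pG typeG]]] noZ4; rewrite -/(rigid gT).
case: typeG => [symG|[n [s [K1 [K2 [ltsn ps defG isoK1 [symK2 eK2]]]]]]|
    [p2 [n [K1 [K2 [n1 defG isoK1 symK2 eK2]]]]]].
- by have [aT [cA isoG _ _]] := symmetric_type_square symG; apply: rigid_type1 cA isoG.
- have [_ sK2] := mulG_sub (dprodW defG).
  have pK2 := pgroupS sK2 pG.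
  have [aT [cA isoK2 eA pA]] := symmetric_type_square symK2.
  apply: (rigid_type2 pP ltsn ps cA (pA _ pK2) _ defG isoK2 isoK1).
  exact: dvdn_trans eA (pgroup_exponent_dvd pP pK2 eK2).
subst p; have [_ sK2] := mulG_sub (dprodW defG).
have pK2 := pgroupS sK2 pG.
have [aT [cA isoK2 eA pA]] := symmetric_type_square symK2.
(* For [n = 1] the presentation of [K1] is that of the excluded direct factor. *)
have n2 : 1 < n.
  rewrite ltn_neqAle n1 andbT eq_sym; apply/eqP => def_n; case: noZ4.
  by exists K1, K2; split=> //; rewrite def_n in isoK1.
apply: (rigid_type3 n2 cA (pA _ pK2) _ defG isoK2 isoK1).
exact: dvdn_trans eA (@pgroup_exponent_dvd _ _ 2 1 pP pK2 eK2).
Qed.
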